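(* Let $(\varphi_{s,t})$ be an evolution family of order $d\in[1,+\infty]$ and let $\beta:=\lim_{t\to+\infty}\frac{|\varphi_{0,t}'(0)|}{1-|\varphi_{0,t}(0)|^2}$. Then there exists a normalized Loewner chain $(f_t)$ of order $d$ associated with $(\varphi_{s,t})$ such that $\Omega:=\bigcup_{t\ge0}f_t(\mathbb D)$ coincides with the disk $\{z:|z|<1/\beta\}$ if $\beta>0$ and with $\mathbb C$ if $\beta=0$.
   Context: $\mathbb D$ is the open unit disk. For $d\in[1,+\infty]$, an evolution family of order $d$ is a family $(\varphi_{s,t})_{0\le s\le t<+\infty}$ of holomorphic self-maps of $\mathbb D$ with $\varphi_{s,s}=\mathrm{id}_{\mathbb D}$, $\varphi_{s,t}=\varphi_{u,t}\circ\varphi_{s,u}$ for $0\le s\le u\le t$, and such that for every $z\in\mathbb D$, $T>0$ there is a non-negative $k_{z,T}\in L^d([0,T])$ with $|\varphi_{s,u}(z)-\varphi_{s,t}(z)|\le\int_u^tk_{z,T}$ for all $0\le s\le u\le t\le T$. A Loewner chain of order $d$ is a family $(f_t)_{t\ge0}$ of univalent holomorphic maps $f_t:\mathbb D\to\mathbb C$ with $f_s(\mathbb D)\subset f_t(\mathbb D)$ for $s<t$ and such that for every compact $K\subset\mathbb D$ and $T>0$ there is a non-negative $k_{K,T}\in L^d([0,T])$ with $|f_s(z)-f_t(z)|\le\int_s^tk_{K,T}$ for $z\in K$, $0\le s\le t\le T$. It is normalized if $f_0(0)=0$, $f_0'(0)=1$, and associated with $(\varphi_{s,t})$ if $f_t\circ\varphi_{s,t}=f_s$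 for all $0\le s\le t$. *)

(* Defs.v *)
From mathcomp Require Import all_boot all_order all_algebra.
From mathcomp Require Import all_classical all_reals all_analysis.
From mathcomp Require Export complex.
Import numFieldNormedType.Exports.
Import Order.TTheory GRing.Theory Num.Theory.
Set Implicit Arguments. Unset Strict Implicit. Unset Printing Implicit Defensive.
Local Open Scope ring_scope.
Local Open Scope classical_set_scope.

(* The complex plane, seen as a normed space over itself (so that 'D_1 and
   derivable are complex derivatives, and topology is the usual one). *)
Notation Cplx R := ((R[i])^o).

(* the modulus |z| of a complex number, as a real number
   (the num-norm `|z| of R[i] is a real element of R[i]; we take its real part) *)
Definition cmod (R : realType) (z : Cplx R) : R := complex.Re `|z|.

Definition disk (R : realType) : set (Cplx R) := [set z | `|z| < 1].

Definition holomorphic_on (R : realType) (A : set (Cplx R)) (f : Cplx R -> Cplx R) :=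
  forall z, A z -> derivable f z 1.

Definition holo_self_map (R : realType) (f : Cplx R -> Cplx R) :=
  holomorphic_on (@disk R) f /\ (forall z, disk z -> disk (f z)).

Definition univalent (R : realType) (f : Cplx R -> Cplx R) :=
  holomorphic_on (@disk R) f /\
  (forall z w, disk z -> disk w -> f z = f w -> z = w).

Definition Ld_nonneg (R : realType) (d : \bar R) (T : R) (k : R -> R) :=
  (forall x, 0 <= k x) /\
  measurable_fun `[0, T] k /\
  (Lnorm (mrestr (@lebesgue_measure R) (measurable_itv (Interval (BLeft 0%R) (BRight T))))
         d (EFin \o k) < +oo)%E.

Definition int_itv (R : realType) (k : R -> R) (u t : R) : \bar R :=
  (\int[@lebesgue_measure R]_(x in `[u, t]) (k x)%:E)%E.

Definition evolution_family (R : realType) (d : \bar R)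
    (phi : R -> R -> Cplx R -> Cplx R) : Prop :=
  [/\ (forall s t, 0 <= s -> s <= t -> holo_self_map (phi s t)),
      (forall s z, 0 <= s -> disk z -> phi s s z = z),
      (forall s u t z, 0 <= s -> s <= u -> u <= t -> disk z ->
          phi s t z = phi u t (phi s u z)) &
      (forall z T, disk z -> 0 < T -> exists k : R -> R,
          Ld_nonneg d T k /\
          forall s u t, 0 <= s -> s <= u -> u <= t -> t <= T ->
            ((cmod (phi s u z - phi s t z))%:E <= int_itv k u t)%E)].

Definition loewner_chain (R : realType) (d : \bar R)
    (f : R -> Cplx R -> Cplx R) : Prop :=
  [/\ (forall t, 0 <= t -> univalent (f t)),
      (forall s t, 0 <= s -> s < t -> f s @` (@disk R) `<=` f t @` (@disk R)) &
      (forall (K : set (Cplx R)) T, compact K -> K `<=` (@disk R) -> 0 < T ->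
         exists k : R -> R,
          Ld_nonneg d T k /\
          forall z s t, K z -> 0 <= s -> s <= t -> t <= T ->
            ((cmod (f s z - f t z))%:E <= int_itv k s t)%E)].

Definition normalized_chain (R : realType) (f : R -> Cplx R -> Cplx R) : Prop :=
  f 0 0 = 0 /\ 'D_1 (f 0) 0 = 1.

Definition associated_chain (R : realType) (f : R -> Cplx R -> Cplx R)
    (phi : R -> R -> Cplx R -> Cplx R) : Prop :=
  forall s t z, 0 <= s -> s <= t -> disk z -> f t (phi s t z) = f s z.

(* Main.v *)
(* Let [a_t = phi_{0,t}(0)] and let [m_t] be the automorphism of the disk sending [a_t] to [0].
   The maps [psi_{s,t} = m_t o phi_{s,t} o m_s^-1] fix [0], and
   [psi_{s,t}'(0) = la_t / la_s] with [la_t = (m_t o phi_{0,t})'(0)], so that [|la_t|] decreases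
   to [beta].  The chain is [f_s = g_s o m_s] with [g_s = lim_t psi_{s,t} / la_t].  The limit exists
   because [F_{t,u} = psi_{t,u} la_t / la_u] is close to the identity where it matters: if
   [beta > 0], then [|psi_{t,u}'(0)|] tends to [1] and the Schwarz-Pick lemma applies; if
   [beta = 0], then [|F_{t,u}(w) - w| <= 18 |w|^2] on [|w| < 1/2] while [psi_{s,t}] tends to [0].
   Injectivity of [g_s] and the determination of the union of the ranges use that a perturbation of
   the identity with small Lipschitz constant is injective and nearly onto.

   The uniform estimates in [t] follow from the pointwise ones at [0] and [1/2]:
   a self-map of the disk satisfies
   [(1 - r) |phi(z) - z| <= 60 (|phi(0)| + |phi(1/2) - 1/2|)] for [|z| <= r < 1].

   Complex differentiability at every point is the only notion of holomorphy, so Goursat's lemma, the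
   maximum principle, the removability of the singularity of a difference quotient, Weierstrass'
   theorem and the Schwarz-Pick lemma are derived from it. *)
Require Import Defs.
From mathcomp Require Import all_boot all_order all_algebra.
From mathcomp Require Import all_classical all_reals all_analysis.
From mathcomp Require Import complex ring lra ess_sup_inf measurable_realfun.
Import numFieldNormedType.Exports.
Import Order.TTheory GRing.Theory Num.Theory.
Set Implicit Arguments. Unset Strict Implicit. Unset Printing Implicit Defensive.
Local Open Scope ring_scope.
Local Open Scope classical_set_scope.
Local Notation Re := complex.Re.
Local Notation Im := complex.Im.
Local Notation cj := conjc.

(** * Modulus and differentiability on the complex plane *)

Section Modulus.
Variable R : realType.
Implicit Types (z w : Cplx R) (x y e : R).

(** What is global in time comes from short steps: for [s <= t <= T] with [t - s] small, [phi_{s,t}]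
    is uniformly close to the identity on each smaller disk. Injectivity of [phi_{s,t}],
    non-vanishing of [la_t] and the growth bound for [psi_{s,t}] are stable under composition, so
    they are proved for short steps and propagated along a subdivision.

    The obstacle in the limit is the division by [la_t], which may tend to [0]: [F_{t,u}] has to be
    close to the identity relative to [|la_t|], on a disk containing the image of [|z| <= r] under
    [psi_{s,t}]. When [beta = 0], the growth bound makes that image shrink at the rate of [|la_t|],
    while the error is quadratic in the radius. Univalence of [g_s] is then read off from
    [g_s = g_t o psi_{s,t}] at a single large [t], for which [la_t g_t] is injective on the
    image. *)

Lemma cmodE z : `|z| = (cmod z)%:C%C.
Proof. by rewrite /cmod (normc_def z). Qed.

Lemma cmod_sqrt z : cmod z = Num.sqrt (Re z ^+ 2 + Im z ^+ 2).
Proof. by rewrite /cmod (normc_def z). Qed.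

Lemma cmod_ge0 z : 0 <= cmod z.
Proof. by rewrite cmod_sqrt sqrtr_ge0. Qed.

Lemma cmod_sq z : cmod z ^+ 2 = Re z ^+ 2 + Im z ^+ 2.
Proof. by rewrite cmod_sqrt sqr_sqrtr// addr_ge0 ?sqr_ge0. Qed.

Lemma cmodM z w : cmod (z * w) = cmod z * cmod w.
Proof. by apply: complexI; rewrite rmorphM /= -!cmodE normrM. Qed.

Lemma cmodV z : cmod (z^-1) = (cmod z)^-1.
Proof. by apply: complexI; rewrite (fmorphV (real_complex R)) /= -!cmodE normfV. Qed.

Lemma cmod_div z w : cmod (z / w) = cmod z / cmod w.
Proof. by rewrite cmodM cmodV. Qed.

Lemma cmodN z : cmod (- z) = cmod z.
Proof. by apply: complexI; rewrite -!cmodE normrN. Qed.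

Lemma cmodB z w : cmod (z - w) = cmod (w - z).
Proof. by rewrite -cmodN opprB. Qed.

Lemma cmod0 : cmod (0 : Cplx R) = 0.
Proof. by apply: complexI; rewrite -!cmodE normr0. Qed.

Lemma cmod1 : cmod (1 : Cplx R) = 1.
Proof. by apply: complexI; rewrite -!cmodE normr1. Qed.

Lemma cmod_eq0 z : (cmod z == 0) = (z == 0).
Proof. by rewrite -[RHS]normr_eq0 cmodE eq_complex /= eqxx andbT. Qed.

Lemma cmod_gt0 z : (0 < cmod z) = (z != 0).
Proof. by rewrite lt_def cmod_ge0 andbT cmod_eq0. Qed.

Lemma cmodD_le z w : cmod (z + w) <= cmod z + cmod w.
Proof. by rewrite -lecR rmorphD /= -!cmodE ler_normD. Qed.

Lemma cmodB_le z w : cmod (z - w) <= cmod z + cmod w.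
Proof. by rewrite -(cmodN w) cmodD_le. Qed.

Lemma cmod_subr_le z w : cmod z - cmod w <= cmod (z - w).
Proof. by rewrite lerBlDr; apply: le_trans (cmodD_le _ _); rewrite subrK. Qed.

Lemma cmod_real x : cmod (x%:C%C : Cplx R) = `|x|.
Proof. by rewrite cmod_sqrt /= expr0n addr0 sqrtr_sqr. Qed.

Lemma Re_le_cmod z : `|Re z| <= cmod z.
Proof. by rewrite cmod_sqrt -sqrtr_sqr ler_wsqrtr// lerDl sqr_ge0. Qed.

Lemma Im_le_cmod z : `|Im z| <= cmod z.
Proof. by rewrite cmod_sqrt -sqrtr_sqr ler_wsqrtr// lerDr sqr_ge0. Qed.

Lemma cmod_le_ReIm z : cmod z <= `|Re z| + `|Im z|.
Proof.
rewrite cmod_sqrt -[leRHS]ger0_norm ?addr_ge0// -sqrtr_sqr ler_wsqrtr//.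
by rewrite sqrrD !real_normK ?num_real// lerD2r lerDl mulrn_wge0// mulr_ge0.
Qed.

Lemma cReD z w : Re (z + w) = Re z + Re w.
Proof. by case: z w => [? ?] [? ?]. Qed.
Lemma cReB z w : Re (z - w) = Re z - Re w.
Proof. by case: z w => [? ?] [? ?]. Qed.
Lemma cImD z w : Im (z + w) = Im z + Im w.
Proof. by case: z w => [? ?] [? ?]. Qed.
Lemma cImB z w : Im (z - w) = Im z - Im w.
Proof. by case: z w => [? ?] [? ?]. Qed.
Lemma cReM z w : Re (z * w) = Re z * Re w - Im z * Im w.
Proof. by case: z w => [? ?] [? ?]. Qed.
Lemma cImM z w : Im (z * w) = Re z * Im w + Im z * Re w.
Proof. by case: z w => [? ?] [? ?]. Qed.

Lemma diskP z : disk z <-> cmod z < 1.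
Proof. by rewrite /disk /= cmodE -[1]/((1 : R)%:C%C) ltcR. Qed.

Lemma gt0_real (e : R[i]) : 0 < e -> 0 < Re e /\ e = (Re e)%:C%C.
Proof.
case: e => a b; rewrite ltcE /= => /andP[/eqP -> h]; split => //.
Qed.

(** The norm of [Cplx R] has values in [R[i]], so balls have complex radii. A positive complex
    number is real, which lets all estimates be made with the real-valued [cmod]. *)
Lemma cnbhsP z (P : set (Cplx R)) :
  nbhs z P <-> exists2 d : R, 0 < d & forall w, cmod (w - z) < d -> P w.
Proof.
split.
  move=> /nbhs_ballP[e /gt0_real[e0 ee] eP]; exists (Re e) => // w wz.
  apply: eP; rewrite -ball_normE /= distrC ee cmodE ltcR //.
move=> [d d0 dP]; apply/nbhs_ballP; exists (d%:C%C).
  by rewrite /= -[0]/((0 : R)%:C%C) ltcR.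
move=> w; rewrite -ball_normE /= distrC cmodE ltcR; exact: dP.
Qed.

Lemma ccvgP (T : Type) (F : set_system T) {FF : Filter F} (f : T -> Cplx R) l :
  f @ F --> l <-> forall e, 0 < e -> \forall t \near F, cmod (f t - l) <= e.
Proof.
split.
  move=> fl e e0; have /fl// : nbhs l [set w | cmod (w - l) <= e].
  by apply/cnbhsP; exists e => // w; exact: ltW.
move=> H A /cnbhsP[d d0 dA]; have := H (d / 2) (divr_gt0 d0 (ltr0Sn _ 1)).
apply: filterS => t ht; apply: dA; apply: le_lt_trans ht _.
by rewrite ltr_pdivrMr// ltr_pMr// ltr1n.
Qed.

Lemma ccontP (f : Cplx R -> Cplx R) z :
  {for z, continuous f} <->
  forall e, 0 < e -> exists2 d : R, 0 < d & forall w, cmod (w - z) < d -> cmod (f w - f z) <= e.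
Proof.
by split=> [/(@ccvgP _ (nbhs z)) H e /H /cnbhsP//|H]; apply/(@ccvgP _ (nbhs z)) => e /H ?; exact/cnbhsP.
Qed.

(** Division-free differentiability: such increment estimates add and compose without excluding
    [h = 0]. *)
Definition cdiff (f : Cplx R -> Cplx R) z (l : Cplx R) := forall e, 0 < e ->
  exists2 d : R, 0 < d & forall h, cmod h < d ->
    cmod (f (z + h) - f z - l * h) <= e * cmod h.

Lemma cdiffP f z l : cdiff f z l <-> is_derive z 1 f l.
Proof.
have E : cdiff f z l <->
    (fun h : Cplx R => h^-1 *: (f (h *: 1 + z) - f z)) @ 0^' --> l.
  split.
    move=> H; apply/ccvgP => e /H[d d0 dP]; rewrite near_withinE.
    apply/cnbhsP; exists d => // h; rewrite subr0 => hd h0.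
    rewrite -(ler_pM2r (x := cmod h)) ?cmod_gt0// -cmodM.
    apply: le_trans (dP h hd); rewrite le_eqVlt; apply/orP; left; apply/eqP.
    congr cmod; rewrite /GRing.scale /= mulr1 [h + z]addrC.
    by field.
  move=> /ccvgP H e /H; rewrite near_withinE => /cnbhsP[d d0 dP]; exists d => // h hd.
  have [->|h0] := eqVneq h 0.
    by rewrite mulr0 addr0 !subr0 subrr cmod0 mulr0.
  have := dP h; rewrite subr0 => /(_ hd h0).
  rewrite -(ler_pM2r (x := cmod h)) ?cmod_gt0// -cmodM.
  apply: le_trans; rewrite le_eqVlt; apply/orP; left; apply/eqP.
  congr cmod; rewrite /GRing.scale /= mulr1 [h + z]addrC.
  by field.
split.
  move/E => H; have Hd : derivable f z 1 by apply/cvg_ex; exists l.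
  by apply: (DeriveDef Hd); exact: (cvg_lim (@norm_hausdorff _ _) H).
move=> [H1 H2]; apply/E; rewrite -H2; exact: H1.
Qed.

Lemma derivable_cdiff f z : derivable f z 1 -> cdiff f z ('D_1 f z).
Proof. by move/derivableP/cdiffP. Qed.

Lemma cdiff_derivable f z l : cdiff f z l -> derivable f z 1.
Proof. by move/cdiffP => []. Qed.

Lemma cdiff_D f z l : cdiff f z l -> 'D_1 f z = l.
Proof. by move/cdiffP => []. Qed.

Lemma derivable_cont (f : Cplx R -> Cplx R) z : derivable f z 1 -> {for z, continuous f}.
Proof. by move/(derivable1_diffP f z)/differentiable_continuous. Qed.

Lemma cdiff_comp (f g : Cplx R -> Cplx R) z lf lg : cdiff f z lf -> cdiff g (f z) lg ->
  cdiff (g \o f) z (lg * lf).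
Proof.
move=> /cdiffP df dg e e0.
have fc : {for z, continuous f} by apply: derivable_cont; case: df.
move/cdiffP: df => df.
(* [k] bounds the slope of [f] near [z] and [m] bounds [|lg|]; the added [1] keeps both positive as
   divisors. *)
set k := cmod lf + 1; have k0 : 0 < k by rewrite /k ltr_wpDl ?cmod_ge0.
pose m := cmod lg + 1; have m0 : 0 < m by rewrite /m ltr_wpDl ?cmod_ge0.
have [d1 d10 H1] := df 1 ltr01.
have [d2 d20 H2] := df (e / 2 / m) (divr_gt0 (divr_gt0 e0 (ltr0Sn _ 1)) m0).
have [d3 d30 H3] := dg (e / 2 / k) (divr_gt0 (divr_gt0 e0 (ltr0Sn _ 1)) k0).
exists (Num.min (Num.min d1 d2) (d3 / k)).
  by rewrite !lt_min d10 d20 divr_gt0.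
move=> h; rewrite !lt_min => /andP[/andP[hd1 hd2] hd3].
have fk : cmod (f (z + h) - f z) <= k * cmod h.
  rewrite -(subrK (lf * h) (f (z + h) - f z)); apply: le_trans (cmodD_le _ _) _.
  by rewrite /k mulrDl addrC cmodM lerD2l; exact: H1.
have f3 : cmod (f (z + h) - f z) < d3.
  apply: le_lt_trans fk _; move: hd3; rewrite ltr_pdivlMr// mulrC //.
have := H3 _ f3; rewrite [f z + _]addrC subrK => G3.
have G2 := H2 _ hd2.
have -> : (g \o f) (z + h) - (g \o f) z - lg * lf * h =
   (g (f (z + h)) - g (f z) - lg * (f (z + h) - f z)) +
   lg * (f (z + h) - f z - lf * h) by rewrite /=; ring.
apply: le_trans (cmodD_le _ _) _; rewrite [e]splitr mulrDl lerD//.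
  apply: le_trans G3 _; apply: le_trans (ler_wpM2l _ fk) _.
    by rewrite divr_ge0 ?divr_ge0 ?ltW.
  by rewrite mulrA divfK ?gt_eqF.
rewrite cmodM; apply: (@le_trans _ _ (m * (e / 2 / m * cmod h))).
  rewrite ler_pM ?cmod_ge0// /m lerDl//.
by rewrite mulrA [m * _]mulrC divfK ?gt_eqF.
Qed.

Lemma derivable_compc (f g : Cplx R -> Cplx R) z : derivable f z 1 -> derivable g (f z) 1 ->
  derivable (g \o f) z 1.
Proof.
by move=> /derivable_cdiff df /derivable_cdiff dg; apply: cdiff_derivable (cdiff_comp df dg).
Qed.

Lemma D_comp (f g : Cplx R -> Cplx R) z : derivable f z 1 -> derivable g (f z) 1 ->
  'D_1 (g \o f) z = 'D_1 g (f z) * 'D_1 f z.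
Proof.
by move=> /derivable_cdiff df /derivable_cdiff dg; apply: cdiff_D (cdiff_comp df dg).
Qed.

Lemma cdiff_near (f g : Cplx R -> Cplx R) z l r : 0 < r ->
  (forall w, cmod (w - z) < r -> f w = g w) -> cdiff f z l -> cdiff g z l.
Proof.
move=> r0 fg fl e /fl[d d0 dP]; exists (Num.min d r); first by rewrite lt_min d0.
move=> h; rewrite lt_min => /andP[hd hr].
by rewrite -!fg ?subrr ?cmod0//; [exact: dP|rewrite addrC addKr].
Qed.

Lemma derivable_near (f g : Cplx R -> Cplx R) z r : 0 < r ->
  (forall w, cmod (w - z) < r -> f w = g w) -> derivable f z 1 -> derivable g z 1.
Proof. by move=> r0 fg /derivable_cdiff/(cdiff_near r0 fg)/cdiff_derivable. Qed.

Lemma D_near (f g : Cplx R -> Cplx R) z r : 0 < r ->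
  (forall w, cmod (w - z) < r -> f w = g w) -> derivable f z 1 -> 'D_1 g z = 'D_1 f z.
Proof. by move=> r0 fg /derivable_cdiff/(cdiff_near r0 fg)/cdiff_D. Qed.

(** Real and imaginary parts are 1-Lipschitz, so both are Cauchy, and completeness of the reals
    gives the coordinates of the limit. *)
Lemma cauchy_cvgc (c : nat -> Cplx R) :
  (forall e, 0 < e -> exists N, forall n, (N <= n)%N -> cmod (c n - c N) <= e) ->
  exists l, forall e, 0 < e -> exists N, forall n, (N <= n)%N -> cmod (c n - l) <= e.
Proof.
move=> H.
have G (p : R[i] -> R) : (forall z w, p (z - w) = p z - p w) ->
    (forall z, `|p z| <= cmod z) -> cvgn (p \o c).
  move=> pB ple; suff ce : cauchy_ex (p \o c @ \oo).
    by apply: R_complete; exact: cauchy_exP ce.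
  move=> e e0.
  have [N NP] := H (e / 2) (divr_gt0 e0 (ltr0Sn _ 1)).
  exists (p (c N)); exists N => //= n Nn; rewrite -ball_normE /= -/(`|p (c N) - p (c n)| < e) -pB.
  apply: le_lt_trans (ple _) _; rewrite cmodB.
  apply: (@le_lt_trans _ _ (e / 2)); last by rewrite ltr_pdivrMr// ltr_pMr// ltr1n.
  exact: NP.
have /cvg_ex[/= a ca] := G (@Re R) (@cReB) (@Re_le_cmod).
have /cvg_ex[/= b cb] := G (@Im R) (@cImB) (@Im_le_cmod).
exists (Complex a b) => e e0; have e20 := divr_gt0 e0 (ltr0Sn _ 1).
have [N1 _ H1] := @cvgr_dist_le _ _ _ _ _ _ _ ca _ e20.
have [N2 _ H2] := @cvgr_dist_le _ _ _ _ _ _ _ cb _ e20.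
exists (maxn N1 N2) => n; rewrite geq_max => /andP[n1 n2].
apply: le_trans (cmod_le_ReIm _) _; rewrite cReB cImB [leRHS]splitr.
by rewrite lerD// distrC; [exact: H1|exact: H2].
Qed.

End Modulus.

(** * Goursat's lemma *)

Section Goursat.
Variable R : realType.
Implicit Types (a b c d x y e k : R) (f g : R -> R).

Definition sint a b f : R := (\int[@lebesgue_measure R]_(x in `[a, b]) f x)%R.

Definition cont_on a b f := forall x, a <= x <= b -> {for x, continuous f}.

Lemma cont_on_integrable a b f : cont_on a b f ->
  (@lebesgue_measure R).-integrable `[a, b] (EFin \o f).
Proof.
move=> fc; apply: continuous_compact_integrable; first exact: segment_compact.
apply: continuous_in_subspaceT => x; rewrite inE /= in_itv /=; exact: fc.
Qed.

Lemma eq_sint a b f g : (forall x, a <= x <= b -> f x = g x) -> sint a b f = sint a b g.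
Proof.
by move=> fg; apply: eq_Rintegral => x; rewrite inE /= in_itv /= => /fg.
Qed.

Lemma sintB a b f g : cont_on a b f -> cont_on a b g ->
  sint a b (fun x => f x - g x) = sint a b f - sint a b g.
Proof. by move=> fc gc; apply: RintegralB => //; exact: cont_on_integrable. Qed.

Lemma sint_cat a b c f : a <= b -> b <= c -> cont_on a c f ->
  sint a c f = sint a b f + sint b c f.
Proof.
move=> ab bc fc; apply/eqP; rewrite addrC -subr_eq; apply/eqP.
rewrite /sint Rintegral_itvB ?bnd_simp//; last exact: cont_on_integrable.
rewrite Rintegral_itv_obnd_cbnd//.
apply: integrableS (cont_on_integrable fc) => //.
by apply: subset_itv; rewrite bnd_simp.
Qed.

Lemma sint_cst a b k : a <= b -> sint a b (fun=> k) = k * (b - a).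
Proof.
move=> ab; rewrite /sint Rintegral_cst//; congr (_ * _).
transitivity (fine (@lebesgue_measure R [set` `[a, b]%R])) => //.
rewrite lebesgue_measure_itv /= lte_fin.
by case: ltgtP ab => //= ->; rewrite subrr.
Qed.

Lemma cont_cst a b k : cont_on a b (fun=> k).
Proof. by move=> x _; exact: cvg_cst. Qed.

Lemma sint_le a b f g : cont_on a b f -> cont_on a b g ->
  (forall x, a <= x <= b -> f x <= g x) -> sint a b f <= sint a b g.
Proof.
move=> fc gc fg; apply: le_Rintegral => //; try exact: cont_on_integrable.
Qed.

Lemma sint_near a b f k e : a <= b -> cont_on a b f ->
  (forall x, a <= x <= b -> `|f x - k| <= e) -> `|sint a b f - k * (b - a)| <= e * (b - a).
Proof.
move=> ab fc fk.
have h1 : sint a b f <= (k + e) * (b - a).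
  rewrite -sint_cst//; apply: sint_le => //; first exact: cont_cst.
  by move=> x /fk; rewrite ler_norml => /andP[]; lra.
have h2 : (k - e) * (b - a) <= sint a b f.
  rewrite -sint_cst//; apply: sint_le => //; first exact: cont_cst.
  by move=> x /fk; rewrite ler_norml => /andP[]; lra.
by rewrite ler_norml; apply/andP; split; lra.
Qed.

(* The real form of complex differentiability of [u + iv] at [x + iy]. *)
Definition crdiff (u v : R -> R -> R) x y := exists p q : R, forall e, 0 < e ->
  exists2 d : R, 0 < d & forall h k, `|h| < d -> `|k| < d ->
    `|u (x + h) (y + k) - u x y - (p * h - q * k)| <= e * (`|h| + `|k|) /\
    `|v (x + h) (y + k) - v x y - (p * k + q * h)| <= e * (`|h| + `|k|).

Lemma slope_cont f x p : (forall e, 0 < e -> exists2 d : R, 0 < d & forall h, `|h| < d ->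
    `|f (x + h) - f x - p * h| <= e * `|h|) -> {for x, continuous f}.
Proof.
move=> /(_ 1 ltr01)[d d0 H]; apply/cvgrPdist_le => e e0 /=.
pose K := `|p| + 1; have K0 : 0 < K by rewrite /K ltr_wpDl.
near=> y.
have yd : `|y - x| < d.
  by rewrite distrC; near: y; apply: cvgr_dist_lt => //; exact: cvg_id.
have ye : `|y - x| <= e / K.
  rewrite distrC; near: y; apply: cvgr_dist_le; rewrite ?divr_gt0//; exact: cvg_id.
have := H _ yd; rewrite subrKC mul1r => Hy.
rewrite distrC -(subrK (p * (y - x)) (f y - f x)).
apply: le_trans (ler_normD _ _) _; rewrite normrM.
apply: (@le_trans _ _ (K * `|y - x|)); last by rewrite mulrC -ler_pdivlMr.
by rewrite /K mulrDl mul1r addrC lerD2l.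
Unshelve. all: by end_near. Qed.

Section CR.
Variables (u v : R -> R -> R) (x y : R).
Hypothesis H : crdiff u v x y.

Lemma crdiff_cont_ux : {for x, continuous (u^~ y)}.
Proof.
have [p [q K]] := H; apply: (@slope_cont _ _ p) => e /K[d d0 P]; exists d => // h hd.
by have [] := P h 0 hd; rewrite normr0 // !addr0 !mulr0 !subr0.
Qed.

Lemma crdiff_cont_vy : {for y, continuous (v x)}.
Proof.
have [p [q K]] := H; apply: (@slope_cont _ _ p) => e /K[d d0 P]; exists d => // h hd.
have [] := P 0 h _ hd; rewrite normr0 // => _.
by rewrite !addr0 !mulr0 !addr0 !add0r.
Qed.
End CR.

(* The real part of the integral of [u + iv] over the boundary of [[a, b] x [c, d]]. *)
Definition rint (u v : R -> R -> R) a b c d :=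
  sint a b (fun x => u x c - u x d) - sint c d (fun y => v b y - v a y).

Section Rect.
Variables u v : R -> R -> R.

Definition cr_on a b c d := forall x y, a <= x <= b -> c <= y <= d -> crdiff u v x y.

Lemma cr_onW a b c d a' b' c' d' : a <= a' -> b' <= b -> c <= c' -> d' <= d ->
  cr_on a b c d -> cr_on a' b' c' d'.
Proof.
move=> aa bb cc dd H x y /andP[x1 x2] /andP[y1 y2]; apply: H.
  by rewrite (le_trans aa x1) (le_trans x2 bb).
by rewrite (le_trans cc y1) (le_trans y2 dd).
Qed.

Lemma cr_cont_u a b c d y : cr_on a b c d -> c <= y <= d -> cont_on a b (u^~ y).
Proof. by move=> H cd x xab; apply: crdiff_cont_ux (H x y xab cd). Qed.

Lemma cr_cont_v a b c d x : cr_on a b c d -> a <= x <= b -> cont_on c d (v x).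
Proof. by move=> H ab y ycd; apply: crdiff_cont_vy (H x y ab ycd). Qed.

Lemma rint_splitx a m b c d : a <= m -> m <= b -> c <= d -> cr_on a b c d ->
  rint u v a b c d = rint u v a m c d + rint u v m b c d.
Proof.
move=> am mb cd H; rewrite /rint (@sint_cat a m b)//; last first.
  move=> x xab; apply: cvgB; apply: cr_cont_u H _ _ xab; by rewrite ?lexx ?cd.
rewrite !(@sintB c d); try by apply: (cr_cont_v H); rewrite ?lexx ?am ?mb ?(le_trans am mb).
by ring.
Qed.

Lemma rint_splity a b c m d : c <= m -> m <= d -> a <= b -> cr_on a b c d ->
  rint u v a b c d = rint u v a b c m + rint u v a b m d.
Proof.
move=> cm md ab H; rewrite /rint (@sint_cat c m d)//; last first.
  move=> x xab; apply: cvgB; apply: cr_cont_v H _ _ xab; by rewrite ?lexx ?ab.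
rewrite !(@sintB a b); try by apply: (cr_cont_u H); rewrite ?lexx ?cm ?md ?(le_trans cm md).
by ring.
Qed.

(** The affine part contributes [q (b - a) (d - c)] to each of the two integrals of [rint], and
    these cancel. The Cauchy-Riemann equations enter here, through the [q] shared by [u] and [v]. *)
Lemma rint_local a b c d px py p q e : a <= px <= b -> c <= py <= d ->
  cr_on a b c d -> 0 <= e ->
  (forall x y, a <= x <= b -> c <= y <= d ->
    `|u x y - u px py - (p * (x - px) - q * (y - py))| <= e /\
    `|v x y - v px py - (p * (y - py) + q * (x - px))| <= e) ->
  `|rint u v a b c d| <= 2 * e * ((b - a) + (d - c)).
Proof.
move=> /andP[ap pb] /andP[cp pd] H e0 K.
have ab : a <= b := le_trans ap pb; have cd : c <= d := le_trans cp pd.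
have ca : c <= c <= d by rewrite lexx.
have da : c <= d <= d by rewrite lexx andbT.
have aa : a <= a <= b by rewrite lexx.
have ba : a <= b <= b by rewrite lexx andbT.
have h1 : `|sint a b (fun x => u x c - u x d) - q * (d - c) * (b - a)| <= 2 * e * (b - a).
  apply: sint_near => //.
    by move=> x xab; apply: cvgB; exact: cr_cont_u H _ _ xab.
  move=> x xab; have [k1 _] := K x c xab ca; have [k2 _] := K x d xab da.
  by move: k1 k2; rewrite !ler_norml => /andP[? ?] /andP[? ?]; apply/andP; split; lra.
have h2 : `|sint c d (fun y => v b y - v a y) - q * (b - a) * (d - c)| <= 2 * e * (d - c).
  apply: sint_near => //.
    by move=> x xab; apply: cvgB; exact: cr_cont_v H _ _ xab.
  move=> y ycd; have [_ k1] := K a y aa ycd; have [_ k2] := K b y ba ycd.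
  by move: k1 k2; rewrite !ler_norml => /andP[? ?] /andP[? ?]; apply/andP; split; lra.
by move: h1 h2; rewrite /rint !ler_norml => /andP[? ?] /andP[? ?]; apply/andP; split; lra.
Qed.

Record rect := Rect { rl : R; rr : R; rb : R; rt : R }.
Let J r := rint u v (rl r) (rr r) (rb r) (rt r).
Let good r := [/\ rl r <= rr r, rb r <= rt r & cr_on (rl r) (rr r) (rb r) (rt r)].
Let step r r' := [/\ (rl r <= rl r' /\ rr r' <= rr r), (rb r <= rb r' /\ rt r' <= rt r),
  rr r' - rl r' = (rr r - rl r) / 2, rt r' - rb r' = (rt r - rb r) / 2 &
  `|J r| <= 4 * `|J r'|].

(** One of the four quarters carries at least a quarter of [|J r|]. The existential precedes
    [good r] so that [choice] yields a total function on rectangles, which can be iterated. *)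
Lemma rint_quarter r : exists r', good r -> good r' /\ step r r'.
Proof.
have [gr|] := pselect (good r); last by move=> h; exists r => /h.
case: r gr => a b c d [/= ab cd H].
pose m := (a + b) / 2; pose n := (c + d) / 2.
have am : a <= m by rewrite /m; lra.
have mb : m <= b by rewrite /m; lra.
have cn : c <= n by rewrite /n; lra.
have nd : n <= d by rewrite /n; lra.
have Hl : cr_on a m c d by apply: cr_onW H.
have Hr : cr_on m b c d by apply: cr_onW H.
have E : rint u v a b c d = (rint u v a m c n + rint u v a m n d) +
    (rint u v m b c n + rint u v m b n d).
  by rewrite (rint_splitx am mb cd H) (rint_splity cn nd am Hl) (rint_splity cn nd mb Hr).
have G (z1 z2 z3 z4 : R) : [\/ `|z1 + z2 + (z3 + z4)| <= 4 * `|z1|,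
   `|z1 + z2 + (z3 + z4)| <= 4 * `|z2|, `|z1 + z2 + (z3 + z4)| <= 4 * `|z3|
   | `|z1 + z2 + (z3 + z4)| <= 4 * `|z4|].
  set s := `|_|; have : s <= `|z1| + `|z2| + (`|z3| + `|z4|).
    by apply: le_trans (ler_normD _ _) _; rewrite lerD// ler_normD.
  case: (leP s (4 * `|z1|)) => ?; first by constructor 1.
  case: (leP s (4 * `|z2|)) => ?; first by constructor 2.
  case: (leP s (4 * `|z3|)) => ?; first by constructor 3.
  by move=> ?; constructor 4; lra.
have [k|k|k|k] := G (rint u v a m c n) (rint u v a m n d) (rint u v m b c n) (rint u v m b n d);
  rewrite -E in k.
- exists (Rect a m c n) => _; split; first by split => //=; apply: cr_onW H.
  by split => //=; rewrite /m /n; lra.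
- exists (Rect a m n d) => _; split; first by split => //=; apply: cr_onW H.
  by split => //=; rewrite /m /n; lra.
- exists (Rect m b c n) => _; split; first by split => //=; apply: cr_onW H.
  by split => //=; rewrite /m /n; lra.
- exists (Rect m b n d) => _; split; first by split => //=; apply: cr_onW H.
  by split => //=; rewrite /m /n; lra.
Qed.

Lemma nested_intervals (A B : nat -> R) : (forall n, A n <= B n) -> (forall n, A n <= A n.+1) ->
  (forall n, B n.+1 <= B n) -> exists p, forall n, A n <= p <= B n.
Proof.
move=> AB A1 B1.
have Am : nondecreasing_seq A by apply/nondecreasing_seqP.
have Bm : nonincreasing_seq B by apply/nonincreasing_seqP.
have ABm n m : A n <= B m.
  apply: (@le_trans _ _ (A (maxn n m))); first by apply: Am; rewrite leq_maxl.
  by apply: le_trans (AB _) _; apply: Bm; rewrite leq_maxr.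
have hs : has_sup (range A).
  by split; [exists (A 0%N); exists 0%N|exists (B 0%N) => _ [n _ <-]].
exists (sup (range A)) => n; apply/andP; split.
  by apply: sup_upper_bound => //; exists n.
by apply: ge_sup; [exists (A 0%N); exists 0%N|move=> _ [m _ <-]].
Qed.

Theorem goursat a b c d : a <= b -> c <= d -> cr_on a b c d -> rint u v a b c d = 0.
Proof.
move=> ab cd H; have [f fP] := choice rint_quarter.
pose r n := iter n f (Rect a b c d).
have gr n : good (r n).
  by elim: n => [|n IH]; [split|have [] := fP _ IH].
have sr n : step (r n) (r n.+1) by have [] := fP _ (gr n).
have [px Px] : exists p, forall n, rl (r n) <= p <= rr (r n).
  by apply: nested_intervals => n; [have [] := gr n|have [[]] := sr n|have [[]] := sr n].
have [py Py] : exists p, forall n, rb (r n) <= p <= rt (r n).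
  by apply: nested_intervals => n; [have [] := gr n|have [_ []] := sr n|have [_ []] := sr n].
have wx n : rr (r n) - rl (r n) = (b - a) / 2 ^+ n.
  elim: n => [|n IH]; first by rewrite expr0 divr1.
  by have [_ _ -> _ _] := sr n; rewrite IH exprS invfM mulrA mulrAC.
have wy n : rt (r n) - rb (r n) = (d - c) / 2 ^+ n.
  elim: n => [|n IH]; first by rewrite expr0 divr1.
  by have [_ _ _ -> _] := sr n; rewrite IH exprS invfM mulrA mulrAC.
have Jn n : `|rint u v a b c d| <= 4 ^+ n * `|J (r n)|.
  elim: n => [|n IH]; first by rewrite expr0 mul1r.
  apply: le_trans IH _; rewrite exprSr -mulrA ler_wpM2l ?exprn_ge0//.
  by have [] := sr n.
pose L := (b - a) + (d - c).
have L0 : 0 <= L by rewrite /L addr_ge0 ?subr_ge0.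
have [p [q K]] : crdiff u v px py by apply: H; [exact: (Px 0%N)|exact: (Py 0%N)].
apply/eqP; rewrite -normr_le0; apply/ler_addgt0Pl => e e0; rewrite addr0.
(* At level [n] the final bound is [4^n * 4 e' (L / 2^n)^2 = 4 e' L^2], whatever [n] is. *)
have [e' [e'0 ee]] : exists e' : R, 0 < e' /\ 4 * e' * L ^+ 2 <= e.
  exists (e / (4 * L ^+ 2 + 1)); split; first by rewrite divr_gt0// ltr_wpDl// mulr_ge0 ?sqr_ge0.
  rewrite mulrAC mulrA ler_pdivrMr ?ltr_wpDl// ?mulr_ge0 ?sqr_ge0//.
  by rewrite mulrC ler_wpM2l ?lerDl// ltW.
have [dl dl0 Kd] := K e' e'0.
have [n nd] : exists n, L / 2 ^+ n < dl.
  have := @cvg_geometric R L (2^-1); rewrite ger0_norm ?invr_ge0// invf_lt1// ltr1n => /(_ isT).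
  move=> /cvgr_dist_lt/(_ _ dl0)[N _ /(_ N)/= ]; rewrite leqnn => /(_ isT) h.
  exists N; move: h; rewrite /geometric /= sub0r normrN exprVn => /(le_lt_trans (ler_norm _)) //.
apply: le_trans (Jn n) _.
have [gl gb gc] := gr n.
have Ln : (rr (r n) - rl (r n)) + (rt (r n) - rb (r n)) = L / 2 ^+ n.
  by rewrite wx wy -mulrDl.
have /andP[px1 px2] := Px n; have /andP[py1 py2] := Py n.
have := @rint_local (rl (r n)) (rr (r n)) (rb (r n)) (rt (r n)) px py p q
  (e' * (2 * (L / 2 ^+ n))) (Px n) (Py n) gc.
have Lp : 0 <= L / 2 ^+ n by rewrite divr_ge0// exprn_ge0.
move=> /(_ (mulr_ge0 (ltW e'0) (mulr_ge0 (ler0n _ _) Lp))); rewrite Ln => key.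
apply: (@le_trans _ _ (4 ^+ n * (2 * (e' * (2 * (L / 2 ^+ n))) * (L / 2 ^+ n)))).
  rewrite ler_wpM2l ?exprn_ge0//; apply: key => x y /andP[x1 x2] /andP[y1 y2].
  have xb : `|x - px| <= L / 2 ^+ n by rewrite -Ln ler_norml; apply/andP; split; lra.
  have yb : `|y - py| <= L / 2 ^+ n by rewrite -Ln ler_norml; apply/andP; split; lra.
  have [] := Kd (x - px) (y - py) (le_lt_trans xb nd) (le_lt_trans yb nd).
  have E z1 z2 : z1 + (z2 - z1) = z2 :> R by rewrite addrC subrK.
  have xy : e' * (`|x - px| + `|y - py|) <= e' * (2 * (L / 2 ^+ n)).
    by rewrite ler_wpM2l ?(ltW e'0)// mulr_natl mulr2n lerD.
  by rewrite !E => h1 h2; split; [exact: le_trans h1 xy|exact: le_trans h2 xy].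
apply: le_trans ee; rewrite le_eqVlt; apply/orP; left; apply/eqP.
have -> : (4 : R) = 2 ^+ 2 by rewrite expr2; ring.
have := expf_neq0 n (lt0r_neq0 (ltr0Sn R 1)).
rewrite exprAC => h; field.
by [].
Qed.
End Rect.
End Goursat.

(** * The complex exponential and means over circles *)

Section ComplexExp.
Variable R : realType.
Implicit Types (z w a : Cplx R) (x y e : R).

Lemma real_slope (f : R -> R) x (l : R) : is_derive x 1 f l -> forall e, 0 < e ->
  exists2 d : R, 0 < d & forall h, `|h| < d -> `|f (x + h) - f x - l * h| <= e * `|h|.
Proof.
move=> [H1 H2] e e0.
have H : (fun h : R => h^-1 *: (f (h *: 1 + x) - f x)) @ 0^' --> l by rewrite -H2; exact: H1.
move/cvgrPdist_le: H => /(_ _ e0).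
rewrite near_withinE => /(@nbhs_ballP R R)[d d0 dP]; exists d => // h hd.
have [->|h0] := eqVneq h 0; first by rewrite mulr0 addr0 !subr0 subrr normr0 mulr0.
have := dP h; rewrite -ball_normE /= sub0r normrN => /(_ hd h0).
rewrite -(ler_pM2r (x := `|h|)) ?normr_gt0// -normrM distrC.
apply: le_trans; rewrite le_eqVlt; apply/orP; left; apply/eqP.
by congr `|_|; rewrite /GRing.scale /= mulr1 [h + x]addrC; field.
Qed.

Definition cexp w : Cplx R := Complex (expR (Re w) * cos (Im w)) (expR (Re w) * sin (Im w)).

Lemma cexpD z w : cexp (z + w) = cexp z * cexp w.
Proof.
rewrite /cexp cReD cImD expRD cosD sinD; apply/eqP; rewrite eq_complex cReM cImM /=.
by apply/andP; split; apply/eqP; ring.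
Qed.

Lemma cmod_cexp w : cmod (cexp w) = expR (Re w).
Proof.
rewrite cmod_sqrt /= !exprMn -mulrDr cos2Dsin2 mulr1 sqrtr_sqr ger0_norm// expR_ge0.
Qed.

Lemma cexp0 : cexp 0 = 1.
Proof. by rewrite /cexp /= expR0 cos0 sin0 mulr1 mulr0. Qed.

Lemma cdiff_cexp0 : cdiff cexp 0 1.
Proof.
(* The errors of the real and imaginary parts, [A1] and [A2] below, are at most [4 n |h|] and
   [5 n |h|]. *)
move=> e e0; have [n [n0 n1 ne]] : exists n : R, [/\ 0 < n, n <= 1 & 9 * n <= e].
  exists (Num.min 1 (e / 9)); rewrite lt_min ltr01 divr_gt0// ge_min lexx; split => //.
  by rewrite mulrC -ler_pdivlMr// ge_min lexx orbT.
have [d1 d10 H1] := real_slope (is_derive_expR (0 : R)) n0.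
have [d2 d20 H2] := real_slope (is_derive_sin (0 : R)) n0.
have [d3 d30 H3] := real_slope (is_derive_cos (0 : R)) n0.
exists (Num.min (Num.min n d1) (Num.min d2 d3)); first by rewrite !lt_min n0 d10 d20 d30.
case=> x y; rewrite !lt_min => /andP[/andP[hn hd1] /andP[hd2 hd3]].
have xh : `|x| <= cmod (Complex x y : Cplx R) := Re_le_cmod (Complex x y).
have yh : `|y| <= cmod (Complex x y : Cplx R) := Im_le_cmod (Complex x y).
have := H1 x (le_lt_trans xh hd1); rewrite add0r expR0 mul1r => K1.
have := H2 y (le_lt_trans yh hd2); rewrite add0r sin0 cos0 mul1r subr0 => K2.
have := H3 y (le_lt_trans yh hd3); rewrite add0r sin0 cos0 oppr0 mul0r subr0 => K3.
set h := Complex x y in xh yh hn *.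
have E3 : expR x <= 3.
  move: K1; rewrite ler_norml => /andP[_ K1].
  have : n * `|x| <= 1 * 1.
    by rewrite ler_pM ?(ltW n0)//; apply: le_trans n1; apply: le_trans xh _; exact: ltW.
  have := le_trans (ler_norm x) (le_trans xh (le_trans (ltW hn) n1)); lra.
have E1 : `|expR x - 1| <= 2 * `|x|.
  have -> : expR x - 1 = (expR x - 1 - x) + x by ring.
  apply: le_trans (ler_normD _ _) _; rewrite mulr_natl mulr2n lerD2r.
  by apply: le_trans K1 _; rewrite ler_piMl.
apply: le_trans (cmod_le_ReIm _) _.
rewrite cexp0 mul1r add0r !cReB !cImB /= subr0.
have A1 : `|expR x * cos y - 1 - x| <= n * cmod h + 3 * (n * cmod h).
  have -> : expR x * cos y - 1 - x = (expR x - 1 - x) + expR x * (cos y - 1) by ring.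
  apply: le_trans (ler_normD _ _) _; rewrite lerD//.
    by apply: le_trans K1 _; rewrite ler_wpM2l// ltW.
  rewrite normrM ger0_norm ?expR_ge0//; apply: ler_pM; rewrite ?expR_ge0//.
  by apply: le_trans K3 _; rewrite ler_wpM2l// ltW.
have A2 : `|expR x * sin y - y| <= 3 * (n * cmod h) + 2 * (n * cmod h).
  have -> : expR x * sin y - y = expR x * (sin y - y) + (expR x - 1) * y by ring.
  apply: le_trans (ler_normD _ _) _; rewrite lerD//.
    rewrite normrM ger0_norm ?expR_ge0//; apply: ler_pM; rewrite ?expR_ge0//.
    by apply: le_trans K2 _; rewrite ler_wpM2l// ltW.
  rewrite normrM; apply: le_trans (ler_wpM2r (normr_ge0 _) E1) _.
  rewrite -mulrA ler_wpM2l//; apply: ler_pM => //; apply: le_trans xh _; exact: ltW.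
apply: le_trans (lerD A1 A2) _.
apply: (@le_trans _ _ (9 * n * cmod h)); last by rewrite ler_wpM2r ?cmod_ge0.
lra.
Qed.

Lemma cdiff_cexp w : cdiff cexp w (cexp w).
Proof.
move=> e e0; have k0 : 0 < cmod (cexp w) by rewrite cmod_cexp expR_gt0.
have [d d0 H] := cdiff_cexp0 (divr_gt0 e0 k0); exists d => // h /H.
have -> : cexp (w + h) - cexp w - cexp w * h = cexp w * (cexp (0 + h) - cexp 0 - 1 * h).
  rewrite cexpD add0r mul1r.
  by rewrite cexp0; ring.
by rewrite cmodM mulrAC ler_pdivlMr// mulrC.
Qed.

Lemma cdiff_crdiff (f : Cplx R -> Cplx R) x y l : cdiff f (Complex x y) l ->
  crdiff (fun x y => Re (f (Complex x y))) (fun x y => Im (f (Complex x y))) x y.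
Proof.
move=> H; exists (Re l), (Im l) => e e0; have [d d0 dP] := H e e0.
exists (d / 2); first by rewrite divr_gt0.
move=> h k hd kd.
have hk : cmod (Complex h k : Cplx R) <= `|h| + `|k| := cmod_le_ReIm (Complex h k).
have := dP (Complex h k) (le_lt_trans hk _); rewrite [d]splitr ltrD// => /(_ isT) K.
have {}K := le_trans K (ler_wpM2l (ltW e0) hk).
split.
  apply: le_trans K; apply: le_trans (Re_le_cmod _); rewrite !cReB cReM /=.
  by rewrite /= le_eqVlt; apply/orP; left; apply/eqP; congr `|_|; ring.
apply: le_trans K; apply: le_trans (Im_le_cmod _); rewrite !cImB cImM /=.
by rewrite /= le_eqVlt; apply/orP; left; apply/eqP; congr `|_|; ring.
Qed.

(* Goursat for [w |-> i G(a + exp w)] on a rectangle of height [2 pi]: the mean of [Re G] over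
   the circles around [a] does not depend on the radius, and it tends to [Re (G a) = 0]. *)
Lemma circle_not_negative (G : Cplx R -> Cplx R) a r r0 e :
  (forall z, 0 < cmod (z - a) < r0 -> derivable G z 1) ->
  {for a, continuous G} -> G a = 0 -> 0 < r < r0 -> 0 < e ->
  (forall z, cmod (z - a) = r -> Re (G z) <= - e) -> False.
Proof.
move=> dG cG Ga /andP[r_gt0 rr0] e0 Gr.
have e20 : 0 < e / 2 by rewrite divr_gt0.
have [d d0] := (ccontP G a).1 cG _ e20; rewrite Ga => dP.
have [s [s0 sr sd]] : exists s : R, [/\ 0 < s, s <= r & s < d].
  exists (Num.min r (d / 2)); rewrite lt_min r_gt0 divr_gt0// ge_min lexx; split => //.
  by apply: le_lt_trans (_ : d / 2 < d); rewrite ?ge_min ?lexx ?orbT// ltr_pdivrMr// ltr_pMr// ltr1n.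
(* Vertical segments are mapped to circles around [a], and [rint] integrates the imaginary part
   along vertical sides; the factor [i] makes that part equal to [Re G]. *)
pose f w : Cplx R := Complex 0 1 * G (a + cexp w).
pose u x y := Re (f (Complex x y)); pose v x y := Im (f (Complex x y)).
have H : cr_on u v (ln s) (ln r) 0 (pi *+ 2).
  move=> x y /andP[_ xr] _.
  have xr' : expR x <= r by rewrite -[r]lnK ?posrE// ler_expR.
  suff : derivable f (Complex x y) 1 by move=> /derivable_cdiff; exact: cdiff_crdiff.
  apply: derivableM; first exact: derivable_cst.
  apply: (@derivable_compc _ (fun w => a + cexp w)).
    apply: derivableD; first exact: derivable_cst.
    exact: cdiff_derivable (cdiff_cexp _).
  apply: dG; rewrite addrC addKr cmod_cexp /= expR_gt0 /=.
  exact: le_lt_trans rr0.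
have lsr : ln s <= ln r by rewrite ler_ln ?posrE.
have p0 : 0 <= (pi *+ 2 : R) by rewrite mulrn_wge0// pi_ge0.
have := goursat lsr p0 H; rewrite /rint.
have -> : sint (ln s) (ln r) (fun x => u x 0 - u x (pi *+ 2)) = 0.
  rewrite (@eq_sint _ _ _ _ (fun=> 0)) ?sint_cst ?mul0r// => x _.
  rewrite /u /f; suff -> : cexp (Complex x (pi *+ 2)) = cexp (Complex x 0) by rewrite subrr.
  by rewrite /cexp /= cos2pi sin2pi cos0 sin0.
have vE x y : v x y = Re (G (a + cexp (Complex x y))).
  by rewrite /v /f cImM /= mul0r mul1r add0r.
have cv x : ln s <= x <= ln r -> cont_on 0 (pi *+ 2) (v x).
  by move=> xsr; apply: cr_cont_v H xsr.
(* On the outer circle [v <= - e], on the inner one [v >= - e / 2], whereas Goursat makes the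
   integral of the difference vanish. *)
have : sint 0 (pi *+ 2) (fun y => v (ln r) y - v (ln s) y) <= sint 0 (pi *+ 2) (fun=> - (e / 2)).
  apply: sint_le; last 2 first.
  - exact: cont_cst.
  - move=> y _; rewrite !vE.
    have h1 : Re (G (a + cexp (Complex (ln r) y))) <= - e.
      by apply: Gr; rewrite addrC addKr cmod_cexp /= lnK.
    have : cmod (G (a + cexp (Complex (ln s) y)) - 0) <= e / 2.
      by apply: dP; rewrite addrC addKr cmod_cexp /= lnK.
    rewrite subr0 => /(le_trans (Re_le_cmod _)); rewrite ler_norml => /andP[]; lra.
  by move=> y yp; apply: cvgB; apply: cv => //; rewrite lexx ?lsr.
rewrite sint_cst// subr0 => h /eqP; rewrite subr_eq0 eq_sym => /eqP h'; move: h; rewrite h'.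
have pp : 0 < (pi *+ 2 : R) by rewrite pmulrn_lgt0// pi_gt0.
by rewrite mulNr oppr_ge0 leNgt mulr_gt0.
Qed.

End ComplexExp.

(** * The maximum principle *)

Section MaxPrinciple.
Variable R : realType.
Implicit Types (z w a b : Cplx R) (x y e r : R) (f g : Cplx R -> Cplx R).

Lemma cmod_continuous : continuous (@cmod R).
Proof.
move=> z; apply/(@cvgrPdist_le _ _ _ (nbhs z)) => e e0; apply/cnbhsP; exists e => // w wz.
apply: le_trans (ltW wz); rewrite ler_norml lerNl opprB cmod_subr_le /= cmodB.
exact: cmod_subr_le.
Qed.

Lemma Complex_continuous : continuous (fun p : R * R => Complex p.1 p.2 : Cplx R).
Proof.
move=> p; apply/(@ccvgP _ _ (nbhs p)) => e e0.
have e20 : 0 < e / 2 by rewrite divr_gt0.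
have H1 : (fun q : R * R => q.1) @ nbhs p --> (p.1 : R) by exact: cvg_fst.
have H2 : (fun q : R * R => q.2) @ nbhs p --> (p.2 : R) by exact: cvg_snd.
move/cvgrPdist_le: H1 => /(_ _ e20) H1; move/cvgrPdist_le: H2 => /(_ _ e20) H2.
near=> q; apply: le_trans (cmod_le_ReIm _) _; rewrite cReB cImB /= [leRHS]splitr.
by rewrite lerD// distrC; near: q.
Unshelve. all: by end_near. Qed.

Lemma subr_continuous a : continuous (fun w : Cplx R => w - a).
Proof.
move=> z; apply/(ccontP (fun w => w - a)) => e e0; exists e => // w /ltW.
by rewrite opprB addrA subrK.
Qed.

Lemma compact_cdisk a r : compact [set z : Cplx R | cmod (z - a) <= r].
Proof.
have cB : compact ((fun p : R * R => a + Complex p.1 p.2 : Cplx R) @` (`[- r, r] `*` `[- r, r])).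
  apply: continuous_compact; last by apply: compact_setX; exact: segment_compact.
  apply: continuous_subspaceT => p; apply: cvgD; [exact: cvg_cst|exact: Complex_continuous].
apply: (subclosed_compact _ cB).
  apply: (@closed_comp _ _ (fun z : Cplx R => cmod (z - a)) [set x | x <= r]).
    move=> z _; apply: (@cvg_comp _ _ _ (fun w => w - a) (@cmod R)); last exact: cmod_continuous.
    exact: subr_continuous.
  exact: closed_le.
move=> z /= zr; exists (Re (z - a), Im (z - a)).
  split; rewrite /= in_itv /= -ler_norml; apply: le_trans zr;
  [exact: Re_le_cmod|exact: Im_le_cmod].
by rewrite /= -[RHS](subrKC a); congr (_ + _); case: (z - a).
Qed.

(** The centre is excluded because circles around [z] do not see it; in this form the maximum
    principle applies to a difference quotient at its own base point. *)
Definition punct_holo g z := exists2 r : R, 0 < r & forall w, 0 < cmod (w - z) < r -> derivable g w 1.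

(* If [|g| > M] somewhere, then [|g|^2 + e |z - a|^2] has an interior maximum [b], and
   [2 conj (g b) (g z - g b) + 2 e conj (b - a) (z - b)] has negative real part around [b]. *)
Lemma max_principle g a r (M : R) :
  (forall z, cmod (z - a) <= r -> {for z, continuous g}) ->
  (forall z, cmod (z - a) < r -> punct_holo g z) ->
  (forall z, cmod (z - a) = r -> cmod (g z) <= M) ->
  forall z, cmod (z - a) <= r -> cmod (g z) <= M.
Proof.
move=> cg hg gM z0 z0r; rewrite leNgt; apply/negP => Mz0.
have r0 : 0 <= r := le_trans (cmod_ge0 _) z0r.
(* [e] is so small that [P] stays below [|g z0|^2] on the circle, which forces its maximiser into
   the open disk. If [M < 0] any [e] does, since a maximiser on the circle would give [0 <= M]. *)
have [e [e0 He]] : exists e : R, 0 < e /\ (0 <= M -> M ^+ 2 + e * r ^+ 2 < cmod (g z0) ^+ 2).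
  have [M0|M0] := leP 0 M; last by exists 1; split => // ?; lra.
  have h : 0 < cmod (g z0) ^+ 2 - M ^+ 2 by rewrite subr_gt0 ltr_pXn2r// nnegrE cmod_ge0.
  have k : 0 < 2 * (r ^+ 2 + 1) by rewrite mulr_gt0// ltr_wpDl// sqr_ge0.
  exists ((cmod (g z0) ^+ 2 - M ^+ 2) / (2 * (r ^+ 2 + 1))); rewrite divr_gt0//; split => // _.
  rewrite -ltrBrDl mulrAC ltr_pdivrMr// ltr_pM2l//.
  by have := sqr_ge0 r; lra.
pose P z := cmod (g z) ^+ 2 + e * cmod (z - a) ^+ 2.
have [b br Pb] : exists2 b : Cplx R, cmod (b - a) <= r & forall z, cmod (z - a) <= r -> P z <= P b.
  have A0 : [set z : Cplx R | cmod (z - a) <= r] !=set0 by exists z0.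
  have [|b] := @compact_EVT_max _ _ P _ A0 (compact_cdisk (a := a) (r := r)).
    apply: continuous_in_subspaceT => z; rewrite inE /= => zr.
    have c1 : {for z, continuous (fun w => cmod (g w))}.
      by apply: (@cvg_comp _ _ _ g (@cmod R)); [exact: cg|exact: cmod_continuous].
    have c2 : {for z, continuous (fun w : Cplx R => cmod (w - a))}.
      apply: (@cvg_comp _ _ _ (fun w => w - a) (@cmod R)); last exact: cmod_continuous.
      exact: subr_continuous.
    exact: (cvgD (cvgM c1 c1) (cvgM (cvg_cst e) (cvgM c2 c2))).
  by rewrite inE => br Pb; exists b => // z zr; apply: Pb; rewrite inE.
have Pz0 : cmod (g z0) ^+ 2 <= P b.
  by apply: le_trans (Pb _ z0r); rewrite lerDl mulr_ge0 ?sqr_ge0 ?ltW.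
have bltr : cmod (b - a) < r.
  rewrite lt_neqAle br andbT; apply/eqP => E.
  have gb := gM b E; have M0 := le_trans (cmod_ge0 _) gb.
  have : P b <= M ^+ 2 + e * r ^+ 2 by rewrite /P E lerD2r ler_pXn2r// nnegrE cmod_ge0.
  by have := He M0; lra.
have [s s0 hs] := hg b bltr.
(* Expanding the squares in [P z <= P b] gives [Re (G z) <= - |g z - g b|^2 - e |z - b|^2], hence at
   most [- e t^2] on the circle of radius [t]. *)
pose G z := Complex (2 * Re (g b)) (- (2 * Im (g b))) * (g z - g b) +
  Complex (2 * e * Re (b - a)) (- (2 * e * Im (b - a))) * (z - b) : Cplx R.
have [t [t0 ts tr]] : exists t : R, [/\ 0 < t, t < s & cmod (b - a) + t <= r].
  have h : 0 < r - cmod (b - a) by rewrite subr_gt0.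
  exists (Num.min (s / 2) (r - cmod (b - a))); split.
  - by rewrite lt_min divr_gt0.
  - by apply: le_lt_trans (_ : s / 2 < s); rewrite ?ge_min ?lexx// ltr_pdivrMr// ltr_pMr// ltr1n.
  - by rewrite -lerBrDl ge_min lexx orbT.
apply: (@circle_not_negative _ G b t s (e * t ^+ 2)).
- move=> z zs; apply: derivableD; (apply: derivableM; first exact: derivable_cst).
    by apply: derivableB; [exact: hs|exact: derivable_cst].
  by apply: derivableB; [exact: derivable_id|exact: derivable_cst].
- by apply: (cvgD (cvgM (cvg_cst _) (cvgB (cg b br) (cvg_cst _)))
    (cvgM (cvg_cst _) (@subr_continuous b b))).
- by rewrite /G !subrr !mulr0 addr0.
- by rewrite t0 ts.
- by rewrite mulr_gt0// exprn_gt0.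
move=> z zt; have zr : cmod (z - a) <= r.
  have -> : z - a = (b - a) + (z - b) by ring.
  by apply: le_trans (cmodD_le _ _) _; rewrite zt.
have := Pb z zr; have : 0 <= cmod (g z - g b) ^+ 2 by exact: sqr_ge0.
rewrite /P -zt !cmod_sq !(cReB, cImB) cReD !cReM /= !(cReB, cImB).
move: e0; clear; move: (Re _) (Re _) (Re _) (Re _) (Re _) (Im _) (Im _) (Im _) (Im _) (Im _).
move=> z1 z2 z3 z4 z5 z6 z7 z8 z9 z10 *; lra.
Qed.

End MaxPrinciple.

(** * Difference quotients and uniform limits *)

Section Weierstrass.
Variable R : realType.
Implicit Types (z w a b : Cplx R) (x y e r M : R) (f g h : Cplx R -> Cplx R).

Lemma derivable_subr a z : derivable (fun w : Cplx R => w - a) z 1.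
Proof. by apply: derivableB; [exact: derivable_id|exact: derivable_cst]. Qed.

Lemma derivable_subc f (a v : Cplx R) : derivable f v 1 -> derivable (fun w => f w - a) v 1.
Proof. by move=> d1; exact: (derivableB d1 (derivable_cst _ _ _)). Qed.

Definition dq f a z : Cplx R := if z == a then 'D_1 f a else (f z - f a) / (z - a).

Lemma dq_eq f a : dq f a a = 'D_1 f a.
Proof. by rewrite /dq eqxx. Qed.

Lemma dq_neq f a z : z != a -> dq f a z = (f z - f a) / (z - a).
Proof. by rewrite /dq => /negPf ->. Qed.

Lemma dqE f a z : f z = f a + dq f a z * (z - a).
Proof.
have [->|za] := eqVneq z a; first by rewrite subrr mulr0 addr0.
by rewrite dq_neq// divfK ?subr_eq0// subrKC.
Qed.

Lemma near_neq a z w : cmod (w - z) < cmod (z - a) -> w != a.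
Proof. by apply: contraTneq => ->; rewrite cmodB ltxx. Qed.

Lemma dq_cont_eq f a : derivable f a 1 -> {for a, continuous (dq f a)}.
Proof.
move=> /derivable_cdiff df; apply/ccontP => e e0; have [d d0 dP] := df e e0.
exists d => // w wd; rewrite dq_eq; have [->|wa] := eqVneq w a.
  by rewrite dq_eq subrr cmod0 ltW.
have wa0 : w - a != 0 by rewrite subr_eq0.
rewrite dq_neq// -(ler_pM2r (x := cmod (w - a))) ?cmod_gt0// -cmodM mulrBl divfK//.
by have := dP _ wd; rewrite subrKC.
Qed.

Lemma dq_near f a z : z != a -> exists2 d : R, 0 < d &
  forall w, cmod (w - z) < d -> (f w - f a) / (w - a) = dq f a w.
Proof.
move=> za; exists (cmod (z - a)); first by rewrite cmod_gt0 subr_eq0.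
by move=> w /near_neq wa; rewrite dq_neq.
Qed.

Lemma dq_derivable_neq f a z : z != a -> derivable f z 1 -> derivable (dq f a) z 1.
Proof.
move=> za df; have [d d0 dE] := dq_near f za; apply: (derivable_near d0 dE).
have d1 : derivable (fun w => f w - f a) z 1 := derivableB df (derivable_cst _ _ _).
have d2 : derivable (fun w : Cplx R => (w - a)^-1) z 1.
  by apply: derivableV; [rewrite subr_eq0|exact: derivable_subr].
exact: (derivableM d1 d2).
Qed.

Lemma dq_cont_neq f a z : z != a -> {for z, continuous f} -> {for z, continuous (dq f a)}.
Proof.
move=> za cf; have [d d0 dE] := dq_near f za.
have H : {for z, continuous (fun w => (f w - f a) / (w - a))}.
  apply: (cvgM (cvgB cf (cvg_cst _)) (cvgV _ (@subr_continuous _ a z))).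
  by rewrite subr_eq0.
apply/ccontP => e e0; have [d' d'0 P] := (ccontP _ _).1 H e e0.
exists (Num.min d d'); first by rewrite lt_min d0 d'0.
move=> w; rewrite lt_min => /andP[w1 w2]; rewrite -dE// -dE; last by rewrite subrr cmod0.
exact: (P w w2).
Qed.

Lemma dq_punct f a z : punct_holo f z -> punct_holo (dq f a) z.
Proof.
move=> [r r0]; have [->|za] := eqVneq z a => H.
  exists r; first exact: r0.
  move=> w wr; apply: dq_derivable_neq; last exact: (H w wr).
  by case/andP: wr => wa _; rewrite -subr_eq0 -cmod_gt0.
exists (Num.min r (cmod (z - a))); first by rewrite lt_min r0 cmod_gt0 subr_eq0.
move=> w; rewrite lt_min => /andP[w0 /andP[wr /near_neq wa]].
by apply: dq_derivable_neq; [exact: wa|apply: H; rewrite w0].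
Qed.

(* Unlike holomorphy, this is known for [dq f b] with [b != a] before the singularity of [dq f b] at
   [b] is shown to be removable. *)
Definition quasi_holo f a r := [/\ derivable f a 1,
  forall z, cmod (z - a) <= r -> {for z, continuous f} &
  forall z, cmod (z - a) < r -> punct_holo f z].

Lemma quasi_holoB f g a r : quasi_holo f a r -> quasi_holo g a r -> quasi_holo (fun z => f z - g z) a r.
Proof.
move=> [f1 f2 f3] [g1 g2 g3]; split; first exact: (derivableB f1 g1).
  by move=> z zr; exact: (cvgB (f2 z zr) (g2 z zr)).
move=> z zr; have [d d0 dP] := f3 z zr; have [d' d'0 d'P] := g3 z zr.
exists (Num.min d d'); first by rewrite lt_min d0 d'0.
move=> w; rewrite lt_min => /andP[w0 /andP[w1 w2]].
by apply: derivableB; [apply: dP|apply: d'P]; rewrite w0.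
Qed.

Lemma holo_quasi_holo f a r r' : r < r' -> 0 < r' -> (forall z, cmod (z - a) < r' -> derivable f z 1) -> quasi_holo f a r.
Proof.
move=> rr r0 H; split; first by apply: H; rewrite subrr cmod0.
  by move=> z zr; apply: derivable_cont; apply: H; apply: le_lt_trans rr.
move=> z zr; exists (r' - r); first by rewrite subr_gt0.
move=> w /andP[_ wz]; apply: H; have -> : w - a = (w - z) + (z - a) by ring.
by apply: le_lt_trans (cmodD_le _ _) _; lra.
Qed.

Lemma dq_quasi_holo_cont f a r : quasi_holo f a r ->
  forall z, cmod (z - a) <= r -> {for z, continuous (dq f a)}.
Proof.
move=> [f1 f2 f3] z zr; have [->|za] := eqVneq z a; first exact: dq_cont_eq.
exact: (dq_cont_neq za (f2 z zr)).
Qed.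

(** This is the Schwarz lemma in quotient form: the maximum principle is applied to [dq f a] itself,
    whose modulus on the circle is [|f z - f a| / r]. *)
Lemma dq_bound f a r M : 0 < r -> quasi_holo f a r ->
  (forall z, cmod (z - a) = r -> cmod (f z - f a) <= M) ->
  forall z, cmod (z - a) <= r -> cmod (dq f a z) <= M / r.
Proof.
move=> r0 nf fM; apply: max_principle; first exact: dq_quasi_holo_cont.
  by move=> z zr; apply: dq_punct; have [_ _] := nf; apply.
move=> z zr; have za : z != a by rewrite -subr_eq0 -cmod_gt0 zr.
by rewrite (dq_neq f za) cmod_div zr ler_pM2r ?invr_gt0//; exact: fM.
Qed.

Lemma schwarz_center f a r M : 0 < r -> quasi_holo f a r ->
  (forall z, cmod (z - a) = r -> cmod (f z - f a) <= M) ->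
  forall z, cmod (z - a) <= r -> cmod (f z - f a) <= M / r * cmod (z - a).
Proof.
move=> r0 nf fM z zr; rewrite (dqE f a z) addrAC subrr add0r cmodM.
by rewrite ler_wpM2r ?cmod_ge0//; exact: (dq_bound r0 nf fM).
Qed.

Section Limit.
Variables (g : Cplx R -> Cplx R) (a : Cplx R) (r : R).
Hypothesis r0 : 0 < r.

(** Quasi-holomorphy is the right demand on [h] because [dq_derivable_eq] approximates by [dq f b],
    whose differentiability at [b] is not yet available there. *)
Definition unif_approx h e := quasi_holo h a r /\ forall z, cmod (z - a) <= r -> cmod (h z - g z) <= e.

Hypothesis approxP : forall e, 0 < e -> exists h, unif_approx h e.

Let cmod_aa : cmod (a - a) <= r.
Proof. by rewrite subrr cmod0 ltW. Qed.

Lemma approx_sphere h1 h2 e1 e2 : unif_approx h1 e1 -> unif_approx h2 e2 ->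
  forall z, cmod (z - a) <= r -> cmod (h1 z - h2 z - (h1 a - h2 a)) <= 2 * (e1 + e2).
Proof.
move=> [n1 H1] [n2 H2] z zr; have K w : cmod (w - a) <= r -> cmod (h1 w - h2 w) <= e1 + e2.
  move=> wr; have -> : h1 w - h2 w = (h1 w - g w) + (g w - h2 w) by ring.
  by apply: le_trans (cmodD_le _ _) _; rewrite lerD ?H1// cmodB H2.
by apply: le_trans (cmodB_le _ _) _; rewrite mulr_natl mulr2n lerD ?K.
Qed.

Lemma approx_lip h1 h2 e1 e2 : unif_approx h1 e1 -> unif_approx h2 e2 ->
  forall z, cmod (z - a) <= r ->
  cmod (h1 z - h2 z - (h1 a - h2 a)) <= 2 * (e1 + e2) / r * cmod (z - a).
Proof.
move=> A1 A2 z zr; have [[n1 _] [n2 _]] := (A1, A2).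
apply: (@schwarz_center (fun z => h1 z - h2 z) a r _ r0 (quasi_holoB n1 n2)); last exact: zr.
by move=> w wr; apply: (approx_sphere A1 A2); rewrite wr.
Qed.

Lemma approx_D h1 h2 e1 e2 : unif_approx h1 e1 -> unif_approx h2 e2 ->
  cmod ('D_1 h1 a - 'D_1 h2 a) <= 2 * (e1 + e2) / r.
Proof.
move=> A1 A2; have [[n1 _] [n2 _]] := (A1, A2).
have [d1 _ _] := n1; have [d2 _ _] := n2.
rewrite -(deriveB d1 d2) -[X in 'D_1 X a]/(fun z => h1 z - h2 z) -dq_eq.
apply: (dq_bound r0 (quasi_holoB n1 n2)); last exact: cmod_aa.
by move=> w wr; apply: (approx_sphere A1 A2); rewrite wr.
Qed.

Lemma approx_limit_lip h e : unif_approx h e -> forall z, cmod (z - a) <= r ->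
  cmod (g z - h z - (g a - h a)) <= 2 * e / r * cmod (z - a).
Proof.
move=> A z zr; apply/ler_addgt0Pl => t t0.
(* Replacing [g] by an [s]-approximation costs [2 s |z - a| / r + 2 s], which this choice makes
   equal to [t]. *)
pose s := t / (2 * cmod (z - a) / r + 2).
have q0 : 0 < 2 * cmod (z - a) / r + 2 by rewrite ltr_wpDl// divr_ge0 ?(ltW r0)// mulr_ge0 ?cmod_ge0.
have s0 : 0 < s by rewrite divr_gt0.
have [h' A'] := approxP s0; have := approx_lip A' A zr.
have -> : g z - h z - (g a - h a) = (h' z - h z - (h' a - h a)) - ((h' z - g z) - (h' a - g a)) by ring.
move=> H; apply: le_trans (cmodB_le _ _) _; have [_ A'g] := A'.
have := le_trans (cmodB_le (h' z - g z) (h' a - g a)) (lerD (A'g z zr) (A'g a cmod_aa)).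
have -> : t = s * (2 * cmod (z - a) / r + 2) by rewrite /s divfK ?gt_eqF.
move=> H2; apply: le_trans (lerD H H2) _; rewrite le_eqVlt; apply/orP; left; apply/eqP.
by field; rewrite gt_eqF.
Qed.

(* [g - h] is [2 e / r]-Lipschitz at [a] for every approximation [h], by the Schwarz lemma. *)
Lemma weierstrass_cdiff : exists l, cdiff g a l /\
  forall h e, unif_approx h e -> cmod ('D_1 h a - l) <= 2 * e / r.
Proof.
have [en en0 small] : exists2 en : nat -> R, (forall n, 0 < en n) &
    forall e, 0 < e -> exists N, forall n, (N <= n)%N -> en n <= e.
  exists (fun n => n.+1%:R^-1) => [n|e e0]; first by rewrite invr_gt0.
  have [N _ NP] := near_infty_natSinv_lt (PosNum e0).
  by exists N => n /NP /ltW.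
have [hn hP] := choice (fun n => approxP (en0 n)).
have [l lP] : exists l, forall e, 0 < e -> exists N, forall n, (N <= n)%N -> cmod ('D_1 (hn n) a - l) <= e.
  apply: cauchy_cvgc => e e0; have e1 : 0 < e * r / 4 by rewrite divr_gt0 ?mulr_gt0.
  have [N NP] := small _ e1; exists N => n Nn; apply: le_trans (approx_D (hP n) (hP N)) _.
  rewrite ler_pdivrMr//; have := NP n Nn; have := NP N (leqnn N); lra.
have HD h e : unif_approx h e -> cmod ('D_1 h a - l) <= 2 * e / r.
  move=> A; apply/ler_addgt0Pl => t t0.
  have t1 : 0 < t / 2 by rewrite divr_gt0.
  have t2 : 0 < t * r / 4 by rewrite divr_gt0 ?mulr_gt0.
  have [N1 NP1] := lP _ t1; have [N2 NP2] := small _ t2.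
  pose n := maxn N1 N2; have H3 := NP1 n (leq_maxl _ _); have H2 := NP2 n (leq_maxr _ _).
  have := approx_D A (hP n); move: ('D_1 h a) ('D_1 (hn n) a) H3 => c c' H3 H1.
  have -> : c - l = (c - c') + (c' - l) by ring.
  apply: le_trans (cmodD_le _ _) _; apply: le_trans (lerD H1 H3) _.
  have : 2 * (e + en n) / r <= 2 * (e + t * r / 4) / r.
    by rewrite ler_pM2r ?invr_gt0// ler_pM2l// lerD2l.
  have -> : 2 * (e + t * r / 4) / r = 2 * e / r + t / 2 by field; rewrite gt_eqF.
  lra.
exists l; split=> // e e0.
(* There are three errors of [e / 3]: [g - h] is Lipschitz at [a], [h] is differentiable at [a], and
   ['D_1 h a] is close to [l]. *)
have e3 : 0 < e / 3 by rewrite divr_gt0.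
have e4 : 0 < e / 3 * r / 2 by rewrite divr_gt0 ?mulr_gt0.
have [h A] := approxP e4; have [[dh _ _] _] := A.
have [d d0 dP] := derivable_cdiff dh e3.
exists (Num.min d r); first by rewrite lt_min d0.
move=> k; rewrite lt_min => /andP[kd kr].
have ak : a + k - a = k by rewrite addrAC subrr add0r.
have zr : cmod (a + k - a) <= r by rewrite ak ltW.
have := approx_limit_lip A zr; rewrite ak => H1; have := dP k kd; have := HD _ _ A.
move: ('D_1 h a) => c H3 H2.
have -> : g (a + k) - g a - l * k = (g (a + k) - h (a + k) - (g a - h a)) +
   (h (a + k) - h a - c * k) + (c - l) * k by ring.
move: H1 H3; have -> : 2 * (e / 3 * r / 2) / r = e / 3 by field; rewrite gt_eqF.
move=> H1 H3.
have -> : e * cmod k = e / 3 * cmod k + e / 3 * cmod k + e / 3 * cmod k by field.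
apply: le_trans (cmodD_le _ _) _; rewrite lerD//.
  by apply: le_trans (cmodD_le _ _) _; rewrite lerD.
by rewrite cmodM ler_wpM2r// cmod_ge0.
Qed.

Lemma weierstrass_derivable : derivable g a 1.
Proof. by have [l [/cdiff_derivable]] := weierstrass_cdiff. Qed.

Lemma weierstrass_D h e : unif_approx h e -> cmod ('D_1 h a - 'D_1 g a) <= 2 * e / r.
Proof. by have [l [/cdiff_D -> ]] := weierstrass_cdiff; apply. Qed.

End Limit.

Lemma cont_bounded f a r : 0 <= r -> (forall z, cmod (z - a) <= r -> {for z, continuous f}) ->
  exists M : R, forall z, cmod (z - a) <= r -> cmod (f z) <= M.
Proof.
move=> r0 cf; have A0 : [set z : Cplx R | cmod (z - a) <= r] !=set0.
  by exists a; rewrite /= subrr cmod0.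
have [|b _ Pb] := @compact_EVT_max _ _ (fun z => cmod (f z)) _ A0 (compact_cdisk (a := a) (r := r)).
  apply: continuous_in_subspaceT => z; rewrite inE /= => zr.
  by apply: (@cvg_comp _ _ _ f (@cmod R)); [exact: cf|exact: cmod_continuous].
by exists (cmod (f b)) => z zr; apply: Pb; rewrite inE.
Qed.

(* [dq f a] is the uniform limit near [a] of [dq f b] for [b -> a], and [dq f b] is
   differentiable at [a] when [b != a]. *)
Lemma dq_derivable_eq f a r : 0 < r -> (forall z, cmod (z - a) < r -> derivable f z 1) ->
  derivable (dq f a) a 1.
Proof.
move=> r0 df; pose t := r / 2.
have t0 : 0 < t by rewrite divr_gt0.
have tr : t < r by rewrite /t ltr_pdivrMr// ltr_pMr// ltr1n.
have cf z : cmod (z - a) <= t -> {for z, continuous f}.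
  by move=> zt; apply: derivable_cont; apply: df; apply: le_lt_trans tr.
have nb b : cmod (b - a) < r -> forall z, cmod (z - a) <= t -> {for z, continuous (dq f b)}.
  move=> br z zt; have [->|zb] := eqVneq z b; first by apply: dq_cont_eq; exact: df.
  exact: (dq_cont_neq zb (cf z zt)).
have pf z : cmod (z - a) < t -> punct_holo f z by have [_ _] := holo_quasi_holo tr r0 df; apply.
apply: (@weierstrass_derivable _ a t t0) => e e0.
have [M MP] := cont_bounded (ltW t0) cf.
have M0 : 0 <= M by apply: le_trans (cmod_ge0 _) (MP a _); rewrite subrr cmod0 ltW.
have e1 : 0 < e * t / 4 by rewrite divr_gt0 ?mulr_gt0.
have ca : {for a, continuous f} by apply: cf; rewrite subrr cmod0 ltW.
have [d d0 dP] := (ccontP _ _).1 ca _ e1.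
(* The three terms ensure [|f b - f a| <= e t / 4], [|w - b| >= t / 2] on the circle, and
   [2 M s <= e t^2 / 4]. The numerator of the difference of the two quotients is then at most
   [e t^2 / 2]. *)
pose s := Num.min (Num.min (d / 2) (t / 2)) (e * t ^+ 2 / (8 * (M + 1))).
have M1 : 0 < M + 1 by rewrite ltr_wpDl.
have s0 : 0 < s by rewrite !lt_min !divr_gt0// ?mulr_gt0// exprn_gt0.
pose b := a + s%:C%C.
have ba : cmod (b - a) = s by rewrite /b addrAC subrr add0r cmod_real gtr0_norm.
have sd : s < d.
  by apply: le_lt_trans (_ : d / 2 < d); rewrite ?ge_min ?lexx// ltr_pdivrMr// ltr_pMr// ltr1n.
have st : s <= t / 2 by rewrite !ge_min lexx orbT.
have se : 2 * M * s <= e * t ^+ 2 / 4.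
  apply: (@le_trans _ _ (2 * (M + 1) * s)); first by rewrite ler_wpM2r ?(ltW s0)//; lra.
  have : s <= e * t ^+ 2 / (8 * (M + 1)) by rewrite !ge_min lexx orbT.
  rewrite ler_pdivlMr ?mulr_gt0//; lra.
have br : cmod (b - a) < r by rewrite ba; lra.
have bna : a != b by rewrite eq_sym -subr_eq0 -cmod_gt0 ba.
have N : quasi_holo (dq f b) a t.
  split; [by apply: (dq_derivable_neq bna); apply: df; rewrite subrr cmod0|exact: nb|].
  by move=> z zt; apply: dq_punct; exact: pf.
exists (dq f b); split; first exact: N.
(* The maximum principle moves the estimate to the circle, away from both base points [a] and
   [b]. *)
move=> z zt; apply: (@max_principle _ (fun z => dq f b z - dq f a z) a t); last exact: zt.
- move=> w wt; have aar : cmod (a - a) < r by rewrite subrr cmod0.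
  exact: (cvgB (nb b br w wt) (nb a aar w wt)).
- move=> w wt; have [d1 d10 P1] := dq_punct b (pf w wt); have [d2 d20 P2] := dq_punct a (pf w wt).
  exists (Num.min d1 d2); first by rewrite lt_min d10.
  move=> v; rewrite lt_min => /andP[v0 /andP[v1 v2]].
  by apply: derivableB; [apply: P1|apply: P2]; rewrite v0.
move=> w wt.
have wa0 : w - a != 0 by rewrite -cmod_gt0 wt.
have wa : w != a by rewrite -subr_eq0.
have wb : t / 2 <= cmod (w - b).
  have -> : w - b = (w - a) - (b - a) by ring.
  by apply: le_trans (cmod_subr_le _ _); rewrite wt ba; lra.
have wb0 : w - b != 0 by rewrite -cmod_gt0; apply: lt_le_trans wb; rewrite divr_gt0.
have wnb : w != b by rewrite -subr_eq0.
rewrite (dq_neq f wnb) (dq_neq f wa).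
have -> : (f w - f b) / (w - b) - (f w - f a) / (w - a) =
  ((f w - f a) * (b - a) - (f b - f a) * (w - a)) / ((w - a) * (w - b)) by field; rewrite wa0 wb0.
rewrite cmod_div [cmod ((w - a) * _)]cmodM wt ler_pdivrMr; last first.
  by rewrite mulr_gt0// cmod_gt0.
apply: le_trans (cmodB_le _ _) _; rewrite !cmodM ba wt.
have h1 : cmod (f w - f a) * s <= e * t ^+ 2 / 4.
  apply: le_trans se; rewrite ler_wpM2r ?(ltW s0)//.
  apply: le_trans (cmodB_le _ _) _; rewrite mulr_natl mulr2n lerD ?MP ?wt//.
  by rewrite subrr cmod0 ltW.
have h2 : cmod (f b - f a) * t <= e * t / 4 * t.
  by rewrite ler_wpM2r ?(ltW t0)// dP// ba.
have h3 : e * (t * (t / 2)) <= e * (t * cmod (w - b)) by rewrite !ler_wpM2l// ltW.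
apply: le_trans (lerD h1 h2) _; apply: le_trans h3; rewrite le_eqVlt; apply/orP; left; apply/eqP.
by field.
Qed.

Lemma dq_holo f a r : 0 < r -> (forall z, cmod (z - a) < r -> derivable f z 1) ->
  forall z, cmod (z - a) < r -> derivable (dq f a) z 1.
Proof.
move=> r0 df z zr; have [->|za] := eqVneq z a; first exact: dq_derivable_eq r0 df.
exact: (dq_derivable_neq za (df z zr)).
Qed.

End Weierstrass.

(** * Self-maps of the disk *)

Section Schwarz.
Variable R : realType.
Implicit Types (z w a b c : Cplx R) (x y e r M : R) (f g h : Cplx R -> Cplx R).

Definition holo a r f := forall z, cmod (z - a) < r -> derivable f z 1.

(** If [q = |dq f a z|] exceeded [M / r], some radius [s < r] beyond both [|z - a|] and [M / q]
    would contradict [dq_bound], which needs a closed disk. *)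
Lemma schwarz_dq f a r M : 0 < r -> holo a r f ->
  (forall z, cmod (z - a) < r -> cmod (f z - f a) <= M) ->
  forall z, cmod (z - a) < r -> cmod (dq f a z) <= M / r.
Proof.
move=> r0 hf fM z zr; rewrite leNgt; apply/negP => H.
have M0 : 0 <= M by apply: le_trans (cmod_ge0 _) (fM z zr).
set q := cmod (dq f a z) in H.
have q0 : 0 < q by apply: le_lt_trans H; rewrite divr_ge0// ltW.
have Mq : M / q < r by move: H; rewrite !ltr_pdivrMr// mulrC.
pose s := (Num.max (cmod (z - a)) (M / q) + r) / 2.
have mr : Num.max (cmod (z - a)) (M / q) < r by rewrite gt_max zr.
have zm : cmod (z - a) <= Num.max (cmod (z - a)) (M / q) by rewrite le_max lexx.
have qm : M / q <= Num.max (cmod (z - a)) (M / q) by rewrite le_max lexx orbT.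
have sr : s < r by rewrite /s; lra.
have zs : cmod (z - a) < s by rewrite /s; lra.
have qs : M / q < s by rewrite /s; lra.
have s0 : 0 < s by apply: le_lt_trans (cmod_ge0 _) zs.
have : q <= M / s.
  apply: (dq_bound s0 (holo_quasi_holo sr r0 hf)); last exact: ltW.
  by move=> w ws; apply: fM; rewrite ws.
by rewrite ler_pdivlMr// mulrC -ler_pdivlMr// leNgt qs.
Qed.

Lemma schwarz_lip f a r M : 0 < r -> holo a r f ->
  (forall z, cmod (z - a) < r -> cmod (f z - f a) <= M) ->
  forall z, cmod (z - a) < r -> cmod (f z - f a) <= M / r * cmod (z - a).
Proof.
move=> r0 hf fM z zr; rewrite (dqE f a z) addrAC subrr add0r cmodM.
by rewrite ler_wpM2r ?cmod_ge0//; exact: (schwarz_dq r0 hf fM).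
Qed.

Lemma cauchy_D f a r M : 0 < r -> holo a r f ->
  (forall z, cmod (z - a) < r -> cmod (f z - f a) <= M) -> cmod ('D_1 f a) <= M / r.
Proof. by move=> r0 hf fM; rewrite -dq_eq; apply: (schwarz_dq r0 hf fM); rewrite subrr cmod0. Qed.

Lemma holo_sub a r b s f : cmod (b - a) + s <= r -> holo a r f -> holo b s f.
Proof.
move=> H hf z zs; apply: hf; have -> : z - a = (b - a) + (z - b) by ring.
by apply: le_lt_trans (cmodD_le _ _) _; lra.
Qed.

(** For close points this is the Schwarz lemma on the disk of radius [r2 - r1] around [w]; for
    points at distance at least [r2 - r1] the right-hand side is at least [2 M]. *)
Lemma bounded_lip f r1 r2 M : r1 < r2 -> holo 0 r2 f ->
  (forall z, cmod z < r2 -> cmod (f z) <= M) ->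
  forall z w, cmod z <= r1 -> cmod w <= r1 ->
    cmod (f z - f w) <= 2 * M / (r2 - r1) * cmod (z - w).
Proof.
move=> r12 hf fM z w z1 w1; have s0 : 0 < r2 - r1 by rewrite subr_gt0.
have fM2 u v : cmod u < r2 -> cmod v < r2 -> cmod (f u - f v) <= 2 * M.
  by move=> u2 v2; apply: le_trans (cmodB_le _ _) _; rewrite mulr_natl mulr2n lerD ?fM.
have w2 : cmod w < r2 by apply: le_lt_trans r12.
have z2 : cmod z < r2 by apply: le_lt_trans r12.
have [zw|zw] := ltP (cmod (z - w)) (r2 - r1).
  have hw : holo w (r2 - r1) f by apply: holo_sub hf; rewrite subr0; lra.
  apply: (schwarz_lip s0 hw) zw => u us; apply: fM2; last exact: w2.
  have -> : u = w + (u - w) by ring.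
  by apply: le_lt_trans (cmodD_le _ _) _; lra.
apply: (@le_trans _ _ (2 * M)); first exact: fM2.
rewrite mulrAC ler_pdivlMr// ler_wpM2l//.
by rewrite mulr_ge0//; apply: le_trans (cmod_ge0 _) (fM z z2).
Qed.

Lemma bounded_D f r1 r2 M : r1 < r2 -> holo 0 r2 f ->
  (forall z, cmod z < r2 -> cmod (f z) <= M) ->
  forall z, cmod z <= r1 -> cmod ('D_1 f z) <= 2 * M / (r2 - r1).
Proof.
move=> r12 hf fM z z1; have s0 : 0 < r2 - r1 by rewrite subr_gt0.
have hz : holo z (r2 - r1) f by apply: holo_sub hf; rewrite subr0; lra.
apply: (cauchy_D s0 hz) => u us; apply: le_trans (cmodB_le _ _) _.
rewrite mulr_natl mulr2n lerD ?fM//; last exact: le_lt_trans r12.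
have -> : u = z + (u - z) by ring.
by apply: le_lt_trans (cmodD_le _ _) _; lra.
Qed.

Section NearIdentity.
Variables (G : Cplx R -> Cplx R) (r1 r2 m : R).
Hypotheses (r12 : r1 < r2) (hG : holo 0 r2 G)
  (Gm : forall z, cmod z < r2 -> cmod (G z - z) <= m).

Let hh : holo 0 r2 (fun z => G z - z).
Proof. by move=> z zr; apply: derivableB; [exact: hG|exact: derivable_id]. Qed.

Lemma near_id_inj : 2 * m < r2 - r1 ->
  forall z w, cmod z <= r1 -> cmod w <= r1 -> G z = G w -> z = w.
Proof.
move=> mr z w zr wr E; have := bounded_lip r12 hh Gm zr wr.
rewrite E (_ : G w - z - (G w - w) = - (z - w)); last by ring.
rewrite cmodN => H; apply/eqP; rewrite -subr_eq0; apply/negPn/negP => zw.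
move: H; rewrite -subr_le0 -[X in X - _]mul1r -mulrBl pmulr_lle0 ?cmod_gt0// subr_le0.
by rewrite ler_pdivlMr ?subr_gt0// mul1r leNgt mr.
Qed.

Lemma near_id_D z : cmod z <= r1 -> cmod ('D_1 G z - 1) <= 2 * m / (r2 - r1).
Proof.
move=> zr; have := bounded_D r12 hh Gm zr.
have dG : derivable G z 1 by apply: hG; rewrite subr0; exact: le_lt_trans r12.
have d2 : derivable (id : Cplx R -> Cplx R) z 1 by exact: derivable_id.
by rewrite (deriveB dG d2) derive_id.
Qed.

(* A minimiser [z] of [|G z - y|] is a solution, since [y - (G z - z)] is at most half as far. *)
Lemma near_id_surj (y : Cplx R) : 0 <= r1 -> 4 * m <= r2 - r1 -> cmod y + m <= r1 ->
  exists2 z : Cplx R, cmod z <= r1 & G z = y.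
Proof.
move=> r10 mr ym; have m0 : 0 <= m.
  by apply: le_trans (cmod_ge0 _) (Gm (z := 0) _); rewrite cmod0 (le_lt_trans r10).
have A0 : [set z : Cplx R | cmod (z - 0) <= r1] !=set0 by exists 0; rewrite /= subrr cmod0.
have [|z] := @compact_EVT_min _ _ (fun z => cmod (G z - y)) _ A0 (compact_cdisk (a := 0) (r := r1)).
  apply: continuous_in_subspaceT => z; rewrite inE /= => zr.
  have cG : {for z, continuous G} by apply: derivable_cont; apply: hG; exact: le_lt_trans r12.
  apply: (@cvg_comp _ _ _ (fun z => G z - y) (@cmod R)); last exact: cmod_continuous.
  exact: (cvgB cG (cvg_cst _)).
rewrite inE /= subr0 => zr zmin; exists z; first exact: zr.
have z2 : cmod z < r2 by apply: le_lt_trans r12.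
pose w := y - (G z - z).
have wr : cmod w <= r1.
  by apply: le_trans (cmodB_le _ _) _; apply: le_trans ym; rewrite lerD2l Gm.
have := zmin w; rewrite inE /= subr0 => /(_ wr).
have -> : G w - y = (G w - w) - (G z - z) by rewrite /w; ring.
have := bounded_lip r12 hh Gm wr zr.
have -> : w - z = - (G z - y) by rewrite /w; ring.
rewrite cmodN => H1 H2.
have H3 : 2 * m / (r2 - r1) <= 2^-1.
  by rewrite ler_pdivrMr ?subr_gt0//; lra.
have := cmod_ge0 (G z - y); have := ler_wpM2r (cmod_ge0 (G z - y)) H3 => H4 H5.
have : cmod (G z - y) = 0 by lra.
by move/eqP; rewrite cmod_eq0 subr_eq0 => /eqP.
Qed.
End NearIdentity.

Lemma cjM z w : cj (z * w) = cj z * cj w.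
Proof. exact: rmorphM. Qed.

Lemma cmod_cj z : cmod (cj z) = cmod z.
Proof. by case: z => x y; rewrite !cmod_sqrt /= sqrrN. Qed.

Lemma pick_identity c w :
  cmod (1 - cj c * w) ^+ 2 = cmod (w - c) ^+ 2 + (1 - cmod c ^+ 2) * (1 - cmod w ^+ 2).
Proof.
rewrite !cmod_sq !(cReB, cImB) cReM cImM.
case: c w => [c1 c2] [w1 w2] /=.
by ring.
Qed.

Lemma pick_den_neq0 c w : cmod c < 1 -> cmod w <= 1 -> 1 - cj c * w != 0.
Proof.
move=> c1 w1; rewrite subr_eq0; apply/eqP => E.
have : cmod (cj c * w) < 1.
  rewrite cmodM cmod_cj; apply: le_lt_trans (ler_wpM2l (cmod_ge0 _) w1) _.
  by rewrite mulr1.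
by rewrite -E cmod1 ltxx.
Qed.

Definition moebius c w : Cplx R := (w - c) / (1 - cj c * w).

Lemma pick_den_gt0 c w : cmod c < 1 -> cmod w <= 1 -> 0 < cmod (1 - cj c * w).
Proof. by move=> c1 w1; rewrite cmod_gt0; exact: pick_den_neq0. Qed.

Lemma moebius_le1 c w : cmod c < 1 -> cmod w <= 1 -> cmod (moebius c w) <= 1.
Proof.
move=> c1 w1; rewrite cmod_div ler_pdivrMr ?pick_den_gt0// mul1r.
rewrite -(ler_pXn2r (n := 2)) ?nnegrE ?cmod_ge0// pick_identity lerDl mulr_ge0 ?subr_ge0//.
  by rewrite expr_le1 ?cmod_ge0// ltW.
by rewrite expr_le1 ?cmod_ge0.
Qed.

Lemma moebius_lt1 c w : cmod c < 1 -> cmod w < 1 -> cmod (moebius c w) < 1.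
Proof.
move=> c1 w1; have w1' := ltW w1; rewrite cmod_div ltr_pdivrMr ?pick_den_gt0// mul1r.
rewrite -(ltr_pXn2r (n := 2)) ?nnegrE ?cmod_ge0// pick_identity ltrDl mulr_gt0 ?subr_gt0//.
  by rewrite expr_lt1 ?cmod_ge0.
by rewrite expr_lt1 ?cmod_ge0.
Qed.

Lemma moebius_den_derivable c w : derivable (fun v : Cplx R => 1 - cj c * v : Cplx R) w 1.
Proof.
apply: derivableB; first exact: derivable_cst.
by apply: derivableM; [exact: derivable_cst|exact: derivable_id].
Qed.

Lemma moebius_derivable c w : cmod c < 1 -> cmod w <= 1 -> derivable (moebius c) w 1.
Proof.
move=> c1 w1; have d1 := @derivable_subr R c w.
have d2 := @derivableV _ _ _ w 1 (pick_den_neq0 c1 w1) (@moebius_den_derivable c w).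
exact: (derivableM d1 d2).
Qed.

Lemma moebius_self c : moebius c c = 0.
Proof. by rewrite /moebius subrr mul0r. Qed.

Lemma moebius_0 c : moebius c 0 = - c.
Proof. by rewrite /moebius mulr0 subr0 sub0r divr1. Qed.

Lemma moebius0 w : moebius 0 w = w.
Proof. by rewrite /moebius subr0 conjc0 mul0r subr0 divr1. Qed.

Lemma moebiusK c w : cmod c < 1 -> cmod w < 1 -> moebius (- c) (moebius c w) = w.
Proof.
move=> c1 w1; have d := pick_den_neq0 c1 (ltW w1).
have cc := pick_den_neq0 c1 (ltW c1).
rewrite /moebius rmorphN /=; move: (cj c) d cc => k d cc.
have E1 : (w - c) / (1 - k * w) - - c = w * (1 - k * c) / (1 - k * w).
  by field; exact: d.
have E2 : 1 - - k * ((w - c) / (1 - k * w)) = (1 - k * c) / (1 - k * w).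
  by field; exact: d.
rewrite E1 E2; field.
by rewrite d cc.
Qed.

Lemma moebiusVK c w : cmod c < 1 -> cmod w < 1 -> moebius c (moebius (- c) w) = w.
Proof. by move=> c1 w1; rewrite -{1}[c]opprK moebiusK// cmodN. Qed.

Lemma moebius_D c : cmod c < 1 -> 'D_1 (moebius c) c = (1 - cj c * c)^-1.
Proof.
move=> c1; have d1 := @derivable_subr R c c.
have d2 := @derivableV _ _ _ c 1 (pick_den_neq0 c1 (ltW c1)) (@moebius_den_derivable c c).
rewrite (deriveM d1 d2) subrr scale0r add0r.
have d3 : derivable (id : Cplx R -> Cplx R) c 1 by exact: derivable_id.
rewrite (deriveB d3 (derivable_cst _ _ _)) derive_id derive_cst subr0.
by rewrite /GRing.scale /= mulr1.
Qed.

(** Difference quotients of self-maps may take values on the unit circle, where the Moebius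
    denominator can vanish. Hence the Moebius map is applied to [t q] with [t < 1], the inequality
    is cleared of denominators, and [t] tends to [1]. *)
Lemma schwarz_pick q z : holo 0 1 q -> (forall z, cmod z < 1 -> cmod (q z) <= 1) ->
  cmod z < 1 -> cmod (q z - q 0) <= cmod z * cmod (1 - cj (q 0) * q z).
Proof.
move=> hq q1 z1.
have q0 : cmod (q 0) <= 1 by apply: q1; rewrite cmod0.
have K t : 0 < t -> t < 1 -> t * cmod (q z - q 0) <= cmod z * cmod (1 - t%:C%C ^+ 2 * (cj (q 0) * q z)).
  move=> t0 t1; pose c := t%:C%C * q 0 : Cplx R; pose f w := moebius c (t%:C%C * q w).
  have tq w : cmod w < 1 -> cmod (t%:C%C * q w : Cplx R) < 1.
    move=> /q1 qw; rewrite cmodM cmod_real gtr0_norm//.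
    by apply: le_lt_trans (ler_wpM2l (ltW t0) qw) _; rewrite mulr1.
  have c1 : cmod c < 1 by apply: tq; rewrite cmod0.
  have f0 : f 0 = 0 by exact: moebius_self.
  have z1' : cmod (z - 0) < 1 by rewrite subr0.
  have hf : holo 0 1 f.
    move=> w; rewrite subr0 => w1.
    apply: (@derivable_compc _ (fun w => t%:C%C * q w)).
      by apply: derivableM; [exact: derivable_cst|apply: hq; rewrite subr0].
    by apply: moebius_derivable; [exact: c1|apply: ltW; exact: tq].
  have f1 w : cmod (w - 0) < 1 -> cmod (f w - f 0) <= 1.
    rewrite f0 !subr0 => w1; apply: moebius_le1; [exact: c1|apply: ltW; exact: tq].
  have := schwarz_lip ltr01 hf f1 z1'.
  rewrite f0 !subr0 divr1 mul1r /f /moebius cmod_div.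
  rewrite ler_pdivrMr; last by apply: pick_den_gt0; [exact: c1|apply: ltW; exact: tq].
  rewrite /c -mulrBr cmodM cmod_real gtr0_norm// cjM conjc_real.
  by rewrite (_ : t%:C%C * cj (q 0) * (t%:C%C * q z) = t%:C%C ^+ 2 * (cj (q 0) * q z)); last by ring.
set A := cmod (q z - q 0); set w : Cplx R := cj (q 0) * q z.
have A2 : A <= 2.
  by apply: le_trans (cmodB_le _ _) _; rewrite [2]mulr2n; exact: lerD (q1 _ z1) q0.
have w1 : cmod w <= 1.
  by rewrite cmodM cmod_cj mulr_ile1 ?cmod_ge0// q1.
apply/ler_addgt0Pl => e e0.
(* With [t = 1 - s] the left side loses at most [2 s] and the right side gains at most [2 s]. *)
have [s [s0 s1 se]] : exists s : R, [/\ 0 < s, s < 1 & 4 * s <= e].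
  exists (Num.min (1/2) (e / 4)); rewrite lt_min !divr_gt0//; split => //.
    by apply: le_lt_trans (_ : 1/2 < 1); [rewrite ge_min lexx|lra].
  by rewrite mulrC -ler_pdivlMr// ge_min lexx orbT.
have := K (1 - s); rewrite subr_gt0 s1 ltrBlDr ltrDl s0 => /(_ isT isT).
rewrite -/A -/w => H.
have : cmod (1 - (1 - s)%:C%C ^+ 2 * w) <= cmod (1 - w) + 2 * s.
  have -> : 1 - (1 - s)%:C%C ^+ 2 * w = (1 - w) + (1 - (1 - s) ^+ 2)%:C%C * w.
    by rewrite [in RHS]rmorphB rmorph1 rmorphXn /=; ring.
  have -> : 1 - (1 - s) ^+ 2 = s * (2 - s) by ring.
  have ss : 0 <= s * (2 - s) by rewrite mulr_ge0; lra.
  apply: le_trans (cmodD_le _ _) _; rewrite lerD2l cmodM cmod_real ger0_norm//.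
  apply: le_trans (ler_wpM2l ss w1) _; rewrite mulr1 mulrC ler_wpM2r; lra.
move=> H2; have := ler_wpM2l (cmod_ge0 z) H2; rewrite mulrDr.
have zs : cmod z * (2 * s) <= 2 * s by rewrite ler_piMl ?mulr_ge0 ?ltW.
have := ler_wpM2l (ltW s0) A2; lra.
Qed.

(** A Harnack-type comparison of distances to the boundary point [1], resting on
    [|1 - cj x y| <= |1 - y| + |1 - x|]. *)
Lemma pick_one_dist (x y : Cplx R) r : 0 <= r -> cmod y <= 1 ->
  cmod (x - y) <= r * cmod (1 - cj x * y) ->
  cmod (1 - y) * (1 - r) <= (1 + r) * cmod (1 - x).
Proof.
move=> r0 y1 H.
have E1 : cmod (1 - y) - cmod (1 - x) <= cmod (x - y).
  have -> : x - y = (1 - y) - (1 - x) by ring.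
  exact: cmod_subr_le.
have : cmod (1 - cj x * y) <= cmod (1 - y) + cmod (1 - x).
  have -> : 1 - cj x * y = (1 - y) + y * (1 - cj x) by ring.
  apply: le_trans (cmodD_le _ _) _; rewrite lerD2l cmodM.
  have -> : 1 - cj x = cj (1 - x) by rewrite rmorphB rmorph1.
  by rewrite cmod_cj ler_piMl ?cmod_ge0.
by move/(ler_wpM2l r0); lra.
Qed.

(** [pick_identity] holds for [|c|], [|q|] with the same product [(1 - |c|^2) (1 - |q|^2)], so
    passing to moduli can only decrease the pseudo-hyperbolic distance. *)
Lemma pick_upper (c q : Cplx R) r : 0 <= r -> r < 1 -> cmod c <= 1 -> cmod q <= 1 ->
  cmod (q - c) <= r * cmod (1 - cj c * q) ->
  cmod q * (1 + cmod c * r) <= cmod c + r.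
Proof.
move=> r0 r1 c1 q1 H.
have k0 := cmod_ge0 c; have x0 := cmod_ge0 q.
suff : cmod q - cmod c <= r * (1 - cmod c * cmod q) by lra.
have ck : 0 <= 1 - cmod c * cmod q by rewrite subr_ge0 mulr_ile1.
have [qc|qc] := leP (cmod q) (cmod c).
  by apply: (@le_trans _ _ 0); rewrite ?subr_le0// mulr_ge0.
rewrite -(ler_pXn2r (n := 2)) ?nnegrE ?mulr_ge0// ?subr_ge0 ?(ltW qc)//.
have h1 : (cmod q - cmod c) ^+ 2 <= cmod (q - c) ^+ 2.
  by rewrite ler_pXn2r ?nnegrE ?cmod_ge0 ?subr_ge0 ?(ltW qc)// cmod_subr_le.
have h2 : cmod (q - c) ^+ 2 <= r ^+ 2 * cmod (1 - cj c * q) ^+ 2.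
  by rewrite -exprMn ler_pXn2r ?nnegrE ?cmod_ge0 ?mulr_ge0 ?cmod_ge0.
rewrite pick_identity in h2.
have r2 : 0 <= 1 - r ^+ 2 by rewrite subr_ge0 expr_le1// ltW.
have := ler_wpM2l r2 h1.
rewrite exprMn (_ : (1 - cmod c * cmod q) ^+ 2 = (cmod q - cmod c) ^+ 2 +
  (1 - cmod c ^+ 2) * (1 - cmod q ^+ 2)); last by ring.
lra.
Qed.

(** Used for [|c|] close to [1], where it forces [q] to be close to [c]. It comes from
    [1 - cj c q = (1 - |c|^2) - cj c (q - c)]. *)
Lemma pick_center (c q : Cplx R) r : 0 <= r -> cmod c <= 1 ->
  cmod (q - c) <= r * cmod (1 - cj c * q) ->
  cmod (q - c) * (1 - r) <= r * (1 - cmod c ^+ 2).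
Proof.
move=> r0 c1 H.
have : cmod (1 - cj c * q) <= (1 - cmod c ^+ 2) + cmod c * cmod (q - c).
  have -> : 1 - cj c * q = (1 - cmod c ^+ 2)%:C%C - cj c * (q - c).
    rewrite rmorphB rmorph1 rmorphXn /= -[(cmod c)%:C%C]cmodE.
    by rewrite sqr_normc; ring.
  apply: le_trans (cmodB_le _ _) _; rewrite cmod_real cmodM cmod_cj ger0_norm//.
  by rewrite subr_ge0 expr_le1 ?cmod_ge0.
move/(ler_wpM2l r0); rewrite mulrDr => H2.
have : r * (cmod c * cmod (q - c)) <= r * cmod (q - c).
  by rewrite ler_wpM2l// ler_piMl ?cmod_ge0.
lra.
Qed.

Definition self_map f := holo 0 1 f /\ forall z, cmod z < 1 -> cmod (f z) < 1.

Lemma self_map_dq f : self_map f -> f 0 = 0 ->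
  holo 0 1 (dq f 0) /\ forall z, cmod z < 1 -> cmod (dq f 0 z) <= 1.
Proof.
move=> [hf f1] f0; split; first exact: (dq_holo ltr01 hf).
have fM z : cmod (z - 0) < 1 -> cmod (f z - f 0) <= 1.
  by rewrite f0 !subr0 => /f1 /ltW.
by move=> z z1; have := schwarz_dq ltr01 hf fM (z := z); rewrite subr0 divr1; exact.
Qed.

Lemma self_map_schwarz f z : self_map f -> f 0 = 0 -> cmod z < 1 -> cmod (f z) <= cmod z.
Proof.
move=> hf f0 z1; rewrite (dqE f 0 z) f0 add0r subr0 cmodM ler_piMl ?cmod_ge0//.
by have [_ ->] := self_map_dq hf f0.
Qed.

Lemma self_map_dq_pick f z : self_map f -> f 0 = 0 -> cmod z < 1 ->
  cmod (dq f 0 z - 'D_1 f 0) <= cmod z * cmod (1 - cj ('D_1 f 0) * dq f 0 z).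
Proof.
move=> hf f0 z1; have [h1 h2] := self_map_dq hf f0.
by have := schwarz_pick h1 h2 z1; rewrite dq_eq.
Qed.

Lemma self_map_comp f g : self_map f -> self_map g -> self_map (g \o f).
Proof.
move=> [hf f1] [hg g1]; split => [z|z z1]; last by apply: g1; exact: f1.
rewrite subr0 => z1; apply: derivable_compc; first by apply: hf; rewrite subr0.
by apply: hg; rewrite subr0; exact: f1.
Qed.

Lemma self_map_moebius c : cmod c < 1 -> self_map (moebius c).
Proof.
move=> c1; split => z; last exact: moebius_lt1.
by rewrite subr0 => z1; apply: moebius_derivable c1 (ltW z1).
Qed.

Lemma cmod_half : cmod ((2^-1 : R)%:C%C : Cplx R) = 2^-1.
Proof. by rewrite cmod_real gtr0_norm// invr_gt0. Qed.

(** The value at [0] alone would not detect a rotation, hence the second point [1/2]. After a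
    Moebius map brings [f 0] back to [0], the map is [z p(z)] with [|p| <= 1], and [pick_one_dist]
    carries the smallness of [1 - p] from [1/2] to [0] and from [0] to [z]. When [|f 0| < 1/2] the
    constants accumulate to [12] and [52]; otherwise the left side is at most [2]. *)
Lemma displacement f z r : self_map f -> cmod z <= r -> r < 1 ->
  cmod (f z - z) * (1 - r) <=
  60 * (cmod (f 0) + cmod (f (2^-1 : R)%:C%C - (2^-1 : R)%:C%C)).
Proof.
move=> sf zr r1; set h : Cplx R := (2^-1)%:C%C; have [hf f1] := sf.
have z1 : cmod z < 1 by apply: le_lt_trans r1.
have r0 : 0 <= r := le_trans (cmod_ge0 _) zr.
have ch : cmod h = 2^-1 := cmod_half.
have h1 : cmod h < 1 by rewrite ch invf_lt1// ltr1n.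
clearbody h.
set b := f 0; set d := cmod (f h - h).
have b1 : cmod b < 1 by apply: f1; rewrite cmod0.
have d0 : 0 <= d := cmod_ge0 _; have b0 : 0 <= cmod b := cmod_ge0 _.
have [bh|bh] := leP (2^-1) (cmod b).
  have : cmod (f z - z) <= 2.
    by apply: le_trans (cmodB_le _ _) _; rewrite [2]mulr2n; exact: lerD (ltW (f1 _ z1)) (ltW z1).
  have := cmod_ge0 (f z - z) => k1 k2.
  have : cmod (f z - z) * (1 - r) <= 2 * 1 by rewrite ler_pM//; lra.
  lra.
pose X := moebius b \o f.
have sX : self_map X by apply: self_map_comp sf (self_map_moebius b1).
have X0 : X 0 = 0 by rewrite /X /= moebius_self.
have Xf w : cmod w < 1 -> cmod (X w - f w) <= 4 * cmod b.
  move=> w1; have fw := f1 w w1; rewrite /X /= /moebius; move: (f w) fw => y fw.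
  have dn := pick_den_neq0 b1 (ltW fw); have dp := pick_den_gt0 b1 (ltW fw).
  have -> : (y - b) / (1 - cj b * y) - y = (cj b * y * y - b) / (1 - cj b * y).
    by field; exact: dn.
  rewrite cmod_div ler_pdivrMr//.
  have : cmod (cj b * y * y - b) <= 2 * cmod b.
    apply: le_trans (cmodB_le _ _) _; rewrite !cmodM cmod_cj -mulrA.
    have : cmod y * cmod y <= 1 by rewrite mulr_ile1 ?cmod_ge0 ?ltW.
    by move/(ler_wpM2l b0); lra.
  have : 2^-1 <= cmod (1 - cj b * y).
    apply: le_trans (cmod_subr_le _ _); rewrite cmod1 cmodM cmod_cj.
    have : cmod b * cmod y <= cmod b := ler_piMr b0 (ltW fw).
    lra.
  by move/(ler_wpM2l b0); lra.
have [hp p1] := self_map_dq sX X0.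
have XE w : X w = dq X 0 w * w by rewrite (dqE X 0 w) X0 add0r subr0.
move: (dq X 0) hp p1 XE => p hp p1 XE.
have z0 : cmod (0 : Cplx R) < 1 by rewrite cmod0.
have Pz := schwarz_pick hp p1 z1; have Ph := schwarz_pick hp p1 h1.
have K1 : cmod (1 - p z) * (1 - r) <= (1 + r) * cmod (1 - p 0).
  apply: pick_one_dist r0 (p1 _ z1) _.
  by rewrite cmodB; apply: le_trans Pz _; rewrite ler_wpM2r ?cmod_ge0.
have K2 : cmod (1 - p 0) * (1 - 2^-1) <= (1 + 2^-1) * cmod (1 - p h).
  apply: pick_one_dist _ (p1 _ z0) _; first by rewrite invr_ge0.
  apply: le_trans Ph _; rewrite ch ler_wpM2l ?invr_ge0//.
  by rewrite -cmod_cj rmorphB rmorphM rmorph1 /= conjcK mulrC.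
have K3 : cmod (1 - p h) <= 2 * (d + 4 * cmod b).
  have : cmod (h - X h) <= d + 4 * cmod b.
    have -> : h - X h = - (f h - h) - (X h - f h) by ring.
    by apply: le_trans (cmodB_le _ _) _; rewrite cmodN lerD// Xf.
  have -> : h - X h = (1 - p h) * h by rewrite XE; ring.
  by rewrite cmodM ch; lra.
have K4 : cmod (z - X z) <= cmod (1 - p z).
  have -> : z - X z = (1 - p z) * z by rewrite XE; ring.
  by rewrite cmodM; exact: ler_piMr (cmod_ge0 _) (ltW z1).
have K5 : cmod (f z - z) <= cmod (1 - p z) + 4 * cmod b.
  have -> : f z - z = - (z - X z) - (X z - f z) by ring.
  by apply: le_trans (cmodB_le _ _) _; rewrite cmodN lerD// Xf.
have s0 : 0 <= 1 - r by lra.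
have := ler_wpM2r s0 K5; rewrite mulrDl.
have : (1 + r) * cmod (1 - p 0) <= 2 * cmod (1 - p 0) by rewrite ler_wpM2r ?cmod_ge0//; lra.
have : 4 * cmod b * (1 - r) <= 4 * cmod b by rewrite ler_piMr ?mulr_ge0//; lra.
lra.
Qed.

End Schwarz.

(** * Growth under composition of small steps *)

Section Growth.
Variable R : realType.
Implicit Types (z w : Cplx R) (x y r k q : R) (f : Cplx R -> Cplx R).

(** Induction on the number of steps of length [d]; it serves for growth, for injectivity and for
    the non-vanishing of derivatives. *)
Lemma small_steps_ind (P : R -> R -> Prop) (T d : R) : 0 < d ->
  (forall s t, 0 <= s -> s <= t -> t <= T -> t - s <= d -> P s t) ->
  (forall s u t, 0 <= s -> s <= u -> u <= t -> t <= T -> P s u -> P u t -> P s t) ->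
  forall s t, 0 <= s -> s <= t -> t <= T -> P s t.
Proof.
move=> d0 Ploc Ptr s t s0 st tT.
have H n : forall s, 0 <= s -> s <= t -> t - s <= n%:R * d -> P s t.
  elim: n => [|n IH] {s s0 st} s s0 st h.
    by apply: Ploc => //; apply: le_trans h _; rewrite mul0r ltW.
  have [?|tsd] := leP (t - s) d; first exact: Ploc.
  apply: (Ptr s (s + d) t) => //; [lra|lra| |].
    by apply: Ploc; lra.
  by apply: IH; [lra|lra|move: h; rewrite -natr1 mulrDl; lra].
apply: (H (Num.truncn ((t - s) / d)).+1) => //.
by rewrite -ler_pdivrMr// ltW// truncnS_gt.
Qed.

(* The Koebe function is [x / (1 - x)^2]; with the exponent [3] the growth bound
   [koebe |f z| <= |f'(0)| koebe |z|] holds without univalence as soon as [|f'(0)| >= 1/2], hence along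
   small steps, and Bieberbach's theorem is not needed. *)
Definition koebe x := x / (1 - x) ^+ 3.

Lemma koebe_ge0 x : 0 <= x -> x < 1 -> 0 <= koebe x.
Proof. by move=> x0 x1; rewrite divr_ge0// exprn_ge0//; lra. Qed.

Lemma koebe_le x y : 0 <= x -> x <= y -> y < 1 -> koebe x <= koebe y.
Proof.
move=> x0 xy y1; rewrite /koebe ler_pM ?invr_ge0 ?exprn_ge0//; try lra.
rewrite lef_pV2 ?posrE ?exprn_gt0//; try lra.
by rewrite ler_pXn2r ?nnegrE//; lra.
Qed.

Lemma koebe_ge_id x : 0 <= x -> x < 1 -> x <= koebe x.
Proof.
move=> x0 x1; rewrite /koebe ler_pdivlMr ?exprn_gt0; try lra.
by rewrite ler_piMr// expr_le1//; lra.
Qed.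

(** The argument on the left is the Schwarz-Pick bound for [|f z|] with [k = |f'(0)|] and [r = |z|].
    With exponent [2] the inequality would amount to [r (1 - k)^2 <= 0]; with exponent [3] the
    coefficient of [r] becomes [(2 k - 1) (1 - k)], whence the threshold [1/2]. *)
Lemma koebe_step k r : 2^-1 <= k -> k <= 1 -> 0 <= r -> r < 1 ->
  koebe ((k + r) / (1 + k * r) * r) <= k * koebe r.
Proof.
move=> k2 k1 r0 r1; have k0 : 0 < k by lra.
have kr : 0 <= k * r by rewrite mulr_ge0// ltW.
have p1 : 0 < 1 + k * r by lra.
have -> : koebe ((k + r) / (1 + k * r) * r) =
   (r / (1 - r) ^+ 3) * ((k + r) * (1 + k * r) ^+ 2 / (1 + r) ^+ 3).
  have n1 : 1 + k * r != 0 by rewrite lt0r_neq0.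
  have n2 : 1 - r != 0 by rewrite lt0r_neq0; lra.
  have n3 : 1 + r != 0 by rewrite lt0r_neq0; lra.
  have E : 1 - (k + r) / (1 + k * r) * r = (1 - r) * (1 + r) / (1 + k * r) by field.
  rewrite /koebe E; field.
  by rewrite n1 n2 n3.
rewrite mulrC [leRHS]mulrC -/(koebe r) [leLHS]mulrC ler_wpM2l ?koebe_ge0//.
rewrite ler_pdivrMr ?exprn_gt0; try lra.
have h1 : 0 <= r * ((2 * k - 1) * (1 - k)) by rewrite !mulr_ge0//; lra.
have h2 : 0 <= r ^+ 2 * (k * (1 - k) * (1 + k)) by rewrite !mulr_ge0 ?exprn_ge0//; lra.
have h3 : 0 <= r ^+ 3 * (k * (1 - k)) by rewrite !mulr_ge0 ?exprn_ge0//; lra.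
rewrite -subr_ge0.
have -> : k * (1 + r) ^+ 3 - (k + r) * (1 + k * r) ^+ 2 =
   r * ((2 * k - 1) * (1 - k)) + r ^+ 2 * (k * (1 - k) * (1 + k)) +
   (r ^+ 2 * (k * (1 - k)) * 0 + r ^+ 3 * (k * (1 - k))) by ring.
lra.
Qed.

Lemma self_map_D_le1 f : self_map f -> f 0 = 0 -> cmod ('D_1 f 0) <= 1.
Proof.
move=> sf f0; have [_ H] := self_map_dq sf f0.
by rewrite -dq_eq; apply: H; rewrite cmod0.
Qed.

Lemma self_map_koebe f z : self_map f -> f 0 = 0 -> cmod z < 1 ->
  2^-1 <= cmod ('D_1 f 0) -> koebe (cmod (f z)) <= cmod ('D_1 f 0) * koebe (cmod z).
Proof.
move=> sf f0 z1; have k1 := self_map_D_le1 sf f0; have Hp := self_map_dq_pick sf f0 z1.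
have [_ d1] := self_map_dq sf f0; have {}d1 := d1 z z1.
have := pick_upper (cmod_ge0 z) z1 k1 d1 Hp => Hq k2.
apply: le_trans (koebe_step k2 k1 (cmod_ge0 z) z1).
have kr : 0 <= cmod ('D_1 f 0) * cmod z by rewrite mulr_ge0 ?cmod_ge0.
move: (cmod ('D_1 f 0)) k1 k2 Hq kr {Hp} => k k1 k2 Hq kr.
apply: koebe_le; first exact: cmod_ge0.
  rewrite {1}(dqE f 0 z) f0 add0r subr0 cmodM ler_wpM2r ?cmod_ge0//.
  rewrite ler_pdivlMr//; clear f0; lra.
have := cmod_ge0 z; move: (cmod z) z1 kr => r r1 kr r0; clear f0 d1 Hq.
rewrite mulrAC ltr_pdivrMr; last lra.
have : 0 < (1 - r) * (1 + r) by rewrite mulr_gt0; lra.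
by rewrite mul1r mulrDl; lra.
Qed.

End Growth.

(** The interface between the evolution family and the limit construction, free of Moebius maps and
    integrals. [nf_steps] says that [|psi_{s,t}'(0)| >= 1/2] on short steps, the threshold of
    [self_map_koebe]. *)
Record normalized_family (R : realType) (psi : R -> R -> Cplx R -> Cplx R)
    (la : R -> Cplx R) (beta : R) : Prop := NormalizedFamily {
  nf_self : forall s t : R, 0 <= s -> s <= t -> self_map (psi s t);
  nf_0 : forall s t : R, 0 <= s -> s <= t -> psi s t 0 = 0;
  nf_inj : forall (s t : R) (z w : Cplx R), 0 <= s -> s <= t -> cmod z < 1 -> cmod w < 1 ->
    psi s t z = psi s t w -> z = w;
  nf_comp : forall (s u t : R) (z : Cplx R), 0 <= s -> s <= u -> u <= t -> cmod z < 1 ->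
    psi s t z = psi u t (psi s u z);
  nf_la_neq0 : forall t : R, 0 <= t -> la t != 0;
  nf_D : forall s t : R, 0 <= s -> s <= t -> 'D_1 (psi s t) 0 = la t / la s;
  nf_steps : forall T : R, exists2 d : R, 0 < d & forall s t : R, 0 <= s -> s <= t -> t <= T ->
    t - s <= d -> cmod (la s) <= 2 * cmod (la t);
  nf_lim : forall e : R, 0 < e -> exists2 T : R, 0 <= T &
    forall t : R, T <= t -> `|cmod (la t) - beta| <= e
}.

(** * Normalized families: growth, and closeness of rescaled maps to the identity *)

Section Normalized.
Variable R : realType.
Variables (psi : R -> R -> Cplx R -> Cplx R) (la : R -> Cplx R) (beta : R).
Implicit Types (s t u : R) (z w : Cplx R) (r e m : R).
Hypothesis nf : normalized_family psi la beta.
Let psi_self := nf_self nf.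
Let psi0 := nf_0 nf.
Let psi_comp := nf_comp nf.
Let la_neq0 := nf_la_neq0 nf.
Let psi_D := nf_D nf.
Let la_steps := nf_steps nf.
Let la_lim := nf_lim nf.

Lemma la_gt0 t : 0 <= t -> 0 < cmod (la t).
Proof. by move=> t0; rewrite cmod_gt0 la_neq0. Qed.

Lemma la_le s t : 0 <= s -> s <= t -> cmod (la t) <= cmod (la s).
Proof.
move=> s0 st; have := self_map_D_le1 (psi_self s0 st) (psi0 s0 st).
by rewrite psi_D// cmod_div ler_pdivrMr ?mul1r// la_gt0.
Qed.

Lemma beta_le t : 0 <= t -> beta <= cmod (la t).
Proof.
move=> t0; apply/ler_addgt0Pl => e e0; have [T T0 HT] := la_lim e0.
have := HT (Num.max t T); rewrite le_max lexx orbT => /(_ isT).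
rewrite ler_norml => /andP[h _].
have := @la_le t (Num.max t T) t0; rewrite le_max lexx => /(_ isT).
by move=> k; lra.
Qed.

(** Each short step multiplies [koebe] by at most the modulus of its derivative at [0], and these
    factors telescope. *)
Lemma psi_koebe s t z : 0 <= s -> s <= t -> cmod z < 1 ->
  koebe (cmod (psi s t z)) <= cmod (la t) / cmod (la s) * koebe (cmod z).
Proof.
move=> s0 st; have [d d0 Hd] := la_steps t.
pose P s t := forall z, cmod z < 1 ->
  koebe (cmod (psi s t z)) <= cmod (la t) / cmod (la s) * koebe (cmod z).
have : P s t; last by apply.
apply: (@small_steps_ind R P t d d0 _ _ s t s0 st (lexx t)).
  move=> a b a0 ab bt h v v1; rewrite -cmod_div -psi_D//.
  apply: (self_map_koebe (psi_self a0 ab) (psi0 a0 ab) v1).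
  rewrite psi_D// cmod_div ler_pdivlMr ?la_gt0//.
  by have := Hd a b a0 ab bt h; lra.
move=> a b c a0 ab bc ct Pab Pbc v v1; have b0 := le_trans a0 ab.
rewrite (psi_comp a0 ab bc v1).
have w1 : cmod (psi a b v) < 1 by have [_] := psi_self a0 ab; apply.
apply: le_trans (Pbc _ w1) _.
have -> : cmod (la c) / cmod (la a) = cmod (la c) / cmod (la b) * (cmod (la b) / cmod (la a)).
  by rewrite mulrA divfK// lt0r_neq0// la_gt0.
by rewrite -[leRHS]mulrA ler_wpM2l ?divr_ge0 ?cmod_ge0//; exact: Pab.
Qed.

(** The map [F_{t,u}] of the overview: it has derivative [1] at [0], and tends to [la_t g_t] as [u]
    grows. *)
Definition rescaled t u w : Cplx R := psi t u w * la t / la u.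

Lemma rescaled_cmod t u w : cmod (rescaled t u w) = cmod (psi t u w) * (cmod (la t) / cmod (la u)).
Proof. by rewrite /rescaled cmod_div cmodM mulrA. Qed.

Lemma rescaled_holo t u : 0 <= t -> t <= u -> holo 0 1 (rescaled t u).
Proof.
move=> t0 tu w w1; have [h _] := psi_self t0 tu.
apply: derivableM; last exact: derivable_cst.
by apply: derivableM; [exact: h|exact: derivable_cst].
Qed.

Lemma cmod_psi_div s t z : 0 <= s -> s <= t -> cmod z < 1 ->
  cmod (psi s t z / la t) <= koebe (cmod z) / cmod (la s).
Proof.
move=> s0 st z1; have t0 := le_trans s0 st; have [_ ps] := psi_self s0 st.
rewrite cmod_div ler_pdivrMr ?la_gt0//.
apply: le_trans (koebe_ge_id (cmod_ge0 _) (ps z z1)) _.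
by apply: le_trans (psi_koebe s0 st z1) _; rewrite mulrC mulrCA mulrC.
Qed.

(** On [|w| < 1/2] the quotient [F(w) / w] is at most [koebe |w| / |w| <= 8], so its distance to its
    value [1] at [0] is at most [9]; the Schwarz lemma on the disk of radius [1/2] turns this into
    [18 |w|]. *)
Lemma rescaled_near_0 t u w : 0 <= t -> t <= u -> cmod w < 2^-1 ->
  cmod (rescaled t u w - w) <= 18 * cmod w ^+ 2.
Proof.
move=> t0 tu w2; have u0 := le_trans t0 tu.
have lt0 : cmod (la t) != 0 by rewrite lt0r_neq0// la_gt0.
have h0 : 0 < (2^-1 : R) by rewrite invr_gt0.
have h1 : (2^-1 : R) < 1 by rewrite invf_lt1// ltr1n.
have F0 : rescaled t u 0 = 0 by rewrite /rescaled psi0// !mul0r.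
have dps : derivable (psi t u) 0 1.
  by have [h _] := psi_self t0 tu; apply: h; rewrite subr0 cmod0.
have D0 : 'D_1 (rescaled t u) 0 = 1.
  have := derivable_cdiff dps; rewrite psi_D// => /cdiffP H.
  apply: cdiff_D; move/cdiffP: H => H e e0.
  have [d d0 dP] := H (e * (cmod (la u) / cmod (la t))) (mulr_gt0 e0 (divr_gt0 (la_gt0 u0) (la_gt0 t0))).
  exists d => // h hd; have := dP h hd; rewrite add0r.
  have -> : rescaled t u h - rescaled t u 0 - 1 * h = (psi t u h - psi t u 0 - la u / la t * h) * (la t / la u).
    rewrite /rescaled; field.
    by rewrite !la_neq0.
  rewrite cmodM cmod_div => K; apply: le_trans (ler_wpM2r _ K) _.
    by rewrite divr_ge0 ?cmod_ge0.
  rewrite le_eqVlt; apply/orP; left; apply/eqP; field.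
  by rewrite !lt0r_neq0 ?la_gt0.
have hF : holo 0 1 (rescaled t u) by exact: rescaled_holo.
have hp : holo 0 2^-1 (fun w => dq (rescaled t u) 0 w - 1).
  move=> v v1; have v1' : cmod (v - 0) < 1 by apply: lt_trans h1.
  have d1 := dq_holo ltr01 hF v1'.
  exact: (derivable_subc d1).
have p0 : dq (rescaled t u) 0 0 - 1 = 0 by rewrite dq_eq D0 subrr.
have bF v : cmod (v - 0) < 2^-1 -> cmod (dq (rescaled t u) 0 v - 1 - (dq (rescaled t u) 0 0 - 1)) <= 9.
  rewrite p0 !subr0 => v2; apply: le_trans (cmodB_le _ _) _; rewrite cmod1.
  have : cmod (dq (rescaled t u) 0 v) <= 8; last by lra.
  have [->|v0] := eqVneq v 0; first by rewrite dq_eq D0 cmod1; lra.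
  have v1 : cmod v < 1 by lra.
  have vp : 0 < cmod v by rewrite cmod_gt0.
  have e1 : cmod (dq (rescaled t u) 0 v) * cmod v <= koebe (cmod v).
    rewrite -cmodM; have := dqE (rescaled t u) 0 v; rewrite F0 add0r subr0 => <-.
    have := cmod_psi_div t0 tu v1; rewrite cmod_div => H.
    by rewrite rescaled_cmod mulrA mulrAC -ler_pdivlMr ?la_gt0.
  rewrite -(ler_pM2r vp); apply: le_trans e1 _.
  rewrite /koebe mulrC ler_wpM2r ?(ltW vp)// -[8]invrK lef_pV2 ?posrE ?exprn_gt0 ?invr_gt0//; last lra.
  have -> : 8^-1 = (2^-1) ^+ 3 :> R by field.
  have h8 : 2^-1 <= 1 - cmod v by lra.
  by rewrite lerXn2r ?nnegrE ?invr_ge0// (le_trans _ h8)// invr_ge0.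
have w2' : cmod (w - 0) < 2^-1 by rewrite subr0.
have := schwarz_lip h0 hp bF w2'; rewrite p0 !subr0 => H.
have -> : rescaled t u w - w = (dq (rescaled t u) 0 w - 1) * w.
  by rewrite (dqE (rescaled t u) 0 w) F0 add0r subr0 mulrBl mul1r.
rewrite cmodM expr2 mulrA ler_wpM2r ?cmod_ge0//; apply: le_trans H _.
by rewrite ler_wpM2r ?cmod_ge0//; lra.
Qed.

(** [pick_center] for the difference quotient of [psi t u], around [c = la u / la t] with
    [k <= |c| <= 1]. *)
Lemma rescaled_near_1 t u w r k : 0 <= t -> t <= u -> cmod w <= r -> r < 1 -> 0 < k ->
  k * cmod (la t) <= cmod (la u) -> cmod (rescaled t u w - w) <= (1 - k ^+ 2) / (k * (1 - r)).
Proof.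
move=> t0 tu wr r1 k0 kl; have u0 := le_trans t0 tu.
have w1 : cmod w < 1 by apply: le_lt_trans r1.
have sp := psi_self t0 tu; have p0 := psi0 t0 tu.
have c1 := self_map_D_le1 sp p0.
have [_ d1] := self_map_dq sp p0; have {}d1 := d1 w w1.
have H := pick_center (cmod_ge0 w) c1 (self_map_dq_pick sp p0 w1).
rewrite psi_D// in c1 H.
set c := la u / la t in c1 H.
have cn : c != 0 by rewrite mulf_neq0 ?invr_eq0 ?la_neq0.
have ck : k <= cmod c by rewrite cmod_div ler_pdivlMr ?la_gt0.
have -> : rescaled t u w - w = (dq (psi t u) 0 w - c) * w / c.
  have := dqE (psi t u) 0 w; rewrite p0 add0r subr0 /rescaled => ->.
  rewrite /c; field.
  by rewrite !la_neq0.
rewrite cmod_div cmodM; move: (cmod (dq _ _ _ - c)) H (cmod_ge0 (dq (psi t u) 0 w - c)) => x H x0.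
have cp : 0 < cmod c by rewrite cmod_gt0.
have w0 := cmod_ge0 w.
move: (cmod c) (cmod w) w1 w0 wr ck c1 cp H => a y y1 y0 yr ka a1 a0 H.
have ry : 0 < 1 - y by lra.
have x1 : x * y <= (1 - k ^+ 2) / (1 - r).
  apply: (@le_trans _ _ x); first by rewrite ler_piMr// ltW.
  apply: (@le_trans _ _ ((1 - a ^+ 2) / (1 - y))).
    rewrite ler_pdivlMr//; apply: le_trans H _; rewrite ler_piMl//; last lra.
    by rewrite subr_ge0 expr_le1// ltW.
  rewrite ler_pM ?invr_ge0//; try lra.
  - by rewrite subr_ge0 expr_le1// ltW.
  - by rewrite lerB// ler_pXn2r ?nnegrE// ltW.
  - by rewrite lef_pV2 ?posrE//; lra.
have z0 : 0 <= x * y by rewrite mulr_ge0.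
apply: (@le_trans _ _ ((1 - k ^+ 2) / (1 - r) / k)); last by rewrite -mulrA -invfM [_ * k]mulrC.
by rewrite ler_pM ?invr_ge0 ?(ltW a0)// lef_pV2 ?posrE.
Qed.

Definition rescaled_near_id t r m := forall u w, t <= u -> cmod w < r -> cmod (rescaled t u w - w) <= m.

Lemma rescaled_near_id_pos r m : 0 < beta -> r < 1 -> 0 < m ->
  exists2 T : R, 0 <= T & forall t, T <= t -> rescaled_near_id t r m.
Proof.
(* With [k = 1 - e], the bound of [rescaled_near_1] is at most [2 e / ((1 - e) (1 - r)) <= m]. *)
move=> b0 r1 m0; pose e := Num.min (2^-1) (m * (1 - r) / 4).
have e0 : 0 < e by rewrite lt_min invr_gt0 ltr0n divr_gt0// mulr_gt0//; lra.
have e2 : e <= 2^-1 by rewrite ge_min lexx.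
have em : e <= m * (1 - r) / 4 by rewrite ge_min lexx orbT.
have [T T0 HT] := la_lim (mulr_gt0 e0 b0); exists T => // t Tt u w tu wr.
have t0 := le_trans T0 Tt.
apply: (@le_trans _ _ ((1 - (1 - e) ^+ 2) / ((1 - e) * (1 - r)))).
  apply: rescaled_near_1 => //; [exact: ltW|lra|].
  have := beta_le (le_trans t0 tu); have := HT t Tt; rewrite ler_norml => /andP[_ h] h2.
  have := beta_le t0.
  have h3 : (1 - e) * cmod (la t) <= (1 - e) * (beta + e * beta) by rewrite ler_wpM2l; lra.
  have h4 : 0 <= e * (e * beta) by rewrite !mulr_ge0 ?ltW.
  lra.
rewrite ler_pdivrMr; last by rewrite mulr_gt0; lra.
have h1 : 0 < 1 - r by lra.
have mr0 := mulr_gt0 m0 h1.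
have : 2^-1 * (m * (1 - r)) <= (1 - e) * (m * (1 - r)) by rewrite ler_wpM2r; lra.
have := sqr_ge0 e; lra.
Qed.

Lemma rescaled_near_id_zero t r : 0 <= t -> r <= 2^-1 -> 0 <= r -> rescaled_near_id t r (18 * r ^+ 2).
Proof.
move=> t0 r2 r0 u w tu wr; apply: le_trans (rescaled_near_0 t0 tu _) _; first lra.
by rewrite ler_wpM2l// ler_pXn2r ?nnegrE ?cmod_ge0// ltW.
Qed.

(* If [beta > 0], take [r1 = r], as [F_{t,u}] tends to the identity on compact sets; if [beta = 0],
   the radii [r1] and [r2 = 2 r1] tend to [0] with [la t], and [m] is quadratic in them. *)
Lemma contracts s r e : 0 <= s -> 0 < r -> r < 1 -> 0 < e ->
  exists2 T : R, s <= T & forall t, T <= t -> exists r1 r2 m : R,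
   [/\ (0 <= r1 /\ r1 < r2), r2 <= 1, forall z, cmod z <= r -> cmod (psi s t z) <= r1,
      rescaled_near_id t r2 m & m <= e * (r2 - r1) /\ m <= e * cmod (la t)].
Proof.
move=> s0 r0 r1 e0; have [b0|b0] := ltP 0 beta.
  pose r2 := (1 + r) / 2; pose m := Num.min (e * (r2 - r)) (e * beta).
  have r20 : 0 < r2 - r by rewrite /r2; lra.
  have m0 : 0 < m by rewrite lt_min !mulr_gt0.
  have r21 : r2 < 1 by rewrite /r2; lra.
  have [T T0 HT] := rescaled_near_id_pos b0 r21 m0.
  exists (Num.max s T); first by rewrite le_max lexx.
  move=> t; rewrite ge_max => /andP[st Tt]; exists r, r2, m; split.
  - by split; [exact: ltW|lra].
  - exact: ltW.
  - move=> z zr; have z1 : cmod z < 1 by apply: le_lt_trans r1.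
    exact: le_trans (self_map_schwarz (psi_self s0 st) (psi0 s0 st) z1) zr.
  - exact: HT.
  split; first by rewrite ge_min lexx.
  apply: (@le_trans _ _ (e * beta)); first by rewrite ge_min lexx orbT.
  by rewrite ler_wpM2l ?(ltW e0)// beta_le// (le_trans s0).
have b00 : beta = 0.
  apply/eqP; rewrite eq_le b0 /=; apply/ler_addgt0Pl => d d0; have [T T0 HT] := la_lim d0.
  by have := HT T (lexx T); rewrite ler_norml => /andP[_]; have := cmod_ge0 (la T); lra.
have [K [KE K0]] : exists K : R, K = koebe r /\ 0 < K.
  by exists (koebe r); split => //; rewrite divr_gt0// exprn_gt0//; lra.
have ls := la_gt0 s0.
(* [k] will bound the radius [q] given by the growth estimate. The three conditions give
   [2 q <= 1/2], [m <= e q] and [m <= e |la t|], where [m = 18 (2 q)^2 = 72 q^2]. *)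
have [k [k0 k4 ke kl]] : exists k : R, [/\ 0 < k, 4 * k <= 1, 72 * k <= e & 72 * k * K <= e * cmod (la s)].
  exists (Num.min (Num.min (4^-1) (e / 72)) (e * cmod (la s) / (72 * K))).
  have p1 : 0 < 72 * K by rewrite mulr_gt0.
  have p2 : 0 < 4^-1 :> R by rewrite invr_gt0.
  have p3 : 0 < e / 72 by rewrite divr_gt0.
  have p4 : 0 < e * cmod (la s) / (72 * K) by rewrite divr_gt0// mulr_gt0.
  split; first by rewrite !lt_min p2 p3 p4.
  - by rewrite mulrC -ler_pdivlMr// div1r !ge_min lexx.
  - by rewrite mulrC -ler_pdivlMr// !ge_min lexx orbT.
  - by rewrite mulrAC mulrC -ler_pdivlMr// ge_min lexx orbT.
have [T T0 HT] := la_lim (divr_gt0 (mulr_gt0 k0 ls) K0).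
exists (Num.max s T); first by rewrite le_max lexx.
move=> t; rewrite ge_max => /andP[st Tt].
have t0 := le_trans s0 st; have lt := la_gt0 t0.
pose q := cmod (la t) / cmod (la s) * K.
have q0 : 0 < q by rewrite mulr_gt0// divr_gt0.
have qk : q <= k.
  have := HT t Tt; rewrite b00 subr0 ger0_norm ?cmod_ge0// ler_pdivlMr//.
  by rewrite /q mulrAC ler_pdivrMr.
exists q, (2 * q), (18 * (2 * q) ^+ 2); split.
- by split; lra.
- lra.
- move=> z zr; have z1 : cmod z < 1 by apply: le_lt_trans r1.
  have [_ ps] := psi_self s0 st.
  apply: le_trans (koebe_ge_id (cmod_ge0 _) (ps z z1)) _.
  apply: le_trans (psi_koebe s0 st z1) _.
  by rewrite /q KE ler_wpM2l ?divr_ge0 ?cmod_ge0// koebe_le ?cmod_ge0.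
- apply: rescaled_near_id_zero => //; lra.
have qq : 18 * (2 * q) ^+ 2 = 72 * q * q by ring.
have e1 : 72 * q * q <= e * q by rewrite ler_wpM2r ?(ltW q0)//; lra.
rewrite qq; split; first by lra.
have -> : 72 * q * q = 72 * q * K / cmod (la s) * cmod (la t) by rewrite /q; field; rewrite lt0r_neq0.
rewrite ler_wpM2r ?(ltW lt)// ler_pdivrMr//; apply: le_trans kl.
by rewrite ler_wpM2r ?(ltW K0)// ler_wpM2l.
Qed.

End Normalized.

(** * The limit of a normalized family *)

Section NormalizedLimit.
Variable R : realType.
Variables (psi : R -> R -> Cplx R -> Cplx R) (la : R -> Cplx R) (beta : R).
Implicit Types (s t u : R) (z w : Cplx R) (r e m : R).
Hypothesis nf : normalized_family psi la beta.
Let psi_self := nf_self nf.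
Let psi0 := nf_0 nf.
Let psi_comp := nf_comp nf.
Let la_neq0 := nf_la_neq0 nf.
Let psi_D := nf_D nf.
Let la_lim := nf_lim nf.

(** With [w = psi s t z], the difference is [(F_{t,u}(w) - w) / la_t]; this is why [contracts]
    bounds [m] by a multiple of [|la t|]. *)
Lemma psi_div_cauchy s r e : 0 <= s -> 0 < r -> r < 1 -> 0 < e ->
  exists2 T : R, s <= T & forall t u z, T <= t -> t <= u -> cmod z <= r ->
    cmod (psi s u z / la u - psi s t z / la t) <= e.
Proof.
move=> s0 r0 r1 e0; have [T sT HT] := contracts nf s0 r0 r1 e0.
exists T => // t u z Tt tu zr; have [r1' [r2 [m [[r10 r12] r21 psr nid [_ me]]]]] := HT t Tt.
have st := le_trans sT Tt; have t0 := le_trans s0 st; have u0 := le_trans t0 tu.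
have z1 : cmod z < 1 by apply: le_lt_trans r1.
have w2 : cmod (psi s t z) < r2 := le_lt_trans (psr z zr) r12.
rewrite (psi_comp s0 st tu z1); move: (psi s t z) w2 => w w2.
have -> : psi t u w / la u - w / la t = (rescaled psi la t u w - w) / la t.
  rewrite /rescaled; field.
  by rewrite !la_neq0.
by rewrite cmod_div ler_pdivrMr ?(la_gt0 nf)//; apply: le_trans (nid u w tu w2) me.
Qed.

Lemma rescaled_limit_exists : exists g : R -> Cplx R -> Cplx R,
  forall s r e, 0 <= s -> 0 < r -> r < 1 -> 0 < e ->
  exists2 T : R, s <= T & forall t z, T <= t -> cmod z <= r ->
    cmod (psi s t z / la t - g s z) <= e.
Proof.
(* The pointwise limit is taken along the times [s + n]; [psi_div_cauchy] then extends the
   convergence to all real times, uniformly in [z]. *)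
pose c s z n := psi s (s + n%:R) z / la (s + n%:R).
have [g gP] : exists g : R -> Cplx R -> Cplx R, forall s z, 0 <= s -> cmod z < 1 ->
    forall e, 0 < e -> exists N, forall n, (N <= n)%N -> cmod (c s z n - g s z) <= e.
  have H (p : R * Cplx R) : exists l : Cplx R, 0 <= p.1 -> cmod p.2 < 1 ->
    forall e, 0 < e -> exists N, forall n, (N <= n)%N -> cmod (c p.1 p.2 n - l) <= e.
    (* The value [0] elsewhere makes the limit a total function, as [choice] demands. *)
    case: p => s z /=; have [[s0 z1]|] := pselect (0 <= s /\ cmod z < 1); last first.
      by move=> h; exists 0 => s0 z1; case: h.
    have [|l lP] := @cauchy_cvgc _ (c s z); last by exists l.
    move=> e e0; have zr := cmod_ge0 z.
    have [||T sT HT] := @psi_div_cauchy s ((1 + cmod z) / 2) e s0 _ _ e0; try lra.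
    exists (Num.truncn (T - s)).+1 => n hn.
    have nT : T - s <= (Num.truncn (T - s)).+1%:R by rewrite ltW// truncnS_gt.
    apply: HT; [lra| |lra].
    by rewrite lerD2l ler_nat.
  have [h hP] := choice H; exists (fun s z => h (s, z)) => s z s0 z1 e e0.
  exact: (hP (s, z)).
exists g => s r e s0 r0 r1 e0; have e2 : 0 < e / 2 by rewrite divr_gt0.
have [T sT HT] := psi_div_cauchy s0 r0 r1 e2; exists T => // t z Tt zr.
have z1 : cmod z < 1 by apply: le_lt_trans r1.
have [N HN] := gP s z s0 z1 _ e2.
pose n := maxn N (Num.truncn (t - s)).+1.
have h1 := HN n (leq_maxl _ _).
have tn : t <= s + n%:R.
  have : t - s <= (Num.truncn (t - s)).+1%:R by rewrite ltW// truncnS_gt.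
  have : (Num.truncn (t - s)).+1%:R <= n%:R :> R by rewrite ler_nat leq_maxr.
  lra.
have h2 := HT t _ z Tt tn zr.
have -> : psi s t z / la t - g s z = (c s z n - g s z) - (c s z n - psi s t z / la t) by ring.
by apply: le_trans (cmodB_le _ _) _; rewrite [e]splitr lerD.
Qed.

Section Limit.
Variable g : R -> Cplx R -> Cplx R.
Hypothesis gP : forall s r e, 0 <= s -> 0 < r -> r < 1 -> 0 < e ->
  exists2 T : R, s <= T & forall t z, T <= t -> cmod z <= r ->
    cmod (psi s t z / la t - g s z) <= e.

Lemma limitP s z t0 e : 0 <= s -> cmod z < 1 -> 0 < e ->
  exists2 t : R, s <= t /\ t0 <= t & cmod (psi s t z / la t - g s z) <= e.
Proof.
move=> s0 z1 e0; have zr := cmod_ge0 z.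
have [||T sT HT] := @gP s ((1 + cmod z) / 2) e s0 _ _ e0; try lra.
exists (Num.max T t0); first by rewrite !le_max lexx sT orbT.
by apply: HT; [rewrite le_max lexx|lra].
Qed.

Lemma limit_approx s a : 0 <= s -> cmod a < 1 -> forall e, 0 < e ->
  exists2 t, s <= t & unif_approx (g s) a ((1 - cmod a) / 2) (fun z => psi s t z / la t) e.
Proof.
move=> s0 a1 e e0; have ar := cmod_ge0 a.
have [||T sT HT] := @gP s ((1 + cmod a) / 2) e s0 _ _ e0; try lra.
exists T => //; have [hs _] := psi_self s0 sT; split.
  apply: (@holo_quasi_holo _ _ _ _ (1 - cmod a)); [lra|lra|] => z za.
  apply: derivableM; last exact: derivable_cst.
  apply: hs; rewrite subr0; have -> : z = (z - a) + a by ring.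
  by apply: le_lt_trans (cmodD_le _ _) _; lra.
move=> z za; apply: (HT T) => //.
have -> : z = (z - a) + a by ring.
by apply: le_trans (cmodD_le _ _) _; lra.
Qed.

Lemma limit_holo s : 0 <= s -> holo 0 1 (g s).
Proof.
move=> s0 a; rewrite subr0 => a1; have r0 : 0 < (1 - cmod a) / 2 by lra.
apply: (weierstrass_derivable r0) => e e0.
by have [t _ H] := limit_approx s0 a1 e0; exists (fun z => psi s t z / la t).
Qed.

Lemma limit_D s : 0 <= s -> 'D_1 (g s) 0 = (la s)^-1.
Proof.
move=> s0; have z1 : cmod (0 : Cplx R) < 1 by rewrite cmod0.
have r0 : 0 < (1 - cmod (0 : Cplx R)) / 2 by lra.
have AP d : 0 < d -> exists h, unif_approx (g s) 0 ((1 - cmod (0 : Cplx R)) / 2) h d.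
  by move=> d0; have [u _ B] := limit_approx s0 z1 d0; exists (fun z => psi s u z / la u).
have H e : 0 < e -> cmod ((la s)^-1 - 'D_1 (g s) 0) <= 4 * e.
  move=> e0; have [t st A] := limit_approx s0 z1 e0.
  have := weierstrass_D r0 AP A.
  (* All approximations have the same derivative at [0], since [la t] cancels. *)
  have -> : 'D_1 (fun z => psi s t z / la t) 0 = (la s)^-1.
    have d1 : derivable (psi s t) 0 1 by have [h _] := psi_self s0 st; apply: h; rewrite subr0.
    have d2 : derivable (fun=> (la t)^-1 : Cplx R) (0 : Cplx R) 1 by exact: derivable_cst.
    rewrite (deriveM d1 d2) derive_cst scaler0 add0r psi_D// /GRing.scale /=.
    by rewrite mulrA mulVf ?mul1r// la_neq0// (le_trans s0).
  rewrite cmod0 subr0.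
  by have -> : 2 * e / (1 / 2) = 4 * e by field.
apply/eqP; rewrite eq_sym -subr_eq0 -cmod_eq0 eq_le cmod_ge0 andbT.
apply/ler_addgt0Pl => e e0; rewrite addr0; have := H (e / 4) (divr_gt0 e0 (ltr0Sn _ 3)).
by rewrite mulrC divfK.
Qed.

Lemma limit_eq s t z w v : 0 <= s -> 0 <= t -> cmod z < 1 -> cmod w < 1 ->
  (forall u, v <= u -> psi s u z = psi t u w) -> g s z = g t w.
Proof.
move=> s0 t0 z1 w1 H; apply/eqP; rewrite -subr_eq0 -cmod_eq0 eq_le cmod_ge0 andbT.
apply/ler_addgt0Pl => e e0; rewrite addr0; have e2 : 0 < e / 2 by rewrite divr_gt0.
have zr := cmod_ge0 z; have wr := cmod_ge0 w.
have [||T sT HT] := @gP s ((1 + cmod z) / 2) _ s0 _ _ e2; try lra.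
have [u [tu Tu] h2] := limitP (Num.max T v) t0 w1 e2.
move: Tu; rewrite ge_max => /andP[Tu vu].
have := HT u z Tu; rewrite (H u vu) => /(_ _) h1.
have {h1} : cmod (psi t u w / la u - g s z) <= e / 2 by apply: h1; lra.
move=> h1; have -> : g s z - g t w = (psi t u w / la u - g t w) - (psi t u w / la u - g s z) by ring.
by apply: le_trans (cmodB_le _ _) _; rewrite [e]splitr lerD.
Qed.

Lemma limit_assoc s t z : 0 <= s -> s <= t -> cmod z < 1 -> g t (psi s t z) = g s z.
Proof.
move=> s0 st z1; have t0 := le_trans s0 st; have [_ ps] := psi_self s0 st.
apply: (@limit_eq _ _ _ _ t) => //; first exact: ps.
by move=> u tu; rewrite [RHS](psi_comp s0 st tu z1).
Qed.

Lemma limit_le s z t0 (M : R) : 0 <= s -> cmod z < 1 ->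
  (forall t, s <= t -> t0 <= t -> cmod (psi s t z / la t) <= M) -> cmod (g s z) <= M.
Proof.
move=> s0 z1 H; apply/ler_addgt0Pl => e e0; have [t [st tt] h] := limitP t0 s0 z1 e0.
have -> : g s z = psi s t z / la t - (psi s t z / la t - g s z) by ring.
by apply: le_trans (cmodB_le _ _) _; rewrite addrC lerD// H.
Qed.

Lemma limit_koebe s z : 0 <= s -> cmod z < 1 -> cmod (g s z) <= koebe (cmod z) / cmod (la s).
Proof.
move=> s0 z1; apply: (@limit_le _ _ s) => // t st _.
exact: (cmod_psi_div nf s0 st z1).
Qed.

Lemma limit_0 s : 0 <= s -> g s 0 = 0.
Proof.
move=> s0; apply/eqP; rewrite -cmod_eq0 eq_le cmod_ge0 andbT.
have := @limit_koebe s 0 s0; rewrite cmod0 ltr01 => /(_ isT).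
by rewrite /koebe mul0r mul0r.
Qed.

Lemma limit_rescaled_near_id t r m : 0 <= t -> r <= 1 -> rescaled_near_id psi la t r m ->
  forall w, cmod w < r -> cmod (g t w * la t - w) <= m.
Proof.
move=> t0 r1 H w wr; have w1 : cmod w < 1 by apply: lt_le_trans r1.
have lt := la_gt0 nf t0.
apply/ler_addgt0Pl => e e0; have [u [tu _] h] := limitP t t0 w1 (divr_gt0 e0 lt).
have -> : g t w * la t - w = (rescaled psi la t u w - w) - (psi t u w / la u - g t w) * la t.
  by rewrite /rescaled; ring.
apply: le_trans (cmodB_le _ _) _; rewrite addrC lerD//; last exact: H.
by rewrite cmodM -ler_pdivlMr.
Qed.

Lemma scaled_holo t r : 0 <= t -> r <= 1 -> holo 0 r (fun w => g t w * la t).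
Proof.
move=> t0 r1 w wr; apply: derivableM; last exact: derivable_cst.
by apply: (limit_holo t0); apply: lt_le_trans r1.
Qed.

(** [g_s = g_T o psi_{s,T}] with [psi_{s,T}] injective. For large [T] the images of [z] and [w] lie
    where [la_T g_T] is within [m <= (r2 - r1) / 4] of the identity, so [near_id_inj] applies. *)
Lemma limit_inj s z w : 0 <= s -> cmod z < 1 -> cmod w < 1 -> g s z = g s w -> z = w.
Proof.
move=> s0 z1 w1 E; have zr := cmod_ge0 z; have wr := cmod_ge0 w.
have [r [r0 r1 zr' wr']] : exists r, [/\ 0 < r, r < 1, cmod z <= r & cmod w <= r].
  exists (Num.max (2^-1) (Num.max (cmod z) (cmod w))); rewrite gt_max !gt_max z1 w1 !le_max.
  by rewrite lt_max invr_gt0 ltr0n invf_lt1// ltr1n !lexx !orbT.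
have e0 : 0 < 4^-1 :> R by rewrite invr_gt0.
have [T sT HT] := contracts nf s0 r0 r1 e0.
have [r1' [r2 [m [[r10 r12] r21 psr nid [mr _]]]]] := HT T (lexx T).
have T0 := le_trans s0 sT.
apply: (nf_inj nf s0 sT z1 w1).
apply: (near_id_inj r12 (scaled_holo T0 r21) (limit_rescaled_near_id T0 r21 nid)); try exact: psr.
  lra.
by rewrite !limit_assoc// E.
Qed.

Lemma limit_surj t r1 r2 m y : 0 <= t -> 0 <= r1 -> r1 < r2 -> r2 <= 1 -> rescaled_near_id psi la t r2 m ->
  4 * m <= r2 - r1 -> cmod (y * la t : Cplx R) + m <= r1 ->
  exists2 z : Cplx R, cmod z < 1 & g t z = y.
Proof.
move=> t0 r10 r12 r21 nid mr ym.
have [z zr E] := near_id_surj r12 (scaled_holo t0 r21) (limit_rescaled_near_id t0 r21 nid) r10 mr ym.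
by exists z; [lra|exact: mulIf (la_neq0 t0) _ _ E].
Qed.

Lemma limit_union : \bigcup_(t in [set t : R | 0 <= t]) (g t @` [set z | cmod z < 1]) =
  if 0 < beta then [set w : Cplx R | cmod w < beta^-1] else setT.
Proof.
have [b0|b0] := ltP 0 beta.
  apply/seteqP; split => [_ [t /= t0 [z z1 <-]]|y /= yb].
    apply: (@le_lt_trans _ _ (cmod z / beta)); last first.
      by rewrite ltr_pdivrMr// mulVf// gt_eqF.
    apply: (@limit_le _ _ t) => // u tu _; have u0 := le_trans t0 tu.
    rewrite cmod_div ler_pM ?invr_ge0 ?cmod_ge0//.
      exact: self_map_schwarz (psi_self t0 tu) (psi0 t0 tu) z1.
    by rewrite lef_pV2 ?posrE ?(la_gt0 nf)// (beta_le nf).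
  have y0 := cmod_ge0 y.
  (* [|y la_t|] tends to [x]. The radii [(1 + x) / 2] and [(3 + x) / 4] differ by four times the
     error [(1 - x) / 16], as [limit_surj] requires. *)
  pose x := cmod y * beta; have x1 : x < 1 by rewrite /x -ltr_pdivlMr// div1r.
  have x0 : 0 <= x by rewrite mulr_ge0// ltW.
  have m0 : 0 < (1 - x) / 16 by lra.
  have r21 : (3 + x) / 4 < 1 by lra.
  have [T1 T10 HT1] := rescaled_near_id_pos nf b0 r21 m0.
  have y1 : 0 < cmod y + 1 by lra.
  have [T2 T20 HT2] := la_lim (divr_gt0 m0 y1).
  pose t := Num.max T1 T2.
  have t1 : T1 <= t by rewrite le_max lexx.
  have t2 : T2 <= t by rewrite le_max lexx orbT.
  have t0 : 0 <= t := le_trans T10 t1.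
  have [|||||z z1 E] := @limit_surj t ((1 + x) / 2) ((3 + x) / 4) _ y t0 _ _ _ (HT1 t t1); try lra.
    rewrite cmodM; have := HT2 t t2; rewrite ler_norml => /andP[_].
    rewrite ler_pdivlMr// => h.
    have h2 : cmod y * cmod (la t) <= x + (1 - x) / 16.
      have l0 := beta_le nf t0.
      have : cmod y * (cmod (la t) - beta) <= (cmod (la t) - beta) * (cmod y + 1).
        by rewrite mulrC ler_wpM2l; lra.
      rewrite mulrBr -/x; lra.
    lra.
  by exists t => //; exists z.
apply/seteqP; split => // y _.
have b00 : beta = 0.
  apply/eqP; rewrite eq_le b0 /=; apply/ler_addgt0Pl => d d0; have [T T0 HT] := la_lim d0.
  by have := HT T (lexx T); rewrite ler_norml => /andP[_]; have := cmod_ge0 (la T); lra.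
have y1 : 0 < cmod y + 1 by rewrite ltr_wpDl ?cmod_ge0.
(* The radii are [q / 2] and [q], so that [q / 8] is the largest error allowed; [t] is then chosen
   with [|y la_t| <= q / 8]. *)
have [q [q0 q1 qm]] : exists q : R, [/\ 0 < q, q <= 2^-1 & 18 * q ^+ 2 <= q / 8].
  have p0 : 0 < (8^-1 : R) by rewrite invr_gt0.
  have [q [q0 q1]] : exists q : R, 0 < q /\ 18 * q <= 8^-1.
    by exists (8^-1 * (8^-1 * 4^-1)); rewrite !mulr_gt0 ?invr_gt0//; split => //; lra.
  exists q; split => //; first by lra.
  by rewrite expr2 mulrA [leRHS]mulrC ler_wpM2r// ltW.
have [t t0 HT] := la_lim (divr_gt0 (divr_gt0 q0 (ltr0Sn _ 7)) y1).
have h := HT t (lexx t); rewrite b00 subr0 ger0_norm ?cmod_ge0// ler_pdivlMr// in h.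
have nid := rescaled_near_id_zero nf t0 q1 (ltW q0).
have [|||||z z1 E] := @limit_surj t (q / 2) q _ y t0 _ _ _ nid; try lra.
  rewrite cmodM; have : cmod y * cmod (la t) <= cmod (la t) * (cmod y + 1).
    by rewrite mulrC ler_wpM2l ?cmod_ge0//; lra.
  lra.
by exists t => //; exists z.
Qed.

End Limit.
End NormalizedLimit.

(** * Functions of class L^d on an interval *)

Section Ld.
Variable R : realType.
Variables (d : \bar R) (T : R).
Hypothesis d1 : (1 <= d)%E.
Implicit Types (k f g : R -> R) (u t e : R).

Let mu := @lebesgue_measure R.
Let mT := mrestr mu (measurable_itv (Interval (BLeft 0%R) (BRight T))).
Let D : set R := `[0, T].

Lemma Lnorm_mono (m : {measure set (measurableTypeR R) -> \bar R}) (f g : R -> R) :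
  (forall x, 0 <= f x <= g x) -> (Lnorm m d (EFin \o f) <= Lnorm m d (EFin \o g))%E.
Proof.
move=> fg; have d0 : (0 <= d)%E by apply: le_trans d1; rewrite lee_fin.
have nf x : `|f x| <= `|g x|.
  by have /andP[h1 h2] := fg x; rewrite !ger0_norm// (le_trans h1).
rewrite unlock /Lnorm; case: d d1 d0 => [r||//] r1 r0; last first.
  case: ifPn => // _; apply: le_ess_sup; apply: nearW => x /=.
  by rewrite lee_fin.
have r0' : (0 <= r)%R by rewrite -lee_fin.
apply: gt0_ler_poweR; first by rewrite invr_ge0.
- by rewrite in_itv /= integral_ge0// leey.
- by rewrite in_itv /= integral_ge0// leey.
(* In the application [g] is known to be measurable on [[0, T]] only, so monotonicity is read off
   from the supremum over simple functions. *)
rewrite !ge0_integralTE; try by move=> x; exact: poweR_ge0.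
apply: ereal_sup_le => _ [h /= hf <-]; exists h => // x.
apply: le_trans (hf x) _ => /=.
by rewrite lee_fin ge0_ler_powR ?nnegrE.
Qed.

(** Extension by zero makes [k] measurable on the whole line, which gives access to the vector space
    [Lfun]; integrals within [[0, T]] are unchanged. *)
Lemma Ld_Lfun k : Ld_nonneg d T k -> (k \_ D) \in Lfun mT d.
Proof.
move=> [k0 [mk kfin]]; rewrite inE; apply/andP; split; rewrite inE /=.
  have mD : measurable (D : set (measurableTypeR R)) by exact: measurable_itv.
  exact: (measurable_restrictT k mD).1 mk.
apply: le_lt_trans kfin; apply: Lnorm_mono => x.
by rewrite /patch; case: ifP => _; rewrite ?lexx k0.
Qed.

Lemma Lfun_Ld f : f \in Lfun mT d -> (forall x, 0 <= f x) -> Ld_nonneg d T f.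
Proof.
rewrite inE => /andP[/[!inE] /= mf ff] f0; split => //; split => //.
exact: measurable_funS mf.
Qed.

Lemma Lfun_measurable f u t : f \in Lfun mT d -> measurable_fun `[u, t] f.
Proof.
rewrite inE => /andP[/[!inE] /= mf _]; exact: measurable_funS mf.
Qed.

Lemma int_itv_restr k u t : 0 <= u -> t <= T -> int_itv k u t = int_itv (k \_ D) u t.
Proof.
move=> u0 tT; apply: eq_integral => x; rewrite inE /= in_itv /= => /andP[ux xt].
by rewrite /patch mem_set// /D /= in_itv /= (le_trans u0 ux) (le_trans xt tT).
Qed.

Lemma int_itvD f g u t : f \in Lfun mT d -> g \in Lfun mT d ->
  (forall x, 0 <= f x) -> (forall x, 0 <= g x) ->
  int_itv (fun x => f x + g x) u t = (int_itv f u t + int_itv g u t)%E.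
Proof.
move=> hf hg f0 g0; rewrite /int_itv -ge0_integralD//.
- by move=> x _; rewrite lee_fin.
- by apply/measurable_EFinP; exact: Lfun_measurable hf.
- by move=> x _; rewrite lee_fin.
- by apply/measurable_EFinP; exact: Lfun_measurable hg.
Qed.

Lemma int_itvZ f c u t : f \in Lfun mT d -> (forall x, 0 <= f x) -> 0 <= c ->
  int_itv (fun x => c * f x) u t = (c%:E * int_itv f u t)%E.
Proof.
move=> hf f0 c0; rewrite /int_itv -ge0_integralZl_EFin//.
- by move=> x _; rewrite lee_fin.
- by apply/measurable_EFinP; exact: Lfun_measurable hf.
Qed.

Lemma Lfun_add f g : f \in Lfun mT d -> g \in Lfun mT d -> (fun x => f x + g x) \in Lfun mT d.
Proof. by move=> hf hg; have := (@Lfun_submod_closed _ (measurableTypeR R) R _ d d1).2 1 f g hf hg; rewrite scale1r. Qed.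

Lemma Lfun_cmul f c : f \in Lfun mT d -> (fun x => c * f x) \in Lfun mT d.
Proof.
by move=> hf; have [h0 h] := @Lfun_submod_closed _ (measurableTypeR R) R mT d d1; have := h c f 0 hf h0; rewrite addr0.
Qed.

(** The restricted measure is finite, so [L^d] is contained in [L^1]. *)
Lemma Lfun_integrable_itv f : f \in Lfun mT d -> (forall x, 0 <= f x) ->
  mu.-integrable D (EFin \o f).
Proof.
move=> hf f0; have mTfin : mT [set: R] \is a fin_num.
  rewrite /mT /mrestr setTI /mu lebesgue_measure_itv /=; case: ifP => // _.
have := Lfun_subset (lexx 1%E) d1 mTfin d1 hf => /Lfun1_integrable/integrableP[mf intf].
apply/integrableP; split; first exact: measurable_funS mf.
apply: le_lt_trans intf.
rewrite [leLHS](eq_measure_integral mT); last first.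
  by move=> A mA AD; apply/esym; rewrite /mT /= /mrestr; congr (_ _); apply: setIidl; exact: AD.
have mD : measurable (D : set (measurableTypeR R)) by exact: measurable_itv.
refine (@ge0_subset_integral _ (measurableTypeR R) R mT D setT mD measurableT (fun x => `|(EFin \o f) x|)%E _ _ _) => //.
  exact: measurableT_comp mf.
Qed.

(** Absolute continuity of the integral; it turns the integral bounds into uniform continuity in
    time. *)
Lemma int_itv_small f : f \in Lfun mT d -> (forall x, 0 <= f x) -> forall e, 0 < e ->
  exists2 dl : R, 0 < dl & forall u t, 0 <= u -> u <= t -> t <= T -> t - u <= dl ->
    (int_itv f u t <= e%:E)%E.
Proof.
move=> hf f0 e e0; have intf := Lfun_integrable_itv hf f0.
have : mu.-integrable setT (EFin \o (f \_ D)).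
  have mD : measurable (D : set (measurableTypeR R)) by exact: measurable_itv.
  by rewrite -restrict_EFin; exact: (integrable_mkcond _ mD).1 intf.
move=> /integral_normr_continuous /(_ _ e0)[dl [dl0 H]].
exists (dl / 2); first by rewrite divr_gt0.
move=> u t u0 ut tT tu.
have mlt : (mu `[u, t] < dl%:E)%E.
  rewrite /mu lebesgue_measure_itv /=; case: ifP => _; last by rewrite lte_fin.
  by rewrite -EFinB lte_fin; lra.
have := H `[u, t] (measurable_itv _) mlt.
have sub : `[u, t] `<=` D by apply: subset_itv; rewrite bnd_simp.
have mD : measurable (D : set (measurableTypeR R)) by exact: measurable_itv.
have m2 : measurable (`[u, t] : set (measurableTypeR R)) by exact: measurable_itv.
have itf : mu.-integrable `[u, t] (EFin \o f) := integrableS mD m2 sub intf.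
have -> : \int[mu]_(x in `[u, t]) `|(f \_ D) x| = \int[mu]_(x in `[u, t]) f x.
  apply: eq_Rintegral => x; rewrite inE => /sub xD.
  by rewrite /patch mem_set// ger0_norm.
move=> h; rewrite /int_itv -[leLHS]fineK; first by rewrite lee_fin ltW.
exact: integrable_fin_num.
Qed.

End Ld.

(** * Uniform bounds on compact sets of times and points *)

Section Misc.
Variable R : realType.

(** The clamp [p] onto [[s, T]] is 1-Lipschitz, so [c o p] is continuous on the whole line and [c]
    attains its maximum on [[s, T]]. *)
Lemma unif_cont_lt1 (c : R -> R) (s T : R) : s <= T ->
  (forall e : R, 0 < e -> exists2 dl : R, 0 < dl & forall u t : R, s <= u -> u <= t -> t <= T ->
    t - u <= dl -> `|c u - c t| <= e) ->
  (forall u : R, s <= u -> u <= T -> c u < 1) ->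
  exists2 r : R, r < 1 & forall u : R, s <= u -> u <= T -> c u <= r.
Proof.
move=> sT uc c1; pose p u := Num.max s (Num.min u T).
have ps u : s <= p u by rewrite le_max lexx.
have pT u : p u <= T by rewrite ge_max sT ge_min lexx orbT.
have pid u : s <= u -> u <= T -> p u = u by move=> su uT; rewrite /p min_l// max_r.
have pinc u v : u <= v -> p u <= p v.
  move=> uv; rewrite ge_max ps /= /p le_max; apply/orP.
  have [h|h] := leP (Num.min v T) s; last first.
    by right; rewrite le_min ge_min uv ge_min lexx orbT.
  left; apply: le_trans h; by rewrite le_min ge_min uv ge_min lexx orbT.
have plip u v : u <= v -> p v - p u <= v - u.
  move=> uv; rewrite /p; case: (leP u T) => h1; case: (leP v T) => h2;
  case: (leP s u) => ?; case: (leP s v) => ?; case: (leP s T) => ?; lra.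
have cc : continuous (c \o p).
  move=> u; apply/cvgrPdist_le => e e0; have [dl dl0 H] := uc e e0.
  apply/(@nbhs_ballP R R); exists dl => // v; rewrite -ball_normE /= => uv.
  have {}uv := ltW uv; have [h|h] := leP u v.
    apply: H => //; first exact: pinc.
    apply: le_trans (plip _ _ h) _; apply: le_trans uv; rewrite distrC; exact: ler_norm.
  rewrite distrC; apply: H => //; first by apply: pinc; exact: ltW.
  by apply: le_trans (plip _ _ (ltW h)) _; apply: le_trans uv; exact: ler_norm.
have [m msT H] := EVT_max sT (continuous_subspaceT cc).
exists (c m).
  by move: msT; rewrite in_itv /= => /andP[h1 h2]; exact: c1.
move=> u su uT; have mE : p m = m.
  by move: msT; rewrite in_itv /= => /andP[h1 h2]; exact: pid.
by have := H u; rewrite in_itv /= su uT /= pid// mE; apply.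
Qed.

Lemma compact_disk_radius (K : set (Cplx R)) : compact K -> K `<=` @disk R ->
  exists r : R, [/\ 0 <= r, r < 1 & forall z, K z -> cmod z <= r].
Proof.
move=> cK Kd; have [->|/set0P K0] := eqVneq K set0.
  by exists 0; split.
have [|b bK Pb] := @compact_EVT_max _ _ (@cmod R) _ K0 cK.
  by apply: continuous_subspaceT; exact: cmod_continuous.
exists (cmod b); split; first exact: cmod_ge0.
  by apply/diskP; apply: Kd; rewrite inE in bK.
by move=> z Kz; apply: Pb; rewrite inE.
Qed.

(** By [pick_identity], [1 - m^2] is [(1 - |a|^2) (1 - |z|^2)] over a squared denominator at most
    [4], hence at least [e]; and [1 - m^2 <= 2 (1 - m)]. *)
Lemma moebius_bound (al r : R) : 0 <= al -> al < 1 -> 0 <= r -> r < 1 ->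
  exists2 q : R, q < 1 & forall a z : Cplx R, cmod a <= al -> cmod z <= r ->
    cmod (moebius a z) <= q.
Proof.
move=> al0 al1 r0 r1; pose e := (1 - al ^+ 2) * (1 - r ^+ 2) / 4.
have A : 0 < 1 - al ^+ 2 by rewrite subr_gt0 expr_lt1.
have B : 0 < 1 - r ^+ 2 by rewrite subr_gt0 expr_lt1.
have e0 : 0 < e by rewrite divr_gt0// mulr_gt0.
exists (1 - e / 2); first lra.
move=> a z aal zr; have a1 : cmod a < 1 by apply: le_lt_trans al1.
have z1 : cmod z <= 1 by apply: le_trans (ltW r1).
have D := pick_den_gt0 a1 z1; have P := pick_identity a z.
have D2 : cmod (1 - cj a * z) <= 2.
  apply: le_trans (cmodB_le _ _) _; rewrite cmod1 cmodM cmod_cj.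
  have : cmod a * cmod z <= 1 by rewrite mulr_ile1 ?cmod_ge0// ltW.
  lra.
set m := cmod (moebius a z).
have mE : m * cmod (1 - cj a * z) = cmod (z - a) by rewrite /m cmod_div divfK// gt_eqF.
have m0 : 0 <= m := cmod_ge0 _.
have h1 : (1 - al ^+ 2) * (1 - r ^+ 2) <= (1 - cmod a ^+ 2) * (1 - cmod z ^+ 2).
  apply: ler_pM; rewrite ?(ltW A) ?(ltW B)//.
    by rewrite lerB// ler_pXn2r ?nnegrE ?cmod_ge0.
  by rewrite lerB// ler_pXn2r ?nnegrE ?cmod_ge0.
have m1 : m <= 1 := moebius_le1 a1 z1.
have m2 : 0 <= 1 - m ^+ 2 by rewrite subr_ge0 expr_le1.
have h2 : (1 - m ^+ 2) * cmod (1 - cj a * z) ^+ 2 <= (1 - m ^+ 2) * 4.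
  rewrite ler_wpM2l// (_ : 4 = 2 ^+ 2); last by rewrite expr2; ring.
  by rewrite ler_pXn2r ?nnegrE ?cmod_ge0.
have h3 : (1 - m ^+ 2) * cmod (1 - cj a * z) ^+ 2 = (1 - cmod a ^+ 2) * (1 - cmod z ^+ 2).
  by rewrite mulrBl mul1r -exprMn mE P; ring.
have h4 : e <= 1 - m ^+ 2 by rewrite /e ler_pdivrMr//; lra.
have := sqr_ge0 (1 - m); rewrite sqrrB expr1n mul1r; lra.
Qed.

(** The arithmetic of [ev_la_steps], with [p = |a_s|], [q = |a_t|], [x = |phi_{s,t}'(a_s)|] and
    [y = |phi_{0,s}'(0)|]. The factor [2] is [4/3], from the denominators, times [3/2], from [x]. *)
Lemma step_bound (al p q x y : R) : al < 1 -> 0 <= p -> p <= al -> 0 <= q -> q <= al ->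
  p <= q + (1 - al ^+ 2) / 6 -> 0 <= y -> 2 / 3 <= x ->
  y / (1 - p ^+ 2) <= 2 * (x * y / (1 - q ^+ 2)).
Proof.
move=> al1 p0 pal q0 qal pq y0 x0; have al0 : 0 <= al by lra.
have A : 0 < 1 - al ^+ 2 by rewrite subr_gt0 expr_lt1.
have s2 : p ^+ 2 <= al ^+ 2 by rewrite ler_pXn2r ?nnegrE.
have t2 : q ^+ 2 <= al ^+ 2 by rewrite ler_pXn2r ?nnegrE.
have D : 1 - q ^+ 2 <= 4 / 3 * (1 - p ^+ 2).
  have e1 : p ^+ 2 - q ^+ 2 <= (1 - al ^+ 2) / 3.
    have -> : p ^+ 2 - q ^+ 2 = (p - q) * (p + q) by ring.
    apply: (@le_trans _ _ ((1 - al ^+ 2) / 6 * (p + q))).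
      by rewrite ler_wpM2r ?addr_ge0//; lra.
    have -> : (1 - al ^+ 2) / 3 = (1 - al ^+ 2) / 6 * 2 by field.
    by rewrite ler_wpM2l//; lra.
  lra.
have ps : 0 < 1 - p ^+ 2 by lra.
have pt : 0 < 1 - q ^+ 2 by lra.
rewrite ler_pdivrMr//.
have xy : 2 / 3 * y <= x * y by rewrite ler_wpM2r.
apply: (@le_trans _ _ (2 * (2 / 3 * y / (1 - q ^+ 2)) * (1 - p ^+ 2))); last first.
  by rewrite ler_wpM2r ?(ltW ps)// ler_wpM2l// ler_wpM2r// invr_ge0 ltW.
have -> : 2 * (2 / 3 * y / (1 - q ^+ 2)) * (1 - p ^+ 2) = y * (4 / 3 * (1 - p ^+ 2)) / (1 - q ^+ 2).
  by field; rewrite gt_eqF.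
by rewrite ler_pdivlMr// ler_wpM2l.
Qed.

End Misc.

(** * The Loewner chain of an evolution family *)

Section Evolution.
Variables (R : realType) (d : \bar R) (phi : R -> R -> Cplx R -> Cplx R).
Hypothesis d1 : (1 <= d)%E.
Hypothesis ev : evolution_family d phi.
Implicit Types (s t u T r e : R) (z w : Cplx R).

Lemma ev_self s t : 0 <= s -> s <= t -> self_map (phi s t).
Proof.
have [H _ _ _] := ev; move=> s0 st; have [h1 h2] := H s t s0 st; split => z.
  by rewrite subr0 => z1; apply: h1; apply/diskP.
by move=> /diskP/h2/diskP.
Qed.

Lemma ev_id s z : 0 <= s -> cmod z < 1 -> phi s s z = z.
Proof. by have [_ H _ _] := ev; move=> s0 /diskP; exact: H. Qed.

Lemma ev_comp s u t z : 0 <= s -> s <= u -> u <= t -> cmod z < 1 ->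
  phi s t z = phi u t (phi s u z).
Proof. by have [_ _ H _] := ev; move=> s0 su ut /diskP; exact: H. Qed.

Let mT T := mrestr (@lebesgue_measure R) (measurable_itv (Interval (BLeft 0%R) (BRight T))).

Lemma ev_lip z T : cmod z < 1 -> 0 < T -> exists k : R -> R,
  [/\ k \in Lfun (mT T) d, forall x, 0 <= k x & forall s u t, 0 <= s -> s <= u -> u <= t ->
    t <= T -> ((cmod (phi s u z - phi s t z))%:E <= int_itv k u t)%E].
Proof.
have [_ _ _ H] := ev; move=> /diskP z1 T0; have [k [kd kP]] := H z T z1 T0.
exists (k \_ `[0, T]); split.
- exact: Ld_Lfun.
- by move=> x; rewrite /patch; case: ifP => // _; have [h _] := kd.
move=> s u t s0 su ut tT; rewrite -int_itv_restr//; first exact: kP.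
exact: le_trans su.
Qed.

Lemma ev_cont s z T : 0 <= s -> cmod z < 1 -> forall e, 0 < e ->
  exists2 dl : R, 0 < dl & forall u t, s <= u -> u <= t -> t <= T -> t - u <= dl ->
    cmod (phi s u z - phi s t z) <= e.
Proof.
move=> s0 z1 e e0; pose T' := Num.max T 1.
have T0 : 0 < T' by rewrite lt_max ltr01 orbT.
have [k [kL k0 kP]] := ev_lip z1 T0.
have [dl dl0 H] := int_itv_small d1 kL k0 e0; exists dl => // u t su ut tT tu.
have tT' : t <= T' by rewrite le_max tT.
rewrite -lee_fin; apply: le_trans (kP s u t s0 su ut tT') _.
by apply: H => //; exact: le_trans su.
Qed.

Lemma ev_orbit s z T : 0 <= s -> s <= T -> cmod z < 1 ->
  exists2 r : R, r < 1 & forall u, s <= u -> u <= T -> cmod (phi s u z) <= r.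
Proof.
move=> s0 sT z1; apply: (unif_cont_lt1 sT).
  move=> e e0; have [dl dl0 H] := @ev_cont s z T s0 z1 e e0; exists dl => // u t su ut tT tu.
  apply: le_trans (H u t su ut tT tu); rewrite ler_norml cmod_subr_le andbT lerNl opprB cmodB.
  exact: cmod_subr_le.
by move=> u su uT; have [_ h] := ev_self s0 su; exact: h.
Qed.

Let h : Cplx R := (2^-1 : R)%:C%C.
Let h1 : cmod h < 1. Proof. by rewrite /h cmod_half invf_lt1// ltr1n. Qed.

Lemma ev_displacement T : 0 < T -> exists k : R -> R,
  [/\ k \in Lfun (mT T) d, forall x, 0 <= k x & forall s t r z, 0 <= s -> s <= t -> t <= T ->
    cmod z <= r -> r < 1 -> ((cmod (phi s t z - z) * (1 - r))%:E <= int_itv k s t)%E].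
Proof.
move=> T0; have c01 : cmod (0 : Cplx R) < 1 by rewrite cmod0.
have [k0 [k0L k00 k0P]] := ev_lip c01 T0; have [kh [khL kh0 khP]] := ev_lip h1 T0.
have kL := Lfun_add d1 k0L khL; have kp x : 0 <= k0 x + kh x by rewrite addr_ge0.
exists (fun x => 60 * (k0 x + kh x)); split.
- exact: (Lfun_cmul d1 60 kL).
- by move=> x; rewrite mulr_ge0.
move=> s t r z s0 st tT zr r1.
apply: (@le_trans _ _ (60 * (cmod (phi s t 0) + cmod (phi s t h - h)))%:E).
  by rewrite lee_fin; exact: displacement (ev_self s0 st) zr r1.
rewrite (int_itvZ _ _ kL)// EFinM (int_itvD _ _ k0L khL)// lee_wpmul2l ?lee_fin//.
rewrite EFinD; apply: leeD.
  have := k0P s s t s0 (lexx s) st tT; rewrite ev_id//; by rewrite sub0r cmodN.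
by have := khP s s t s0 (lexx s) st tT; rewrite ev_id// cmodB.
Qed.

Lemma ev_small T r e : r < 1 -> 0 < e -> exists2 dl : R, 0 < dl & forall s t z,
  0 <= s -> s <= t -> t <= T -> t - s <= dl -> cmod z <= r -> cmod (phi s t z - z) <= e.
Proof.
move=> r1 e0; pose T' := Num.max T 1.
have T0 : 0 < T' by rewrite lt_max ltr01 orbT.
have [k [kL k0 kP]] := ev_displacement T0; have r0 : 0 < 1 - r by rewrite subr_gt0.
have [dl dl0 H] := int_itv_small d1 kL k0 (mulr_gt0 e0 r0); exists dl => // s t z s0 st tT ts zr.
have tT' : t <= T' by rewrite le_max tT.
rewrite -(ler_pM2r r0) -lee_fin; apply: le_trans (kP s t r z s0 st tT' zr r1) _.
exact: H.
Qed.

Lemma ev_near_id T r e : r < 1 -> 0 < e -> exists2 dl : R, 0 < dl & forall s t,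
  0 <= s -> s <= t -> t <= T -> t - s <= dl ->
  (forall z w, cmod z <= r -> cmod w <= r -> phi s t z = phi s t w -> z = w) /\
  (forall z, cmod z <= r -> cmod ('D_1 (phi s t) z - 1) <= e).
Proof.
move=> r1 e0; pose r2 := (1 + r) / 2; have r12 : r < r2 by rewrite /r2; lra.
have r21 : r2 < 1 by rewrite /r2; lra.
pose m := Num.min (e * (r2 - r) / 2) ((r2 - r) / 3).
have rp : 0 < r2 - r by lra.
have m0 : 0 < m by rewrite lt_min !divr_gt0// mulr_gt0.
have me : m <= e * (r2 - r) / 2 by rewrite ge_min lexx.
have m3 : m <= (r2 - r) / 3 by rewrite ge_min lexx orbT.
have [dl dl0 H] := @ev_small T r2 m r21 m0; exists dl => // s t s0 st tT ts.
have [hh _] := ev_self s0 st.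
have hr : holo 0 r2 (phi s t) by move=> z zr; apply: hh; exact: lt_trans r21.
have Gm z : cmod z < r2 -> cmod (phi s t z - z) <= m by move=> zr; apply: H => //; exact: ltW.
split; first by apply: (near_id_inj r12 hr Gm); lra.
move=> z zr; apply: le_trans (near_id_D r12 hr Gm zr) _.
by rewrite ler_pdivrMr//; lra.
Qed.

(** On [[s, t]] the orbits of [z] and [w] stay in a disk of radius [r < 1], on which short steps are
    injective. Equality at time [t] is therefore pulled back step by step to time [s]. *)
Lemma ev_inj s t z w : 0 <= s -> s <= t -> cmod z < 1 -> cmod w < 1 ->
  phi s t z = phi s t w -> z = w.
Proof.
move=> s0 st z1 w1.
have [rz rz1 Hz] := ev_orbit s0 st z1; have [rw rw1 Hw] := ev_orbit s0 st w1.
pose r := Num.max rz rw; have r1 : r < 1 by rewrite gt_max rz1.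
have [dl dl0 H] := @ev_near_id t r 1 r1 ltr01.
pose P u v := s <= u -> phi s v z = phi s v w -> phi s u z = phi s u w.
have : P s t.
  apply: (@small_steps_ind R P t dl dl0 _ _ s t s0 st (lexx t)).
    move=> a b a0 ab bt ba sa E; have [Hi _] := H a b a0 ab bt ba.
    apply: Hi; last by rewrite -!ev_comp.
      by rewrite le_max Hz// (le_trans ab).
    by rewrite le_max Hw ?orbT// (le_trans ab).
  move=> a b c a0 ab bc ct Pab Pbc sa E; apply: (Pab sa); apply: Pbc E.
  exact: le_trans ab.
by move=> /(_ (lexx s)) K /K; rewrite !ev_id.
Qed.

Let a t := phi 0 t 0.
Let c01 : cmod (0 : Cplx R) < 1. Proof. by rewrite cmod0. Qed.

(* Dividing by the complex number [ev_la t], rather than by its modulus, replaces the rotation that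
   would make the derivatives at [0] positive. *)
Definition ev_la t : Cplx R := 'D_1 (phi 0 t) 0 / (1 - cj (a t) * a t).
Definition ev_psi s t z : Cplx R := moebius (a t) (phi s t (moebius (- a s) z)).

Lemma a_lt1 t : 0 <= t -> cmod (a t) < 1.
Proof. by move=> t0; have [_ H] := ev_self (lexx 0) t0; exact: H. Qed.

Lemma aN_lt1 t : 0 <= t -> cmod (- a t) < 1.
Proof. by rewrite cmodN; exact: a_lt1. Qed.

Lemma phi_a s t : 0 <= s -> s <= t -> phi s t (a s) = a t.
Proof. by move=> s0 st; rewrite /a -ev_comp. Qed.

Lemma cmod_one_sub_sq (b : Cplx R) : cmod b < 1 -> cmod (1 - cj b * b) = 1 - cmod b ^+ 2.
Proof.
move=> b1; have -> : 1 - cj b * b = (1 - cmod b ^+ 2)%:C%C.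
  by rewrite rmorphB rmorph1 rmorphXn /= -[(cmod b)%:C%C]cmodE sqr_normc mulrC.
by rewrite cmod_real ger0_norm// subr_ge0 expr_le1 ?cmod_ge0// ltW.
Qed.

Lemma cmod_ev_la t : 0 <= t -> cmod (ev_la t) = cmod ('D_1 (phi 0 t) 0) / (1 - cmod (a t) ^+ 2).
Proof. by move=> t0; rewrite cmod_div cmod_one_sub_sq// a_lt1. Qed.

Lemma ev_derivable s t z : 0 <= s -> s <= t -> cmod z < 1 -> derivable (phi s t) z 1.
Proof. by move=> s0 st z1; have [H _] := ev_self s0 st; apply: H; rewrite subr0. Qed.

(** The orbit of [0] stays in a smaller disk up to time [T], where a short step has derivative close
    to [1] and moves [|a_s|] little. Both [ev_la_neq0] and the growth bound depend on it. *)
Lemma ev_la_steps T : exists2 dl : R, 0 < dl & forall s t, 0 <= s -> s <= t -> t <= T ->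
  t - s <= dl -> cmod (ev_la s) <= 2 * cmod (ev_la t).
Proof.
have [T0|T0] := leP 0 T; last by exists 1 => // s t s0 st tT _; lra.
have [al al1 Hal] := ev_orbit (lexx 0) T0 c01.
have al0 : 0 <= al by apply: le_trans (cmod_ge0 _) (Hal 0 (lexx 0) T0).
have A : 0 < 1 - al ^+ 2 by rewrite subr_gt0 expr_lt1.
have e30 : 0 < 3^-1 :> R by rewrite invr_gt0.
have [d2 d20 H2] := @ev_near_id T al _ al1 e30.
have e60 : 0 < (1 - al ^+ 2) / 6 by rewrite divr_gt0.
have [d3 d30 H3] := @ev_cont 0 0 T (lexx 0) c01 _ e60.
exists (Num.min d2 d3); first by rewrite lt_min d20.
move=> s t s0 st tT; rewrite le_min => /andP[ts2 ts3]; have t0 := le_trans s0 st.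
have as1 := Hal s s0 (le_trans st tT); have at1 := Hal t t0 tT.
have [_ K2] := H2 s t s0 st tT ts2; have {}K2 := K2 _ as1.
have K3 := H3 s t s0 st tT ts3.
rewrite !cmod_ev_la//; rewrite -/(a s) -/(a t) in as1 at1 K3 K2.
have -> : 'D_1 (phi 0 t) 0 = 'D_1 (phi s t) (a s) * 'D_1 (phi 0 s) 0.
  rewrite -D_comp; [|exact: ev_derivable|exact: ev_derivable (a_lt1 s0)].
  apply: (@D_near _ _ _ _ 1) => //; last first.
    by apply: derivable_compc; [exact: ev_derivable|exact: ev_derivable (a_lt1 s0)].
  by move=> w; rewrite subr0 => w1; rewrite /= [RHS](ev_comp (lexx 0) s0 st w1).
rewrite cmodM; apply: (step_bound (al := al)) => //; try exact: cmod_ge0.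
  by have := cmod_subr_le (a s) (a t); lra.
have far (x : Cplx R) : cmod (x - 1) <= 3^-1 -> 2 / 3 <= cmod x.
  by have := cmod_subr_le 1 (1 - x); rewrite subKr cmod1 cmodB; lra.
exact: far K2.
Qed.

Lemma ev_la0 : ev_la 0 = 1.
Proof.
rewrite /ev_la; have -> : a 0 = 0 by rewrite /a ev_id.
rewrite mulr0 subr0 divr1.
have di : derivable (id : Cplx R -> Cplx R) 0 1 by exact: derivable_id.
have eqid w : cmod (w - 0) < 1 -> id w = phi 0 0 w by rewrite subr0 => w1; rewrite ev_id.
by rewrite (D_near ltr01 eqid di) derive_id.
Qed.

Lemma ev_la_neq0 t : 0 <= t -> ev_la t != 0.
Proof.
move=> t0; have [dl dl0 H] := ev_la_steps t.
pose P s u := ev_la s != 0 -> ev_la u != 0.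
have : P 0 t.
  apply: (@small_steps_ind R P t dl dl0 _ _ 0 t (lexx 0) t0 (lexx t)).
    move=> b c b0 bc ct cb; rewrite /P -!cmod_gt0 => lb.
    by have := H b c b0 bc ct cb; lra.
  by move=> b c e' b0 bc ce et Pbc Pce /Pbc/Pce.
by apply; rewrite ev_la0 oner_eq0.
Qed.

Lemma ev_la_D t : 0 <= t -> 'D_1 (moebius (a t) \o phi 0 t) 0 = ev_la t.
Proof.
move=> t0; have at1 := a_lt1 t0.
rewrite D_comp; [|exact: ev_derivable|exact: moebius_derivable at1 (ltW at1)].
by rewrite -/(a t) moebius_D// mulrC.
Qed.

Lemma ev_psi_self s t : 0 <= s -> s <= t -> self_map (ev_psi s t).
Proof.
move=> s0 st; apply: (@self_map_comp _ (phi s t \o moebius (- a s)) (moebius (a t))).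
  apply: self_map_comp; first exact: self_map_moebius (aN_lt1 s0).
  exact: ev_self.
exact: self_map_moebius (a_lt1 (le_trans s0 st)).
Qed.

Lemma moebius_neg_self b : moebius (- b) 0 = b :> Cplx R.
Proof. by rewrite moebius_0 opprK. Qed.

Lemma ev_psi0 s t : 0 <= s -> s <= t -> ev_psi s t 0 = 0.
Proof. by move=> s0 st; rewrite /ev_psi moebius_neg_self phi_a// moebius_self. Qed.

Lemma moebius_injective (b z w : Cplx R) : cmod b < 1 -> cmod z < 1 -> cmod w < 1 ->
  moebius b z = moebius b w -> z = w.
Proof. by move=> b1 z1 w1 E; rewrite -(moebiusK b1 z1) E moebiusK. Qed.

Lemma ev_psi_moebius s t z : 0 <= s -> cmod z < 1 ->
  ev_psi s t (moebius (a s) z) = moebius (a t) (phi s t z).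
Proof. by move=> s0 z1; rewrite /ev_psi moebiusK// a_lt1. Qed.

Lemma ev_normalized beta :
  (fun t : R => cmod ('D_1 (phi 0 t) 0) / (1 - cmod (phi 0 t 0) ^+ 2)) @ +oo --> beta ->
  normalized_family ev_psi ev_la beta.
Proof.
move=> lim; split.
- exact: ev_psi_self.
- exact: ev_psi0.
- move=> s t z w s0 st z1 w1 E; have t0 := le_trans s0 st.
  have nz := moebius_lt1 (aN_lt1 s0) z1; have nw := moebius_lt1 (aN_lt1 s0) w1.
  have [_ ps] := ev_self s0 st.
  apply: (moebius_injective (aN_lt1 s0) z1 w1).
  apply: (ev_inj s0 st nz nw).
  exact: (moebius_injective (a_lt1 t0) (ps _ nz) (ps _ nw) E).
- move=> s u t z s0 su ut z1; have u0 := le_trans s0 su.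
  have nz := moebius_lt1 (aN_lt1 s0) z1; have [_ ps] := ev_self s0 su.
  by rewrite /ev_psi moebiusK ?a_lt1// ?ps// (ev_comp s0 su ut nz).
- exact: ev_la_neq0.
- move=> s t s0 st; have t0 := le_trans s0 st.
  (* After multiplication by [la_s] this is the chain rule at [0] for [m_t o phi_{0,t} = psi_{s,t} o
     (m_s o phi_{0,s})], so the inverse of [m_s] is not differentiated. *)
  apply: (mulIf (ev_la_neq0 s0)); rewrite divfK ?ev_la_neq0//.
  have [hp _] := ev_psi_self s0 st.
  have z0 : moebius (a s) (phi 0 s 0) = 0 by exact: moebius_self.
  have d1' : derivable (moebius (a s) \o phi 0 s) 0 1.
    apply: derivable_compc; first exact: ev_derivable.
    exact: moebius_derivable (a_lt1 s0) (ltW (a_lt1 s0)).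
  have d2' : derivable (ev_psi s t) ((moebius (a s) \o phi 0 s) 0) 1.
    by rewrite /= z0; apply: hp; rewrite subr0.
  have := D_comp d1' d2'; rewrite [X in 'D_1 (ev_psi s t) X]z0 (ev_la_D s0) => <-.
  have eqn w : cmod (w - 0) < 1 -> (moebius (a t) \o phi 0 t) w =
      (ev_psi s t \o (moebius (a s) \o phi 0 s)) w.
    rewrite subr0 => w1; have [_ ps] := ev_self (lexx 0) s0.
    by rewrite /= ev_psi_moebius ?ps// (ev_comp (lexx 0) s0 st w1).
  have dmt : derivable (moebius (a t) \o phi 0 t) 0 1.
    apply: derivable_compc; first exact: ev_derivable.
    exact: moebius_derivable (a_lt1 t0) (ltW (a_lt1 t0)).
  by rewrite (D_near ltr01 eqn dmt); exact: ev_la_D.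
- exact: ev_la_steps.
- move=> e e0; move/cvgrPdist_le: lim => /(_ e e0)[M [_ HM]].
  (* The filter at [+oo] gives the estimate for [M < t] strictly, hence [M + 1]. *)
  exists (Num.max (M + 1) 0); first by rewrite le_max lexx orbT.
  move=> t; rewrite ge_max => /andP[Mt t0]; rewrite cmod_ev_la// distrC; apply: HM.
  by apply: lt_le_trans Mt; rewrite ltrDl.
Qed.

Section Chain.
Variables (beta : R) (g : R -> Cplx R -> Cplx R).
Hypothesis nf : normalized_family ev_psi ev_la beta.
Hypothesis gP : forall s r e, 0 <= s -> 0 < r -> r < 1 -> 0 < e ->
  exists2 T : R, s <= T & forall t z, T <= t -> cmod z <= r ->
    cmod (ev_psi s t z / ev_la t - g s z) <= e.

Definition chain t z : Cplx R := g t (moebius (a t) z).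

Lemma chain_assoc s t z : 0 <= s -> s <= t -> cmod z < 1 -> chain t (phi s t z) = chain s z.
Proof.
move=> s0 st z1; rewrite /chain -ev_psi_moebius// (limit_assoc nf gP)//.
exact: moebius_lt1 (a_lt1 s0) z1.
Qed.

Lemma chain_holo t : 0 <= t -> holo 0 1 (chain t).
Proof.
move=> t0 z; rewrite subr0 => z1; have at1 := a_lt1 t0.
apply: (@derivable_compc _ (moebius (a t)) (g t)).
  exact: moebius_derivable at1 (ltW z1).
by apply: (limit_holo nf gP t0); rewrite subr0; exact: moebius_lt1.
Qed.

Lemma chain_inj t z w : 0 <= t -> cmod z < 1 -> cmod w < 1 -> chain t z = chain t w -> z = w.
Proof.
move=> t0 z1 w1 E; have at1 := a_lt1 t0.
apply: (moebius_injective at1 z1 w1).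
exact: (limit_inj nf gP t0 (moebius_lt1 at1 z1) (moebius_lt1 at1 w1) E).
Qed.

(** Up to time [T] the points [a_t] stay in a smaller disk, so [moebius_bound] confines [m_t(z)] to
    one radius [q < 1]; the bound [koebe q / |la_t|] is largest at [T]. *)
Lemma chain_bounded T r : 0 <= T -> 0 <= r -> r < 1 -> exists2 M : R, 0 <= M &
  forall t z, 0 <= t -> t <= T -> cmod z <= r -> cmod (chain t z) <= M.
Proof.
move=> T0 r0 r1; have [al al1 Hal] := ev_orbit (lexx 0) T0 c01.
have al0 : 0 <= al by apply: le_trans (cmod_ge0 _) (Hal 0 (lexx 0) T0).
have [q q1 Hq] := moebius_bound al0 al1 r0 r1.
have q0 : 0 <= q.
  by apply: le_trans (cmod_ge0 _) (Hq 0 0 _ _); rewrite cmod0.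
exists (koebe q / cmod (ev_la T)); first by rewrite divr_ge0 ?cmod_ge0 ?koebe_ge0.
move=> t z t0 tT zr; have at1 := Hal t t0 tT.
have mq := Hq (a t) z at1 zr; have m1 := le_lt_trans mq q1.
apply: le_trans (limit_koebe nf gP t0 m1) _.
rewrite ler_pM ?invr_ge0 ?cmod_ge0 ?koebe_ge0 ?koebe_le ?cmod_ge0//.
by rewrite lef_pV2 ?posrE ?(la_gt0 nf)// (la_le nf).
Qed.

(** Since [f_s(z) = f_t(phi_{s,t}(z))], the increment in time is an increment of [f_t] in space,
    controlled by a Lipschitz constant uniform in [t <= T] times the displacement of [z]. *)
Lemma chain_order K T : compact K -> K `<=` @disk R -> 0 < T -> exists k : R -> R,
  Ld_nonneg d T k /\ forall z s t, K z -> 0 <= s -> s <= t -> t <= T ->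
    ((cmod (chain s z - chain t z))%:E <= int_itv k s t)%E.
Proof.
move=> cK Kd T0; have [r [r0 r1 Kr]] := compact_disk_radius cK Kd.
pose r1' := (1 + r) / 2; pose r2 := (3 + r) / 4.
have r12 : r1' < r2 by rewrite /r1' /r2; lra.
have r21 : r2 < 1 by rewrite /r2; lra.
have r20 : 0 <= r2 by rewrite /r2; lra.
have [M M0 HM] := chain_bounded (ltW T0) r20 r21.
have [k [kL k0 kP]] := ev_displacement T0.
pose L := 2 * M / (r2 - r1').
have rp : 0 < r2 - r1' by lra.
have L0 : 0 <= L by rewrite divr_ge0 ?(ltW rp)// mulr_ge0.
have rr : 0 < 1 - r by lra.
have c0 : 0 <= L / (1 - r) by rewrite divr_ge0 ?(ltW rr).
exists (fun x => L / (1 - r) * k x); split.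
  apply: Lfun_Ld; first exact: (Lfun_cmul d1 _ kL).
  by move=> x; rewrite mulr_ge0.
move=> z s t Kz s0 st tT; have t0 := le_trans s0 st.
have zr := Kr z Kz; have z1 := le_lt_trans zr r1.
rewrite (int_itvZ _ _ kL)//.
have key : cmod (chain s z - chain t z) <= L * cmod (phi s t z - z).
  have zr1 : cmod z <= r1' by rewrite /r1'; lra.
  rewrite -(chain_assoc s0 st z1).
  (* If [phi s t z] leaves the disk of radius [r1'], the displacement is at least [(1 - r) / 2], and
     [L] times it is at least [4 M], beyond the trivial bound [2 M]. *)
  have [yr|yr] := leP (cmod (phi s t z)) r1'.
    apply: (@bounded_lip _ (chain t) r1' r2 M r12) yr zr1.
      by move=> w wr; apply: (chain_holo t0); exact: lt_trans r21.
    by move=> w wr; apply: HM => //; exact: ltW.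
  rewrite (chain_assoc s0 st z1).
  have h2 : (1 - r) / 2 <= cmod (phi s t z - z).
    by have := cmod_subr_le (phi s t z) z; rewrite /r1' in yr; lra.
  apply: (@le_trans _ _ (2 * M)).
    apply: le_trans (cmodB_le _ _) _; rewrite mulr_natl mulr2n lerD// HM//; rewrite /r2; lra.
  apply: le_trans (ler_wpM2l L0 h2).
  rewrite /L (_ : r2 - r1' = (1 - r) / 4); last by rewrite /r2 /r1'; field.
  have -> : 2 * M / ((1 - r) / 4) * ((1 - r) / 2) = 4 * M by field; rewrite gt_eqF.
  lra.
apply: (@le_trans _ _ ((L / (1 - r)) * (cmod (phi s t z - z) * (1 - r)))%:E).
  by rewrite lee_fin mulrCA divfK ?gt_eqF// mulrC.
by rewrite EFinM lee_wpmul2l ?lee_fin// kP.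
Qed.

Lemma chain_loewner : loewner_chain d chain.
Proof.
split.
- move=> t t0; split; first by move=> z /diskP z1; apply: (chain_holo t0); rewrite subr0.
  by move=> z w /diskP z1 /diskP w1; exact: chain_inj.
- move=> s t s0 st _ [z /diskP z1 <-]; exists (phi s t z).
    by apply/diskP; have [_ H] := ev_self s0 (ltW st); exact: H.
  exact: (chain_assoc s0 (ltW st) z1).
- exact: chain_order.
Qed.

Lemma chain_normalized : normalized_chain chain.
Proof.
have a0 : a 0 = 0 by rewrite /a ev_id.
have E : chain 0 = g 0 by apply/funext => z; rewrite /chain a0 moebius0.
split; first by rewrite E (limit_0 nf gP).
by rewrite E (limit_D nf gP)// ev_la0 invr1.
Qed.

Lemma chain_union : \bigcup_(t in [set t : R | 0 <= t]) (chain t @` (@disk R)) =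
  if 0 < beta then [set w : Cplx R | cmod w < beta^-1] else setT.
Proof.
rewrite -(limit_union nf gP); apply: eq_bigcupr => t /= t0; have at1 := a_lt1 t0.
apply/seteqP; split => _ [z z1 <-].
  by move/diskP: z1 => z1; exists (moebius (a t) z) => //; exact: moebius_lt1.
exists (moebius (- a t) z); last by rewrite /chain moebiusVK.
by apply/diskP; apply: moebius_lt1 z1; exact: aN_lt1.
Qed.

End Chain.
End Evolution.

Theorem theorem3p3 (R : realType) (d : \bar R)
    (phi : R -> R -> Cplx R -> Cplx R) (beta : R) :
  (1 <= d)%E ->
  evolution_family d phi ->
  (fun t : R => cmod ('D_1 (phi 0 t) 0) / (1 - cmod (phi 0 t 0) ^+ 2))
     @ +oo --> beta ->
  exists f : R -> Cplx R -> Cplx R,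
    [/\ loewner_chain d f, normalized_chain f, associated_chain f phi &
        \bigcup_(t in [set t : R | 0 <= t]) (f t @` (@disk R)) =
          (if 0 < beta then [set w : Cplx R | cmod w < beta^-1] else setT)].
Proof.
move=> d1 ev lim; have nf := ev_normalized d1 ev lim.
have [g gP] := rescaled_limit_exists nf; exists (chain phi g); split.
- exact: (chain_loewner d1 ev nf gP).
- exact: (chain_normalized ev nf gP).
- by move=> s t z s0 st /diskP z1; exact: (chain_assoc ev nf gP).
- exact: (chain_union ev nf gP).
Qed.
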